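(* Let $\xi$ be a non-negative integer-valued random variable with $\mathbb{E}\xi=1$ and $0<\mathrm{Var}(\xi)<\infty$, let $\mathcal{T}$ be the Galton-Watson tree with offspring distribution $\xi$, and let $\mathcal{T}_n$ be $\mathcal{T}$ conditioned on $|\mathcal{T}|=n$. For a plane tree $T$ let $\pi^{\mathrm{nf}}(T):=\mathbb{P}(T\prec\mathcal{T})$ and let $N^{\mathrm{nf}}_T(\mathcal{T}_n)$ be the number of nodes $v$ of $\mathcal{T}_n$ with $T\prec\mathcal{T}_{n,v}$. Let $T_n$ be a sequence of plane trees with $|T_n|=k_n$, where $k_n\to\infty$ and $k_n=o(n)$. Then, as $n\to\infty$: (i) if $n\pi^{\mathrm{nf}}(T_n)\to0$, then $N^{\mathrm{nf}}_{T_n}(\mathcal{T}_n)\to0$ in probability; (ii) if $n\pi^{\mathrm{nf}}(T_n)\to\infty$, then $N^{\mathrm{nf}}_{T_n}(\mathcal{T}_n)/\big(n\pi^{\mathrm{nf}}(T_n)\big)\to1$ in probability.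
   Context: A plane tree is a finite rooted, ordered, unlabeled tree; $|T|$ is its number of nodes. For a node $v$ of $T$, the fringe subtree $T_v$ is the subtree consisting of $v$ and all its descendants, and $\mathcal{T}_{n,v}$ is the fringe subtree of $\mathcal{T}_n$ at $v$. For plane trees $T',S$, write $T'\prec S$ ($S$ has a non-fringe subtree of shape $T'$ at its root) if $S$ can be made isomorphic to $T'$ by replacing some or none of its fringe subtrees with leaves (nodes without children). The Galton-Watson tree $\mathcal{T}$ is generated from the root by giving each node independently a number of children distributed as $\xi$. Let $p_i=\mathbb{P}(\xi=i)$ and let $h=\gcd\{i\ge1:p_i>0\}$ be the span. Then $\mathbb{P}(|\mathcal{T}|=n)>0$ for all large $n$ with $n\equiv1\pmod h$; all limits as $n\to\infty$ are taken along such $n$. *)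

(* Defs.v *)
From HB Require Import structures.
From mathcomp Require Import all_boot all_order all_algebra.
From mathcomp Require Import all_classical all_reals all_analysis.
Set Implicit Arguments.
Unset Strict Implicit.
Unset Printing Implicit Defensive.
Import Order.TTheory GRing.Theory Num.Theory.
Import numFieldNormedType.Exports.
Local Open Scope classical_set_scope.
Local Open Scope ring_scope.

(* A finite rooted ordered tree, given by the list of its root branches. *)
Inductive plane_tree := Node of seq plane_tree.

Definition leaf : plane_tree := Node [::].

Fixpoint tree_size (t : plane_tree) : nat :=
  let: Node ts := t in (sumn (map tree_size ts)).+1.

(* The fringe subtrees T_v, listed with one entry per node v. *)
Fixpoint fringe_subtrees (t : plane_tree) : seq plane_tree :=
  let: Node ts := t in t :: flatten (map fringe_subtrees ts).

(* Nodes are addressed by words (Ulam-Harris): [::] is the root and i :: u is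
   the node u of the i-th branch.  [prune A t] replaces the fringe subtree of t
   at every node whose address is in A by a leaf; if one node of A lies below
   another, only the upper one matters. *)
Fixpoint prune (A : pred (seq nat)) (t : plane_tree) : plane_tree :=
  if A [::] then leaf else
  let: Node ts := t in
  Node ((fix prune_branches (i : nat) (ss : seq plane_tree) : seq plane_tree :=
           if ss is s :: ss' then
             prune (fun u => A (i :: u)) s :: prune_branches i.+1 ss'
           else [::]) 0%N ts).

(* T' \prec S *)
Definition nonfringe (T' S : plane_tree) : Prop :=
  exists A : pred (seq nat), prune A S = T'.

(* N^nf_T(S): the number of nodes v of S with T \prec S_v *)
Definition Nnf (T S : plane_tree) : nat :=
  count (fun Sv => `[< nonfringe T Sv >]) (fringe_subtrees S).

(* [grown c t]: the tree generated from the root by giving c u children to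
   each node u is finite and equal to t. *)
Fixpoint grown (c : seq nat -> nat) (t : plane_tree) : Prop :=
  let: Node ts := t in
  size ts = c [::] /\
  (fix grown_branches (i : nat) (ss : seq plane_tree) : Prop :=
     if ss is s :: ss' then
       grown (fun u => c (i :: u)) s /\ grown_branches i.+1 ss'
     else True) 0%N ts.

Section probability_notions.
Context {R : realType} {d : measure_display} {Omega : measurableType d}.
Variable P : probability Omega R.

Definition mutually_independent {I : choiceType} {d'} {E : measurableType d'}
    (X : I -> {RV P >-> E}) : Prop :=
  forall (s : seq I) (A : I -> set E), uniq s -> (forall i, measurable (A i)) ->
    P [set w | forall i, i \in s -> A i (X i w)] =
    (\prod_(i <- s) P (X i @^-1` A i))%E.

(* The X i are independent copies of xi, where xi may live on another space. *)
Definition iid_copies {I : choiceType} {d'} {E : measurableType d'}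
    {d0} {Omega0 : measurableType d0} {P0 : probability Omega0 R}
    (xi : {RV P0 >-> E}) (X : I -> {RV P >-> E}) : Prop :=
  mutually_independent X /\
  forall i (A : set E), measurable A ->
    distribution P (X i) A = distribution P0 xi A.

(* h = gcd {i >= 1 : P(xi = i) > 0} *)
Definition is_span (xi : {RV P >-> nat}) (h : nat) : Prop :=
  forall m : nat, (m %| h)%N <->
    (forall i : nat, (1 <= i)%N -> (0 < P (xi @^-1` [set i]))%E -> (m %| i)%N).

Variable X : seq nat -> {RV P >-> nat}.

(* P(tau \in A), where X u is the number of children of the node u of the
   random tree tau (the value is irrelevant if u is not a node of tau), and A is a
   set of plane trees, hence of finite trees. *)
Definition prGW (A : set plane_tree) : R :=
  fine (P [set w | exists2 t, grown (fun u => X u w) t & A t]).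

(* P(tau_n \in A) = P(tau \in A | |tau| = n), with value 0 if P(|tau| = n) = 0 *)
Definition prGWn (n : nat) (A : set plane_tree) : R :=
  prGW (A `&` [set t | tree_size t = n]) / prGW [set t | tree_size t = n].

Definition pi_nf (T : plane_tree) : R := prGW [set S | nonfringe T S].

(* f_n(tau_n) -> c in probability as n -> oo along F *)
Definition cvg_in_probability (F : set_system nat)
    (f : nat -> plane_tree -> R) (c : R) : Prop :=
  forall e : R, 0 < e -> prGWn n [set t | e < `|f n t - c|] @[n --> F] --> (0 : R).

End probability_notions.

(* n -> oo along n = 1 (mod h) *)
Definition along (h : nat) : set_system nat :=
  within [set n : nat | n = 1 %[mod h]] \oo.

(* Main.v *)
Require Import Defs.
From HB Require Import structures.
From mathcomp Require Import all_boot all_order all_algebra.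
From mathcomp Require Import all_classical all_reals all_analysis.
From mathcomp Require Import measurable_realfun ring lra zify.
Import Order.TTheory GRing.Theory Num.Theory.
Import numFieldNormedType.Exports.
Local Open Scope classical_set_scope.
Local Open Scope ring_scope.
Set Implicit Arguments.
Unset Strict Implicit.
Unset Printing Implicit Defensive.

(** Notation: p_i is the probability of i children, S_N the sum of N independent
    offspring numbers; the pattern T has m internal nodes and l leaves, hence
    k = m + l nodes.

    The relation T \prec S prescribes the numbers of children at the internal
    nodes of T and nothing else, and a critical Galton-Watson tree is almost
    surely finite ([prob_finite_tree]).  Hence pi^nf(T) is the product of the
    p_i over the internal nodes of T ([pi_nfE]).  Moreover, removing these
    nodes from a tree S with T \prec S leaves an arbitrary ordered forest of l
    trees ([forests_pattern]).  Together with an induction that deletes the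
    root of the first tree of a forest, this turns every expectation over trees
    of size n into a point probability of the random walk:
    - n P(size n) = P(S_n = n - 1)  ([forest_sum_one]);
    - E(N; size n) = pi^nf(T) P(S_(n-m) = n - k)  ([forest_sum_occ]);
    - E(N^2; size n) <= (n - 2m + 1) pi^nf(T)^2 P(S_(n-2m) = n - 2k + 1)
      + 2 \sum_Q E(N_Q; size n)  ([forest_sum_occ_sqr]),
    where N = N^nf_T and Q runs over the trees obtained from T by replacing the
    fringe subtree at an internal node by T itself.  The last sum accounts for
    overlapping occurrences.  As p_i <= 1 - p_0 < 1 for i > 0, the total weight
    of these Q is at most pi^nf(T) / p_0 ([sum_grafts]).

    The point probabilities are compared without Fourier analysis.  For some r
    the law of S_r has two atoms at distance h, so that the generating function
    to the power r is theta X^y (1 + X^h) plus a polynomial with nonnegative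
    coefficients.  Thus S_N contains h times a binomial variable with random
    parameter, and elementary estimates of binomial coefficients give
    (for xi / h instead of xi)
    P(S_N = j) <= C / sqrt N ([walk_prob_upper]), P(S_n = n - 1) >= c / sqrt n
    ([walk_prob_lower]) and
    |P(S_n = j) - P(S_(n-M) = j - D)| <= C (M + D) / (n - M)
    when h divides D ([walk_prob_shift]).

    Part (i) is then the Markov inequality.  For part (ii), p_i i^2 is bounded
    and p_i <= 1 - p_0, which bounds (k - 1) sqrt(pi^nf(T))
    ([size_sqrt_pattern_weight]); so n pi^nf(T) -> oo forces k = o(sqrt n), the
    ratios of point probabilities tend to 1, the overlaps contribute
    O(n pi^nf(T)), and the Chebyshev inequality applies ([tail_bounds]). *)

(** * Patterns, forests and cutting *)

Lemma le_of_eq (R : numDomainType) (x y : R) : x = y -> x <= y.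
Proof. by move=> ->. Qed.

Lemma expr_1B_le (R : realFieldType) (x : R) k : 0 <= x <= 1 ->
  1 - x ^+ k <= k%:R * (1 - x).
Proof.
move=> /andP[x0 x1]; elim: k => [|k IH]; first by rewrite expr0 subrr mul0r.
have : 0 <= x ^+ k by exact: exprn_ge0.
have : x ^+ k <= 1 by exact: exprn_ile1.
by rewrite exprS -[k.+1%:R]natr1; nra.
Qed.

(** Classical equality; trees only have to be listed without repetition. *)
HB.instance Definition _ := gen_eqMixin plane_tree.
HB.instance Definition _ := gen_choiceMixin plane_tree.

(** The automatic induction principle of a nested inductive type provides no
    hypothesis for the branches.  A statement on trees is proved together with
    a companion statement on forests. *)
Lemma tree_forest_ind (Qt : plane_tree -> Prop) (Qf : seq plane_tree -> Prop) :
  (forall ts, Qf ts -> Qt (Node ts)) -> Qf [::] ->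
  (forall t ts, Qt t -> Qf ts -> Qf (t :: ts)) ->
  (forall t, Qt t) /\ (forall ts, Qf ts).
Proof.
move=> QN Q0 QS.
have QT : forall t, Qt t.
  fix IH 1; case=> ts; apply: QN; elim: ts => [|t ts IHts] //.
  by apply: QS => //; apply: IH.
by split=> //; elim=> [|t ts IHts]; [|apply: QS].
Qed.

Definition branches (t : plane_tree) : seq plane_tree := let: Node ts := t in ts.

Fixpoint inner_nodes (t : plane_tree) : nat :=
  let: Node ts := t in if ts is [::] then 0%N else (sumn (map inner_nodes ts)).+1.

Fixpoint leaves (t : plane_tree) : nat :=
  let: Node ts := t in if ts is [::] then 1%N else sumn (map leaves ts).

(** The relation \prec, decided by a simultaneous descent: a leaf of the pattern
    is matched by every tree. *)
Fixpoint prec (T S : plane_tree) : bool :=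
  let: Node ts := T in
  if ts is [::] then true else let: Node ss := S in all2 prec ts ss.

Section ListRecursors.
Variables (A B C : Type).

Fixpoint flatmap2 (f : A -> B -> seq C) (s : seq A) (t : seq B) : seq C :=
  match s, t with x :: s', y :: t' => f x y ++ flatmap2 f s' t' | _, _ => [::] end.

Fixpoint split_map (l : A -> nat) (f : A -> seq B -> C) (s : seq A) (t : seq B) :
    seq C :=
  if s is x :: s' then f x (take (l x) t) :: split_map l f s' (drop (l x) t)
  else [::].
End ListRecursors.

(** The forest that remains of S when the internal nodes of T are removed; the
    inverse operation is [fill]. *)
Fixpoint cut (T S : plane_tree) : seq plane_tree :=
  let: Node ts := T in
  if ts is [::] then [:: S] else let: Node ss := S in flatmap2 cut ts ss.

Fixpoint fill (T : plane_tree) (phi : seq plane_tree) : plane_tree :=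
  let: Node ts := T in
  if ts is [::] then head leaf phi else Node (split_map leaves fill ts phi).

Definition forest_size (phi : seq plane_tree) : nat := sumn (map tree_size phi).

Lemma forest_size_cat phi psi :
  forest_size (phi ++ psi) = (forest_size phi + forest_size psi)%N.
Proof. by rewrite /forest_size map_cat sumn_cat. Qed.

Lemma forest_size_cons t phi :
  forest_size (t :: phi) = (tree_size t + forest_size phi)%N.
Proof. by []. Qed.

Lemma tree_size_Node ts : tree_size (Node ts) = (forest_size ts).+1.
Proof. by []. Qed.

Lemma leaves_gt0 t : (0 < leaves t)%N.
Proof.
move: t; apply (@proj1 _ (forall ts, (0 < size ts)%N -> 0 < sumn (map leaves ts))%N).
apply: tree_forest_ind => //= [[|t ts] IH|t ts IHt IHts _] //=; first exact: IH.
by rewrite addn_gt0 IHt.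
Qed.

Lemma tree_sizeE t : tree_size t = (inner_nodes t + leaves t)%N.
Proof.
move: t; apply (@proj1 _
  (forall ts, forest_size ts = (sumn (map inner_nodes ts) + sumn (map leaves ts))%N)).
apply: tree_forest_ind => [[|t ts] IH||t ts] //=; first by rewrite addSn -IH.
by rewrite /forest_size /= => -> ->; lia.
Qed.

Lemma size_cut T S : prec T S -> size (cut T S) = leaves T.
Proof.
move: T S; apply (@proj1 _ (forall ts ss, all2 prec ts ss ->
   size (flatmap2 cut ts ss) = sumn (map leaves ts))).
apply: tree_forest_ind => [[|t ts] IH [ss]|[]|t ts IHt IHts [|s ss]] //.
- exact: IH.
- by move=> /= /andP[ps pss]; rewrite size_cat IHt // IHts.
Qed.

Lemma cutK T S : prec T S -> fill T (cut T S) = S.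
Proof.
move: T S; apply (@proj1 _ (forall ts ss, all2 prec ts ss ->
   split_map leaves fill ts (flatmap2 cut ts ss) = ss)).
apply: tree_forest_ind => [[|t ts] IH [ss]|[]|t ts IHt IHts [|s ss]] //.
- by move=> pss; congr Node; apply: IH.
- move=> /= /andP[ps pss].
  by rewrite take_size_cat ?size_cut // drop_size_cat ?size_cut // IHt ?IHts.
Qed.

Lemma prec_fill T phi : size phi = leaves T -> prec T (fill T phi).
Proof.
move: T phi; apply (@proj1 _ (forall ts phi, size phi = sumn (map leaves ts) ->
   all2 prec ts (split_map leaves fill ts phi))).
apply: tree_forest_ind => [[|t ts] IH phi|[]|t ts IHt IHts phi] //.
- exact: IH.
- move=> sz; have sz' : size (take (leaves t) phi) = leaves t.
    by rewrite size_takel // sz leq_addr.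
  by rewrite /= IHt // IHts // size_drop sz addKn.
Qed.

Lemma fillK T phi : size phi = leaves T -> cut T (fill T phi) = phi.
Proof.
move: T phi; apply (@proj1 _ (forall ts phi, size phi = sumn (map leaves ts) ->
   flatmap2 cut ts (split_map leaves fill ts phi) = phi)).
apply: tree_forest_ind => [[|t ts] IH [|s phi]|[]|t ts IHt IHts phi] //.
- by case: phi.
- exact: IH.
- exact: IH.
- move=> sz; have sz' : size (take (leaves t) phi) = leaves t.
    by rewrite size_takel // sz leq_addr.
  by rewrite /= IHt // IHts ?cat_take_drop // size_drop sz addKn.
Qed.

Lemma tree_size_cut T S :
  prec T S -> tree_size S = (inner_nodes T + forest_size (cut T S))%N.
Proof.
move: T S; apply (@proj1 _ (forall ts ss, all2 prec ts ss ->
   forest_size ss = (sumn (map inner_nodes ts) + forest_size (flatmap2 cut ts ss))%N)).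
apply: tree_forest_ind => [[|t ts] IH [ss]|[]|t ts IHt IHts [|s ss]] //.
- by rewrite /= /forest_size /= addn0.
- by move=> pss; rewrite tree_size_Node (IH ss pss).
- move=> /= /andP[ps pss]; rewrite forest_size_cat.
  by rewrite forest_size_cons (IHt _ ps) (IHts _ pss) addnACA.
Qed.

(** The forests of r trees with n nodes in total.  Deleting the root of the
    first tree leaves its d branches followed by the other r - 1 trees; this
    recursion on n underlies all the moment computations. *)
Fixpoint forests (n r : nat) : seq (seq plane_tree) :=
  match n, r with
  | 0%N, 0%N => [:: [::]]
  | n'.+1, r'.+1 =>
      [seq Node (take d phi) :: drop d phi | d <- iota 0 n'.+1,
                                             phi <- forests n' (d + r')]
  | _, _ => [::]
  end.

Lemma size_le_forest_size phi : (size phi <= forest_size phi)%N.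
Proof.
elim: phi => //= t phi IH; rewrite forest_size_cons.
by case: t => ts; rewrite tree_size_Node addSn ltnS (leq_trans IH) // leq_addl.
Qed.

Lemma forestsSS n r : forests n.+1 r.+1 =
  [seq Node (take d phi) :: drop d phi | d <- iota 0 n.+1, phi <- forests n (d + r)].
Proof. by []. Qed.

Lemma mem_forests n r phi :
  (phi \in forests n r) = (size phi == r) && (forest_size phi == n).
Proof.
elim: n r phi => [|n IH] [|r] phi.
- by case: phi => [|[ts] phi].
- by case: phi => [|[ts] phi]; rewrite //= forest_size_cons andbF.
- by case: phi => [|[ts] phi].
rewrite forestsSS; apply/allpairsPdep/andP => [[d [psi []]]|].
- rewrite mem_iota add0n => /andP[_ dn]; rewrite IH => /andP[/eqP sz /eqP fs] ->.
  rewrite /= size_drop sz addKn eqxx; split=> //.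
  rewrite forest_size_cons tree_size_Node addSn eqSS.
  by rewrite -forest_size_cat cat_take_drop fs.
case: phi => [|[ts] phi] [] // /eqP[sz].
rewrite forest_size_cons tree_size_Node addSn eqSS => /eqP fs.
have fs' : forest_size (ts ++ phi) = n by rewrite forest_size_cat.
exists (size ts), (ts ++ phi); split.
- rewrite mem_iota add0n ltnS -fs'.
  by rewrite (leq_trans _ (size_le_forest_size _)) // size_cat leq_addr.
- by rewrite IH size_cat sz fs' !eqxx.
- by rewrite take_size_cat // drop_size_cat.
Qed.

Lemma forests_uniq n r : uniq (forests n r).
Proof.
elim: n r => [|n IH] [|r] //; rewrite forestsSS.
apply: allpairs_uniq_dep => [|d _|]; [exact: iota_uniq|exact: IH|].
move=> _ _ /allpairsPdep[d [phi [_ Hphi ->]]] /allpairsPdep[e [psi [_ Hpsi ->]]] /=.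
move: Hphi Hpsi; rewrite !mem_forests => /andP[/eqP sd _] /andP[/eqP se _].
case=> E1 E2.
have Ed : d = e.
  by have := congr1 size E1; rewrite !size_takel ?sd ?se ?leq_addr.
by rewrite -(cat_take_drop d phi) -(cat_take_drop e psi) E1 E2 Ed.
Qed.

(** Cutting the first tree at the leaves of T is a bijection onto all forests
    with the right number of trees and nodes. *)
Lemma forests_pattern T r n : (inner_nodes T <= n)%N ->
  perm_eq [seq phi <- forests n r.+1 | prec T (head leaf phi)]
          [seq fill T (take (leaves T) psi) :: drop (leaves T) psi
             | psi <- forests (n - inner_nodes T) (leaves T + r)].
Proof.
move=> Tn; apply: uniq_perm.
- exact/filter_uniq/forests_uniq.
- rewrite map_inj_in_uniq ?forests_uniq // => phi psi.
  rewrite !mem_forests => /andP[/eqP sphi _] /andP[/eqP spsi _] [E1 E2].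
  rewrite -(cat_take_drop (leaves T) phi) -(cat_take_drop (leaves T) psi) E2.
  congr (_ ++ _); rewrite -(@fillK T (take _ phi)) ?size_takel ?sphi ?leq_addr //.
  by rewrite E1 fillK // ?size_takel ?spsi ?leq_addr.
move=> phi; rewrite mem_filter mem_forests.
apply/idP/mapP => [/and3P[pT sz fs]|[psi]].
- case: phi pT sz fs => // t phi /= pT; rewrite eqSS => /eqP sz /eqP fs.
  exists (cut T t ++ phi).
    rewrite mem_forests size_cat size_cut // sz eqxx /= forest_size_cat.
    by rewrite -fs forest_size_cons (tree_size_cut pT) -addnA addKn.
  by rewrite take_size_cat ?size_cut // drop_size_cat ?size_cut // cutK.
- rewrite mem_forests => /andP[/eqP sz /eqP fs] ->.
  have sz' : size (take (leaves T) psi) = leaves T.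
    by rewrite size_takel // sz leq_addr.
  rewrite /= prec_fill // size_drop sz addKn eqxx /= forest_size_cons.
  rewrite (tree_size_cut (prec_fill sz')) fillK // -addnA.
  by rewrite -forest_size_cat cat_take_drop fs subnKC.
Qed.

(** * Weighted sums over forests *)
Section Weights.
Variables (R : realFieldType) (p : nat -> R).

Fixpoint tree_weight (t : plane_tree) : R :=
  let: Node ts := t in p (size ts) * foldr (fun s x => tree_weight s * x) 1 ts.

Definition forest_weight (phi : seq plane_tree) : R := foldr (fun s x => tree_weight s * x) 1 phi.

(** Only the internal nodes of a pattern carry a condition. *)
Fixpoint pattern_weight (T : plane_tree) : R :=
  let: Node ts := T in
  if ts is [::] then 1 else p (size ts) * foldr (fun s x => pattern_weight s * x) 1 ts.

Lemma tree_weight_Node ts : tree_weight (Node ts) = p (size ts) * forest_weight ts. Proof. by []. Qed.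

Lemma forest_weight_cat phi psi : forest_weight (phi ++ psi) = forest_weight phi * forest_weight psi.
Proof.
by rewrite /forest_weight; elim: phi => [|t phi IH] /=; rewrite ?mul1r // IH mulrA.
Qed.

Lemma tree_weight_cut T S : prec T S -> tree_weight S = pattern_weight T * forest_weight (cut T S).
Proof.
move: T S; apply (@proj1 _ (forall ts ss, all2 prec ts ss -> size ss = size ts /\
   forest_weight ss = foldr (fun s x => pattern_weight s * x) 1 ts * forest_weight (flatmap2 cut ts ss))).
apply: tree_forest_ind => [[|t ts] IH [ss]|[]|t ts IHt IHts [|s ss]] //.
- by rewrite /= !mul1r mulr1.
- by move=> pss; have [sz E] := IH _ pss; rewrite tree_weight_Node E sz mulrA.
- by rewrite /= mulr1.
- move=> /= /andP[ps pss]; have [sz E] := IHts _ pss.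
  by rewrite sz forest_weight_cat /= -/(forest_weight _) E IHt //; split=> //; ring.
Qed.

Definition forest_sum (n r : nat) (F : seq plane_tree -> R) : R :=
  \sum_(phi <- forests n r) forest_weight phi * F phi.

Lemma forest_sum0S r F : forest_sum 0 r.+1 F = 0. Proof. by rewrite /forest_sum big_nil. Qed.

Lemma forest_sum00 F : forest_sum 0 0 F = F [::].
Proof. by rewrite /forest_sum big_seq1 mul1r. Qed.

Lemma forest_sumS0 n F : forest_sum n.+1 0 F = 0. Proof. by rewrite /forest_sum big_nil. Qed.

(** The recursion of [forests], as a one-step analysis of the walk that counts
    the trees still to be explored. *)
Lemma forest_sum_root n r F : forest_sum n.+1 r.+1 F =
  \sum_(d < n.+1) p d *
     forest_sum n (d + r) (fun phi => F (Node (take d phi) :: drop d phi)).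
Proof.
rewrite /forest_sum forestsSS big_allpairs_dep /= -(big_mkord xpredT (fun d => p d *
  \sum_(phi <- forests n (d + r)) forest_weight phi * F (Node (take d phi) :: drop d phi))).
rewrite /index_iota subn0; apply: eq_bigr => d _; rewrite big_distrr /=.
rewrite !big_seq; apply: eq_bigr => phi; rewrite mem_forests => /andP[/eqP sz _].
rewrite mulrA; congr (_ * _); rewrite /= size_takel ?sz ?leq_addr // -!/(forest_weight _).
by rewrite -mulrA -forest_weight_cat cat_take_drop.
Qed.

Lemma forest_sum_pattern T n r F : (inner_nodes T <= n)%N ->
  forest_sum n r.+1 (fun phi => (prec T (head leaf phi))%:R *
     F (cut T (head leaf phi) ++ behead phi)) =
  pattern_weight T * forest_sum (n - inner_nodes T) (leaves T + r) F.
Proof.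
move=> Tn; rewrite /forest_sum big_distrr /=.
transitivity (\sum_(phi <- [seq phi <- forests n r.+1 | prec T (head leaf phi)])
   forest_weight phi * F (cut T (head leaf phi) ++ behead phi)).
  rewrite big_filter [RHS]big_mkcond /=; apply: eq_bigr => phi _.
  by case: (prec _ _); rewrite ?mul1r ?mul0r ?mulr0.
rewrite (perm_big _ (forests_pattern r Tn)) /= big_map.
rewrite !big_seq; apply: eq_bigr => psi; rewrite mem_forests => /andP[/eqP sz _].
have sz' : size (take (leaves T) psi) = leaves T.
  by rewrite size_takel // sz leq_addr.
rewrite /= -/(forest_weight _) (tree_weight_cut (prec_fill sz')) fillK // cat_take_drop.
by rewrite -[pattern_weight T * _ * _]mulrA -forest_weight_cat cat_take_drop mulrA.
Qed.

Lemma forest_sumD n r F G : forest_sum n r (fun phi => F phi + G phi) = forest_sum n r F + forest_sum n r G.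
Proof. by rewrite /forest_sum -big_split /=; apply: eq_bigr => phi _; rewrite mulrDr. Qed.

Lemma forest_sumZ n r c F : forest_sum n r (fun phi => c * F phi) = c * forest_sum n r F.
Proof. by rewrite /forest_sum big_distrr /=; apply: eq_bigr => phi _; rewrite mulrCA. Qed.

Lemma forest_sum_sum n r (I : Type) (s : seq I) F :
  forest_sum n r (fun phi => \sum_(i <- s) F i phi) = \sum_(i <- s) forest_sum n r (F i).
Proof. by rewrite /forest_sum [RHS]exchange_big /=; apply: eq_bigr => phi _; rewrite big_distrr. Qed.

Lemma eq_forest_sum n r F G : (forall phi, size phi = r -> F phi = G phi) ->
  forest_sum n r F = forest_sum n r G.
Proof.
move=> FG; rewrite /forest_sum !big_seq; apply: eq_bigr => phi; rewrite mem_forests.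
by move=> /andP[/eqP sz _]; rewrite FG.
Qed.

Hypothesis p_ge0 : forall d, 0 <= p d.

Lemma forest_weight_ge0 phi : 0 <= forest_weight phi.
Proof.
move: phi; apply (@proj2 (forall t, 0 <= tree_weight t)); apply: tree_forest_ind => //=.
- by move=> ts IH; rewrite mulr_ge0.
- by move=> t ts IHt IHts; rewrite mulr_ge0.
Qed.

Lemma le_forest_sum n r F G : (forall phi, size phi = r -> F phi <= G phi) ->
  forest_sum n r F <= forest_sum n r G.
Proof.
move=> FG; rewrite /forest_sum !big_seq; apply: ler_sum => phi; rewrite mem_forests.
by move=> /andP[/eqP sz _]; rewrite ler_wpM2l ?forest_weight_ge0 ?FG.
Qed.

End Weights.

(** * Counting occurrences and grafting *)
(** The number of occurrences of T in a forest ([NnfE]).  Forests are needed since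
    deleting the first root turns a tree into a forest. *)
Definition occ (T : plane_tree) (phi : seq plane_tree) : nat :=
  count (prec T) (flatten (map fringe_subtrees phi)).

Lemma occ_cons T t phi :
  occ T (t :: phi) = (prec T t + occ T (branches t ++ phi))%N.
Proof. by case: t => ts; rewrite /occ /= map_cat flatten_cat !count_cat addnA. Qed.

Lemma occ_cat T phi psi : occ T (phi ++ psi) = (occ T phi + occ T psi)%N.
Proof. by rewrite /occ map_cat flatten_cat count_cat. Qed.

Fixpoint subst_one A (f : A -> seq A) (s : seq A) : seq (seq A) :=
  if s is x :: s' then [seq y :: s' | y <- f x] ++ map (cons x) (subst_one f s')
  else [::].

(** All trees T[u <- S] obtained by replacing the fringe subtree of T at an
    internal node u by S. *)
Fixpoint grafts (S T : plane_tree) : seq plane_tree :=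
  let: Node ts := T in
  if ts is [::] then [::] else S :: map Node (subst_one (grafts S) ts).

(** An occurrence of S in t lies either at an internal node u of the copy of T at
    the root of t, and then t contains T[u <- S] at its root, or in one of the
    trees below that copy. *)
Lemma occ_grafts S T t : prec T t ->
  (occ S [:: t] <= \sum_(Q <- grafts S T) prec Q t + occ S (cut T t))%N.
Proof.
move: T t; apply (@proj1 _ (forall ts ss, all2 prec ts ss ->
   occ S ss <= \sum_(qs <- subst_one (grafts S) ts) all2 prec qs ss
               + occ S (flatmap2 cut ts ss))%N).
apply: tree_forest_ind => [[|t ts] IH|[]|t ts IHt IHts [|s ss]] //.
- by move=> t _; rewrite leq_addl.
- case=> ss pss.
  rewrite occ_cons cats0 [grafts _ _]/= big_cons big_map -addnA leq_add2l.
  rewrite -[branches (Node ss)]/ss.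
  rewrite -[cut (Node (t :: ts)) (Node ss)]/(flatmap2 cut (t :: ts) ss).
  apply: leq_trans (IH ss pss) _.
  rewrite leq_add2r.
  by apply: leq_sum => -[_|//]; exact: leq_b1.
- move=> /= /andP[ps pss]; rewrite -cat1s occ_cat big_cat !big_map /= occ_cat.
  apply: leq_trans (leq_add (IHt s ps) (IHts ss pss)) _.
  rewrite addnACA leq_add2r.
  apply: leq_add; apply: leq_sum => q _.
    by rewrite pss andbT.
  by rewrite ps.
Qed.

Lemma tree_size_grafts S T Q :
  Q \in grafts S T -> (tree_size Q <= tree_size S + tree_size T)%N.
Proof.
move: T Q; apply (@proj1 _ (forall ts qs, qs \in subst_one (grafts S) ts ->
   forest_size qs <= tree_size S + forest_size ts)%N).
apply: tree_forest_ind => [[|t ts] IH Q|qs|t ts IHt IHts qs] //.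
- rewrite [grafts _ _]/= inE => /orP[/eqP ->|/mapP[qs qsP ->]].
    exact: leq_addr.
  by rewrite !tree_size_Node addnS ltnS IH.
- rewrite /= mem_cat => /orP[] /mapP[q qP ->]; rewrite !forest_size_cons.
    by rewrite addnA leq_add2r IHt.
  by rewrite addnCA leq_add2l IHts.
Qed.

(** * Exact first moment and bound on the second *)
Section Moments.
Variables (R : realFieldType) (p : nat -> R).
Hypothesis p_ge0 : forall d, 0 <= p d.

Lemma pattern_weight_ge0 T : 0 <= pattern_weight p T.
Proof.
move: T; apply (@proj1 _ (forall ts, 0 <= foldr (fun s x => pattern_weight p s * x) 1 ts)).
apply: tree_forest_ind => //= [[|t ts] // IH|t ts IHt IHts]; exact: mulr_ge0.
Qed.

Lemma pattern_weight_le_expn c T : 0 <= c -> (forall d, (0 < d)%N -> p d <= c) ->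
  pattern_weight p T <= c ^+ inner_nodes T.
Proof.
move=> c0 pc; move: T; apply (@proj1 _ (forall ts,
  0 <= foldr (fun s x => pattern_weight p s * x) 1 ts <= c ^+ sumn (map inner_nodes ts))).
apply: tree_forest_ind => //= [[|t ts] // /andP[? ?]||t ts IHt /andP[? ?]].
- by rewrite exprS ler_pM // pc.
- by rewrite ler01 lexx.
- by rewrite exprD mulr_ge0 ?pattern_weight_ge0 //= ler_pM // pattern_weight_ge0.
Qed.

(** Writing T_u for the fringe subtree of T at u, the tree T[u <- S] keeps the
    weight of S and the internal nodes of T outside T_u, whence a factor at most
    c ^ (m - m(T_u)).  The sum over u of these powers is bounded by
    e(m) = (1 - c ^ m) / (1 - c): for a new root, 1 + c e(m) = e(m + 1), and for
    two branches, c ^ b e(a) + c ^ a e(b) <= e(a + b), because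
    (1 - c ^ a) (1 - c ^ b) >= 0. *)
Lemma sum_grafts c S T : 0 <= c < 1 -> (forall d, (0 < d)%N -> p d <= c) ->
  \sum_(Q <- grafts S T) pattern_weight p Q <= pattern_weight p S * ((1 - c ^+ inner_nodes T) / (1 - c)).
Proof.
move=> /andP[c0 c1] pc; have c10 : 0 < 1 - c by rewrite subr_gt0.
pose pwf := foldr (fun s x => pattern_weight p s * x) 1.
have pwf_ge0 ts : 0 <= pwf ts.
  by rewrite /pwf; elim: ts => //= t ts IH; rewrite mulr_ge0 ?pattern_weight_ge0.
have pwf_le ts : pwf ts <= c ^+ sumn (map inner_nodes ts).
  elim: ts => //= t ts IH; rewrite exprD ler_pM ?pattern_weight_ge0 //; exact: pattern_weight_le_expn.
move: T; apply (@proj1 _ (forall ts,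
  \sum_(qs <- subst_one (grafts S) ts) pwf qs <=
    pattern_weight p S * ((1 - c ^+ sumn (map inner_nodes ts)) / (1 - c)))).
apply: tree_forest_ind => [[|t ts] IH||t ts IHt IHts].
- by rewrite /= big_nil subrr mul0r mulr0.
- rewrite [grafts _ _]/= big_cons big_map [inner_nodes _]/=.
  set m := sumn _ in IH *; pose d := size (t :: ts).
  have -> : \sum_(j <- subst_one (grafts S) (t :: ts)) pattern_weight p (Node j) =
      p d * \sum_(j <- subst_one (grafts S) (t :: ts)) pwf j.
    rewrite big_distrr /= !big_seq; apply: eq_bigr => qs qsP.
    have -> : d = size qs.
      rewrite /d; move: qsP; rewrite -/(subst_one _ (t :: ts)).
      elim: (t :: ts) qs => //= u us IHu qs.
      by rewrite mem_cat => /orP[]/mapP[q qP ->] //=; rewrite (IHu q).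
    case: qs qsP => //.
    by rewrite [subst_one _ _]/= mem_cat => /orP[]/mapP[].
  have : p d * \sum_(j <- subst_one (grafts S) (t :: ts)) pwf j <=
      c * (pattern_weight p S * ((1 - c ^+ m) / (1 - c))).
    by rewrite ler_pM // ?pc //; apply: sumr_ge0.
  move=> H; apply: (le_trans (lerD (lexx _) H)); apply: le_of_eq.
  by rewrite exprS; field; rewrite gt_eqF.
- by rewrite /= big_nil subrr mul0r mulr0.
- rewrite [subst_one _ _]/= big_cat !big_map [sumn _]/= exprD.
  rewrite /= -big_distrl -big_distrr /=.
  set a := inner_nodes t in IHt *; set b := sumn _ in IHts *.
  have ca1 : c ^+ a <= 1 by rewrite exprn_ile1 // ltW.
  have cb1 : c ^+ b <= 1 by rewrite exprn_ile1 // ltW.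
  have H1 : (\sum_(Q <- grafts S t) pattern_weight p Q) * pwf ts <=
     pattern_weight p S * ((1 - c ^+ a) / (1 - c)) * c ^+ b.
    by rewrite ler_pM ?pwf_le //; apply: sumr_ge0 => ? _; exact: pattern_weight_ge0.
  have H2 : pattern_weight p t * (\sum_(qs <- subst_one (grafts S) ts) pwf qs) <=
     c ^+ a * (pattern_weight p S * ((1 - c ^+ b) / (1 - c))).
    by rewrite ler_pM ?pattern_weight_ge0 ?pattern_weight_le_expn //; apply: sumr_ge0.
  apply: (le_trans (lerD H1 H2)).
  rewrite -subr_ge0.
  have -> : pattern_weight p S * ((1 - c ^+ a * c ^+ b) / (1 - c)) -
     (pattern_weight p S * ((1 - c ^+ a) / (1 - c)) * c ^+ b +
      c ^+ a * (pattern_weight p S * ((1 - c ^+ b) / (1 - c)))) =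
     pattern_weight p S * ((1 - c ^+ a) * (1 - c ^+ b) / (1 - c)).
    by field; rewrite gt_eqF.
  apply: mulr_ge0; first exact: pattern_weight_ge0.
  by apply: divr_ge0; [rewrite mulr_ge0 // subr_ge0 | exact: ltW].
Qed.

Variable K : nat.
Let pol := \poly_(d < K) p d.

(** This is P(S_N = M - s) as soon as K > M, and 0 when M < s, which avoids
    truncated subtractions. *)
Definition walk_coef (N s M : nat) : R := ('X^s * pol ^+ N)`_M.

Lemma walk_coefE N s M : walk_coef N s M = if (M < s)%N then 0 else (pol ^+ N)`_(M - s).
Proof. by rewrite /walk_coef coefXnM. Qed.

Lemma walk_coef_small N s M : (M < s)%N -> walk_coef N s M = 0.
Proof. by move=> Ms; rewrite walk_coefE Ms. Qed.

Lemma walk_coefSS N s M : walk_coef N s.+1 M.+1 = walk_coef N s M.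
Proof. by rewrite !walk_coefE ltnS subSS. Qed.

Lemma walk_coef_ge0 N s M : 0 <= walk_coef N s M.
Proof.
rewrite walk_coefE; case: ifP => // _; elim: N (M - s)%N => [|N IH] j.
  by rewrite expr0 coef1 ler0n.
rewrite exprS coefM sumr_ge0 // => i _; rewrite mulr_ge0 //.
by rewrite coef_poly; case: ifP.
Qed.

Lemma sum_walk_coef N s M : \sum_(d < K) p d * walk_coef N (s + d) M = walk_coef N.+1 s M.
Proof.
rewrite /walk_coef exprS mulrA {2}/pol poly_def big_distrr /= big_distrl coef_sum.
by apply: eq_bigr => d _; rewrite /= -scalerAr -scalerAl coefZ exprD.
Qed.

(** By exchangeability, each of the N + 1 steps has conditional mean
    (M - s) / (N + 1) given that their sum is M - s.  The proof compares the
    coefficients of 'X (pol ^+ N.+1)^`(). *)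
Lemma sum_degree_walk_coef N s M :
  N.+1%:R * (\sum_(d < K) p d * (d%:R * walk_coef N (s + d) M)) =
  (M%:R - s%:R) * walk_coef N.+1 s M.
Proof.
have coefXd (q : {poly R}) : ('X * q^`())`_M = M%:R * q`_M.
  by rewrite coefXM; case: M => [|m]; rewrite ?mul0r // coef_deriv mulr_natl.
have Xd : 'X * pol^`() = \sum_(d < K) (p d * d%:R) *: 'X^d.
  rewrite /pol poly_def raddf_sum big_distrr /=; apply: eq_bigr => d _.
  rewrite derivZ derivXn; case: (nat_of_ord d) => [|e].
    by rewrite mulr0n scaler0 !mulr0 scale0r.
  by rewrite /= mulr_natr -scalerAr mulrnAr -exprS -scalerMnl scalerMnr.
transitivity (('X^s * ('X * (pol ^+ N.+1)^`()))`_M).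
  rewrite deriv_exp /= !mulrnAr coefMn -[RHS]mulr_natl; congr (_ * _).
  rewrite (mulrA 'X) Xd big_distrl big_distrr coef_sum /=; apply: eq_bigr => d _.
  by rewrite -scalerAl -(scalerAr _ ('X^s : {poly R})) coefZ (mulrA 'X^s) -exprD mulrA.
have := coefXd ('X^s * pol ^+ N.+1).
rewrite derivM mulrDr coefD (mulrCA 'X 'X^s) -/(walk_coef N.+1 s M) mulrBl => <-.
rewrite [X in X - _]addrC -addrA -[LHS]addr0; congr (_ + _); apply/esym/eqP.
rewrite subr_eq0; apply/eqP; rewrite mulrA derivXn /walk_coef.
case: s => [|e]; first by rewrite mulr0n mulr0 !mul0r coef0.
by rewrite mulrnAr -exprS mulrnAl coefMn mulr_natl.
Qed.

Lemma sum_widen n (G : nat -> R) : (n < K)%N -> (forall d, (n < d)%N -> G d = 0) ->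
  \sum_(d < n.+1) p d * G d = \sum_(d < K) p d * G d.
Proof.
move=> nK G0; rewrite (big_ord_widen K (fun d => p d * G d)) // big_mkcond.
by apply: eq_bigr => d _; case: ltnP => // /G0 ->; rewrite mulr0.
Qed.

(** The Otter-Dwass formula: a forest of r trees has size n with probability
    (r / n) P(S_n = n - r). *)
Lemma forest_sum_one n r : (n <= K)%N ->
  n%:R * forest_sum p n r (fun=> 1) = r%:R * walk_coef n r n.
Proof.
elim: n r => [|n IH] [|r] nK; rewrite ?mul0r ?forest_sumS0 ?mulr0 //.
  by rewrite walk_coef_small // mulr0.
rewrite forest_sum_root walk_coefSS; case: n => [|n] in IH nK *.
  rewrite mul1r big_ord1 add0n; case: r => [|r].
    rewrite forest_sum00 mulr1 mul1r walk_coefE subn0 expr1 coef_poly.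
    by case: K nK.
  by rewrite forest_sum0S walk_coef_small // !mulr0.
have n0 : n.+1%:R != 0 :> R by rewrite pnatr_eq0.
apply: (mulfI n0).
pose G d : R := d%:R * walk_coef n.+1 (r + d) n.+1 + r%:R * walk_coef n.+1 (r + d) n.+1.
rewrite [LHS]mulrCA.
have -> : n.+1%:R * (\sum_(d < n.+2) p d * forest_sum p n.+1 (d + r) (fun=> 1)) =
    \sum_(d < n.+2) p d * G d.
  rewrite big_distrr /=; apply: eq_bigr => d _; rewrite mulrCA; congr (_ * _).
  by rewrite IH ?(ltnW nK) // natrD mulrDl addnC.
rewrite sum_widen //; last first.
  by move=> d nd; rewrite /G walk_coef_small ?mulr0 ?addr0 // (leq_trans nd) ?leq_addl.
have -> : \sum_(d < K) p d * G d =
   \sum_(d < K) p d * (d%:R * walk_coef n.+1 (r + d) n.+1) + r%:R * walk_coef n.+2 r n.+1.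
  rewrite -sum_walk_coef big_distrr -big_split /=; apply: eq_bigr => d _.
  by rewrite /G; ring.
by rewrite mulrDr sum_degree_walk_coef; rewrite -!natr1; ring.
Qed.

Lemma forest_sum_pattern_small T n r F : (n <= inner_nodes T)%N ->
  forest_sum p n r.+1 (fun phi => (prec T (head leaf phi))%:R * F phi) = 0.
Proof.
move=> nT; rewrite /forest_sum big_seq big1 // => -[|t phi]; rewrite mem_forests // => /andP[_ /eqP fs].
rewrite [head _ _]/=; case pT : (prec T t); last by rewrite mul0r mulr0.
exfalso; move: fs nT; rewrite forest_size_cons (tree_size_cut pT) => <-.
have := size_le_forest_size (cut T t); rewrite size_cut //.
by have := leaves_gt0 T; lia.
Qed.

Lemma forest_sum_branches n r F :
  forest_sum p n.+1 r.+1 (fun phi => F (branches (head leaf phi) ++ behead phi)) =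
  \sum_(d < n.+1) p d * forest_sum p n (d + r) F.
Proof.
rewrite forest_sum_root; apply: eq_bigr => d _; congr (_ * _).
by apply: eq_forest_sum => phi _; rewrite /= cat_take_drop.
Qed.

Lemma occ_fst_tree T phi r : size phi = r.+1 ->
  occ T phi = (prec T (head leaf phi)
              + occ T (branches (head leaf phi) ++ behead phi))%N.
Proof. by case: phi => // t phi _; rewrite occ_cons. Qed.

(** Deleting the first root loses an occurrence exactly when T matches the first
    tree, and by [forest_sum_pattern] and the Otter-Dwass formula this has weight
    (l + r) pi P(S_N = N - l - r) / N with N = n + 1 - m. *)
Lemma forest_sum_occ T n r : (n <= K)%N ->
  forest_sum p n r (fun phi => (occ T phi)%:R) =
  r%:R * pattern_weight p T * walk_coef (n - inner_nodes T) (r + (leaves T).-1) (n - inner_nodes T).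
Proof.
elim: n r => [|n IH] [|r] nK; rewrite ?mul0r ?forest_sumS0 ?forest_sum00 //.
  by rewrite forest_sum0S walk_coef_small ?mulr0.
rewrite (@eq_forest_sum _ _ _ _ _ (fun phi => (prec T (head leaf phi))%:R * 1 +
   (occ T (branches (head leaf phi) ++ behead phi))%:R)); last first.
  by move=> phi sz; rewrite (occ_fst_tree T sz) natrD mulr1.
have l0 := leaves_gt0 T; set l' := (leaves T).-1.
have El : leaves T = l'.+1 by rewrite prednK.
set m := inner_nodes T; rewrite forest_sumD (forest_sum_branches _ _ (fun phi => (occ T phi)%:R)).
have -> : \sum_(d < n.+1) p d * forest_sum p n (d + r) (fun phi => (occ T phi)%:R) =
    pattern_weight p T * \sum_(d < n.+1) p d *
       (d%:R * walk_coef (n - m) (r + l' + d) (n - m) +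
        r%:R * walk_coef (n - m) (r + l' + d) (n - m)).
  rewrite big_distrr /=; apply: eq_bigr => d _; rewrite mulrCA; congr (_ * _).
  rewrite IH ?(ltnW nK) // -/m -/l' natrD.
  by rewrite (_ : (d + r + l')%N = (r + l' + d)%N); [ring|lia].
rewrite (sum_widen (G := fun d => d%:R * walk_coef (n - m) (r + l' + d) (n - m) +
        r%:R * walk_coef (n - m) (r + l' + d) (n - m))) //; last first.
  by move=> d nd; rewrite !walk_coef_small ?mulr0 ?addr0 //; lia.
(* A forest too small for T gives N = 0.  The coefficient then vanishes, since its
   index is positive unless d = r = 0, when the factor in front of it is 0. *)
have [nm|mn] := leqP n.+1 m.
  rewrite forest_sum_pattern_small // (_ : (n.+1 - m)%N = 0%N); last lia.
  rewrite (_ : (n - m)%N = 0%N); last lia.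
  rewrite (@walk_coef_small _ (r.+1 + l')) // mulr0 add0r big1 ?mulr0 // => d _.
  case: (posnP (r + d)) => [|rd].
    by move=> /eqP; rewrite addn_eq0 => /andP[/eqP -> /eqP ->]; rewrite !mul0r addr0 mulr0.
  by rewrite !walk_coef_small ?mulr0 ?addr0 ?mulr0 //; lia.
rewrite (forest_sum_pattern _ _ (fun=> 1)); last exact: ltnW.
rewrite -/m subSn //; set N := (n - m)%N.
rewrite addSn walk_coefSS.
have N0 : N.+1%:R != 0 :> R by rewrite pnatr_eq0.
apply: (mulfI N0).
have F1 : N.+1%:R * forest_sum p N.+1 (leaves T + r) (fun=> 1) =
    (l'%:R + 1 + r%:R) * walk_coef N.+1 (r + l') N.
  rewrite forest_sum_one; last by rewrite /N; lia.
  by rewrite El natrD -natr1 addSn walk_coefSS addnC.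
have -> : \sum_(d < K) p d * (d%:R * walk_coef N (r + l' + d) N +
        r%:R * walk_coef N (r + l' + d) N) =
   \sum_(d < K) p d * (d%:R * walk_coef N (r + l' + d) N) + r%:R * walk_coef N.+1 (r + l') N.
  rewrite -sum_walk_coef big_distrr -big_split /=; apply: eq_bigr => d _; ring.
rewrite mulrDr mulrCA F1 (mulrCA _ (pattern_weight p T)) mulrDr sum_degree_walk_coef natrD.
by rewrite -!natr1; ring.
Qed.

(** With N and N' the numbers of occurrences before and after the deletion of the
    first root, N^2 - N'^2 <= 2 N if T matches the first tree.  By [occ_grafts],
    N is at most the number of occurrences below the copy of T plus the number
    of grafts that match; the latter is what the sum over grafts loses. *)
Lemma occ_sqr_step T t phi :
  (occ T (t :: phi))%:R ^+ 2 - 2 * (\sum_(Q <- grafts T T) (occ Q (t :: phi))%:R)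
  <= (occ T (branches t ++ phi))%:R ^+ 2
     - 2 * (\sum_(Q <- grafts T T) (occ Q (branches t ++ phi))%:R)
     + 2 * ((prec T t)%:R * (occ T (cut T t ++ phi))%:R) :> R.
Proof.
under eq_bigr => Q _ do rewrite occ_cons natrD.
rewrite big_split /= occ_cons natrD.
set a : R := (occ T (branches t ++ phi))%:R; set s := \sum_(Q <- _) _.
set u := \sum_(Q <- _) (occ Q _)%:R.
have s0 : 0 <= s by apply: sumr_ge0.
case pT : (prec T t); last by rewrite add0r mul0r mulr0 addr0; lra.
rewrite mul1r.
have H : 1 + a <= s + (occ T (cut T t ++ phi))%:R.
  rewrite /a /s -natr_sum nat1r -natrD ler_nat.
  have := occ_grafts T pT; rewrite occ_cons pT cats0 !occ_cat; lia.
have : 0 <= a by []; rewrite mulr1n; nra.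
Qed.

(** The bound is the contribution of the ordered pairs of disjoint copies of T:
    contracting both copies to single nodes leaves N + 2 = n - 2 m + 2 nodes, among
    which the pair is chosen. *)
Lemma forest_sum_occ_sqr T n r : (n <= K)%N ->
  forest_sum p n r (fun phi => (occ T phi)%:R ^+ 2 -
                         2 * (\sum_(Q <- grafts T T) (occ Q phi)%:R)) <=
  r%:R * (n - (inner_nodes T).*2).+1%:R * pattern_weight p T ^+ 2 *
    walk_coef (n - (inner_nodes T).*2) ((leaves T).-1.*2 + r) (n - (inner_nodes T).*2).
Proof.
set F := fun phi : seq plane_tree => _.
elim: n r => [|n IH] [|r] nK; rewrite ?mul0r ?forest_sumS0 ?forest_sum00 //.
- by rewrite /F expr0n sub0r big1 // mulr0 oppr0.
- by rewrite forest_sum0S !mulr_ge0 ?exprn_ge0 ?pattern_weight_ge0 ?walk_coef_ge0.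
have l0 := leaves_gt0 T; set l' := (leaves T).-1.
have El : leaves T = l'.+1 by rewrite prednK.
set m := inner_nodes T.
apply: (@le_trans _ _ (forest_sum p n.+1 r.+1 (fun phi =>
    F (branches (head leaf phi) ++ behead phi) +
    2 * ((prec T (head leaf phi))%:R *
         (occ T (cut T (head leaf phi) ++ behead phi))%:R)))).
  by apply: le_forest_sum => // -[|t phi] // _; exact: occ_sqr_step.
rewrite forest_sumD forest_sumZ (forest_sum_branches _ _ F).
set N := (n - m.*2)%N; pose s := (l'.*2 + r)%N.
pose G d : R := d%:R * walk_coef N (s + d) N + r%:R * walk_coef N (s + d) N.
apply: (@le_trans _ _ (N.+1%:R * pattern_weight p T ^+ 2 * (\sum_(d < K) p d * G d) +
   2 * forest_sum p n.+1 r.+1 (fun phi => (prec T (head leaf phi))%:R *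
         (occ T (cut T (head leaf phi) ++ behead phi))%:R))).
  rewrite lerD2r -(@sum_widen n G) //; last first.
    by move=> d nd; rewrite /G !walk_coef_small ?mulr0 ?addr0 //; lia.
  rewrite big_distrr /=; apply: ler_sum => d _; rewrite mulrCA ler_wpM2l //.
  apply: (le_trans (IH _ (ltnW nK))); rewrite -/N -/l' natrD /G.
  rewrite (_ : (l'.*2 + (d + r))%N = (s + d)%N); last by rewrite /s; lia.
  by apply: le_of_eq; ring.
have [nm|mn] := leqP n.+1 m.*2.
  have -> : forest_sum p n.+1 r.+1 (fun phi => (prec T (head leaf phi))%:R *
         (occ T (cut T (head leaf phi) ++ behead phi))%:R) = 0.
    have [nm'|mn'] := leqP n.+1 m; first exact: forest_sum_pattern_small.
    rewrite (forest_sum_pattern _ _ (fun phi => (occ T phi)%:R)); last exact: ltnW.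
    rewrite forest_sum_occ; last by lia.
    by rewrite walk_coef_small ?mulr0 //; lia.
  rewrite mulr0 addr0.
  have -> : N = 0%N by rewrite /N; lia.
  rewrite big1 ?mulr0 ?mulr_ge0 ?exprn_ge0 ?pattern_weight_ge0 ?walk_coef_ge0 // => d _.
  rewrite /G (_ : N = 0%N); last by rewrite /N; lia.
  case: (posnP (r + d)) => [|rd].
    by move=> /eqP; rewrite addn_eq0 => /andP[/eqP -> /eqP ->]; rewrite !mul0r addr0 mulr0.
  by rewrite !walk_coef_small ?mulr0 ?addr0 ?mulr0 //; rewrite /s; lia.
rewrite (forest_sum_pattern _ _ (fun phi => (occ T phi)%:R)); last by rewrite -/m; lia.
rewrite forest_sum_occ; last by lia.
rewrite -/m (_ : (n.+1 - m - m)%N = N.+1); last by rewrite /N; lia.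
rewrite (_ : (n.+1 - m.*2)%N = N.+1); last by rewrite /N; lia.
rewrite -/l' (_ : (leaves T + r + l')%N = s.+1); last by rewrite /s; lia.
rewrite (_ : (l'.*2 + r.+1)%N = s.+1); last by rewrite /s; lia.
rewrite walk_coefSS.
have -> : N.+1%:R * pattern_weight p T ^+ 2 * (\sum_(d < K) p d * G d) = pattern_weight p T ^+ 2 *
   (N.+1%:R * \sum_(d < K) p d * (d%:R * walk_coef N (s + d) N) +
    N.+1%:R * r%:R * walk_coef N.+1 s N).
  rewrite [_ * pattern_weight p T ^+ 2]mulrC -[LHS]mulrA; congr (_ * _).
  rewrite -[_ * r%:R * _]mulrA -mulrDr; congr (_ * _).
  rewrite -sum_walk_coef big_distrr -big_split /=; apply: eq_bigr => d _.
  by rewrite /G; ring.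
rewrite sum_degree_walk_coef; apply: le_of_eq.
rewrite /s El -muln2 !natrD !natrM -!natr1; ring.
Qed.

End Moments.

(** * Binomial coefficients *)
Lemma leq_bin_middle N j u : (j <= u)%N -> (u + j <= N)%N -> ('C(N, j) <= 'C(N, u))%N.
Proof.
wlog uN : u / (u.*2 <= N)%N.
  move=> W ju ujN; have [uN|Nu] := leqP u.*2 N; first exact: W.
  by rewrite -(@bin_sub N u); [apply: W; lia|lia].
elim: u uN => [|u IH] uN ju _; first by move: ju; rewrite leqn0 => /eqP ->.
move: ju; rewrite leq_eqVlt => /orP[/eqP -> //|ju].
apply: (@leq_trans 'C(N, u)); first by apply: IH; lia.
rewrite -(leq_pmul2l (ltn0Sn u)) mul_bin_left leq_mul2r; apply/orP; right; lia.
Qed.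

Lemma sum_bin N : (\sum_(i < N.+1) 'C(N, i) = 2 ^ N)%N.
Proof.
by rewrite -[2%N]/(1 + 1)%N Pascal; apply: eq_bigr => i _; rewrite !exp1n !muln1.
Qed.

(** By unimodality, N - 2 j of the coefficients are at least 'C(N, j). *)
Lemma bin_gap N j : (j.*2 <= N)%N -> ('C(N, j) * (N - j.*2) <= 2 ^ N)%N.
Proof.
move=> jN; rewrite -sum_bin -(big_mkord xpredT (fun i => 'C(N, i))).
rewrite (@big_cat_nat _ _ _ j) //=; last by lia.
rewrite (@big_cat_nat _ _ _ (N - j).+1 j) //=; [|lia|lia].
apply: (@leq_trans (\sum_(j <= i < (N - j).+1) 'C(N, i))%N); last by lia.
apply: (@leq_trans (\sum_(j <= i < (N - j).+1) 'C(N, j))%N).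
  by rewrite sum_nat_const_nat mulnC leq_mul2r; apply/orP; right; lia.
by rewrite !big_nat; apply: leq_sum => i /andP[? ?]; apply: leq_bin_middle; lia.
Qed.

Lemma bin_dist (R : realFieldType) N j :
  `|N%:R - j.*2%:R| * 'C(N, j)%:R <= 2 ^+ N :> R.
Proof.
wlog jN : j / (j.*2 <= N)%N.
  move=> W; have [jN|Nj] := leqP j.*2 N; first exact: W.
  have [jN'|Nj'] := leqP j N; last by rewrite bin_small // mulr0 exprn_ge0.
  have := W (N - j)%N; rewrite bin_sub // => /(_ ltac:(lia)).
  rewrite (_ : (N - j).*2 = (N + N - j.*2)%N); last by lia.
  rewrite natrB; last by lia.
  rewrite natrD (_ : N%:R - _ = - (N%:R - j.*2%:R) :> R); last by ring.
  by rewrite normrN.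
rewrite -natrB // normr_nat -natrX -natrM ler_nat mulnC; exact: bin_gap.
Qed.

Lemma coef_1DXn (R : nzRingType) i j : ((1 + 'X : {poly R}) ^+ i)`_j = 'C(i, j)%:R.
Proof.
rewrite addrC exprDn_comm; last exact: commr1.
rewrite coef_sum; under eq_bigr => k _ do
  rewrite expr1n mulr1 coefMn coefXn.
have [ij|ji] := ltnP i j.
  rewrite bin_small // big1 // => k _.
  by rewrite (_ : (j == (i - k)%N) = false) ?mul0rn //; apply/eqP; lia.
have H : (i - j < i.+1)%N by lia.
rewrite (bigD1 (Ordinal H)) //= big1 ?addr0 => [|k kH].
  by rewrite subKn // eqxx bin_sub.
rewrite (_ : (j == (i - k)%N) = false) ?mul0rn //; apply/eqP => jk.
by move: kH; rewrite -val_eqE /=; have := ltn_ord k; lia.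
Qed.

Lemma coef_1BX_mul (R : nzRingType) (q : {poly R}) j :
  ((1 - 'X) * q)`_j = q`_j - (if j is j'.+1 then q`_j' else 0).
Proof. by rewrite mulrBl mul1r coefB coefXM; case: j. Qed.

(** The coefficient 'C(i, j) - 'C(i, j - 1) equals
    (i + 1 - 2 j) 'C(i + 1, j) / (i + 1), so that [bin_dist] applies. *)
Lemma bin_diff_le (R : realFieldType) i j :
  `|((1 - 'X) * (1 + 'X : {poly R}) ^+ i)`_j| <= 2 ^+ i.+1 / i.+1%:R.
Proof.
rewrite ler_pdivlMr ?ltr0n // -[X in _ * X]normr_nat -normrM.
suff -> : ((1 - 'X) * (1 + 'X : {poly R}) ^+ i)`_j * i.+1%:R =
    (i.+1%:R - j.*2%:R) * 'C(i.+1, j)%:R by rewrite normrM normr_nat bin_dist.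
have [ij|ji] := ltnP i.+1 j.
  case: j ij => // j ij; rewrite coef_1BX_mul !coef_1DXn !bin_small ?subrr ?mul0r ?mulr0 //; lia.
have E1 : i.+1%:R * 'C(i, j)%:R = (i.+1%:R - j%:R) * 'C(i.+1, j)%:R :> R.
  by rewrite -natrB // -!natrM mul_bin_down.
have E2 : i.+1%:R * (if j is j'.+1 then 'C(i, j')%:R else 0) = j%:R * 'C(i.+1, j)%:R :> R.
  by case: j {ji E1} => [|j]; rewrite ?mulr0 ?mul0r // -!natrM mul_bin_diag.
have -> : ((1 - 'X) * (1 + 'X : {poly R}) ^+ i)`_j =
    'C(i, j)%:R - (if j is j'.+1 then 'C(i, j')%:R else 0).
  by rewrite coef_1BX_mul; case: j {ji E1 E2} => [|j]; rewrite !coef_1DXn.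
rewrite mulrC mulrBr E1 E2 -muln2 natrM; ring.
Qed.

(** The sequence 'C(2 k, k) ^ 2 k / 16 ^ k is nondecreasing. *)
Lemma leq_central_bin i : (0 < i)%N -> (4 ^ i <= 4 * i * 'C(i, i./2) ^ 2)%N.
Proof.
have E k : (16 ^ k.+1 <= 4 * k.+1 * 'C(k.+1.*2, k.+1) ^ 2)%N.
  elim: k => // k IH; set C := 'C(k.+1.*2, k.+1) in IH.
  have H : (k.+2 * 'C(k.+2.*2, k.+2) = 2 * (k.+1.*2.+1) * C)%N.
    have H1 : (k.+2.*2 * 'C(k.+1.*2.+1, k.+1) = k.+2 * 'C(k.+2.*2, k.+2))%N.
      by rewrite -mul_bin_diag.
    have H2 : (k.+1.*2.+1 * C = (k.+1.*2.+1 - k.+1) * 'C(k.+1.*2.+1, k.+1))%N.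
      by rewrite -mul_bin_down.
    rewrite -H1 -mulnA H2; rewrite (_ : k.+1.*2.+1 - k.+1 = k.+2)%N; [|lia].
    by rewrite mulnA; congr (_ * _)%N; lia.
  set D := 'C(k.+2.*2, k.+2) in H *.
  have H2 : (k.+2 ^ 2 * D ^ 2 = 4 * k.+1.*2.+1 ^ 2 * C ^ 2)%N.
    by rewrite -expnMn H !expnMn.
  have k0 : (0 < k.+2 * k.+1)%N by [].
  rewrite -(leq_pmul2l k0).
  have -> : (k.+2 * k.+1 * (4 * k.+2 * D ^ 2) = 4 * k.+1 * (k.+2 ^ 2 * D ^ 2))%N by nia.
  rewrite H2 (expnS 16 k.+1).
  have L : (4 * k.+2 * k.+1 <= k.+1.*2.+1 ^ 2)%N by nia.
  have := leq_mul IH L; move: (16 ^ k.+1)%N (C ^ 2)%N (k.+1.*2.+1 ^ 2)%N => a b c.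
  by nia.
move=> i0; have [k [] ->] : exists k, i = k.+1.*2 \/ i = k.*2.+1.
  have := odd_double_half i; case: (odd i) => Ei; first by exists i./2; right; lia.
  by exists (i./2).-1; left; lia.
  rewrite doubleK -{1}mul2n expnM.
  by apply: leq_trans (E k) _; rewrite -mul2n; nia.
rewrite (_ : (k.*2.+1)./2 = k); last by lia.
have H : (2 * 'C(k.*2.+1, k) = 'C(k.+1.*2, k.+1))%N.
  rewrite doubleS binS; rewrite -(@bin_sub k.*2.+1 k); last by lia.
  by rewrite (_ : (k.*2.+1 - k = k.+1)%N); lia.
have := E k; rewrite -H expnMn; move: ('C(_, _) ^ 2)%N => c.
rewrite (expnS 16) (expnS 4) -[in (4 ^ k.*2)%N]mul2n expnM (_ : (4 ^ 2)%N = 16%N) //.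
move: (16 ^ k)%N => a; rewrite (_ : (2 ^ 2)%N = 4%N) //; nia.
Qed.

(** Going away from the centre from t + s down to t, each of the s quotients of
    consecutive binomial coefficients is at least (t + 1) / (i - t), hence at
    least 1 - 2 (i - 2 t) / i.  The second alternative is the case where this
    bound is negative and its powers say nothing. *)
Lemma bin_shift (R : realFieldType) i t s : (0 < i)%N -> ((s + t).*2 <= i)%N ->
  (1 - 2 * (i%:R - t.*2%:R) / i%:R) ^+ s * 'C(i, s + t)%:R <= 'C(i, t)%:R :> R \/
  1 - 2 * (i%:R - t.*2%:R) / i%:R < 0 :> R.
Proof.
move=> i0 sti; set x := 1 - _; have [x0|x0] := ltP x 0; first by right.
left; elim: s sti => [|s IH] sti; first by rewrite mul1r.
rewrite exprSr -mulrA; apply: le_trans (IH _); last by lia.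
rewrite ler_wpM2l ?exprn_ge0 //.
have it : 0 < i%:R - (s + t)%:R :> R by rewrite subr_gt0 ltr_nat; lia.
have B : 'C(i, s + t)%:R * (i%:R - (s + t)%:R) = (s.+1 + t)%:R * 'C(i, s.+1 + t)%:R :> R.
  rewrite mulrC -natrB; last by lia.
  by rewrite -!natrM addSn mul_bin_left.
rewrite -(ler_pM2r it) B -mulrA mulrCA [leRHS]mulrC ler_wpM2l //.
have i0' : 0 < i%:R :> R by rewrite ltr0n.
rewrite -(ler_pM2r i0') /x.
have -> : (1 - 2 * (i%:R - t.*2%:R) / i%:R) * (i%:R - (s + t)%:R) * i%:R =
  (i%:R - 2 * (i%:R - t.*2%:R)) * (i%:R - (s + t)%:R) :> R.
  by field; rewrite gt_eqF.
have : (s.+1 + t).*2%:R <= i%:R :> R by rewrite ler_nat.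
rewrite -!muln2 !natrM !natrD -[s.+1%:R]natr1.
have : 0 <= s%:R :> R by []; have : 0 <= t%:R :> R by [].
move: (i%:R : R) (s%:R : R) (t%:R : R) => a b c; nra.
Qed.

Lemma expR_le_1B (R : realType) (x : R) : 0 <= x <= 2^-1 -> expR (- (2 * x)) <= 1 - x.
Proof.
move=> /andP[x0 x1]; rewrite expRN -(@ler_pM2r _ (expR (2 * x))) ?expR_gt0 //.
rewrite mulVf ?gt_eqF ?expR_gt0 //.
have := expR_ge1Dx (2 * x); move: (expR _) => e; nra.
Qed.

(** Within a bounded number of standard deviations of the centre, binomial
    probabilities have order 1 / sqrt i: the distance to the centre is
    d = O(sqrt i), and the product of the at most d / 2 quotients of [bin_shift] is at
    least exp(- 2 d ^ 2 / i). *)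
Lemma binomial_lower_bound (R : realType) (A : R) : 0 <= A ->
  exists2 c : R, 0 < c & exists i0 : nat, forall i t : nat, (i0 <= i)%N ->
    (i%:R - t.*2%:R) ^+ 2 <= A * i%:R ->
    (t <= i)%N /\ c / Num.sqrt i%:R <= 'C(i, t)%:R / 2 ^+ i.
Proof.
move=> A0; exists (expR (- (2 * A)) / 2); first by rewrite divr_gt0 ?expR_gt0.
exists (Num.trunc (16 * A)).+1 => i t.
rewrite -(ler_nat R) => /(lt_le_trans (truncnS_gt _)) Ai.
have i0 : (0 < i)%N by rewrite -(ltr_nat R) (le_lt_trans _ Ai) // mulr_ge0.
have i0' : 0 < i%:R :> R by rewrite ltr0n.
move=> Hd; have ti : (t <= i)%N.
  rewrite leqNgt; apply/negP => it.
  have it' : i%:R + 1 <= t%:R :> R by rewrite natr1 ler_nat.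
  by move: Hd; rewrite -muln2 natrM; nra.
split=> //; wlog t2 : t Hd ti / (t.*2 <= i)%N.
  move=> W; have [t2|t2] := leqP t.*2 i; first exact: W.
  rewrite -bin_sub //; apply: W; [|lia|lia].
  move: Hd; rewrite (_ : (i - t).*2 = (i + i - t.*2)%N); last by lia.
  rewrite natrB; last by lia.
  rewrite natrD (_ : i%:R - (i%:R + i%:R - _) = - (i%:R - t.*2%:R) :> R); last by ring.
  by rewrite sqrrN.
set d : R := i%:R - t.*2%:R in Hd.
have d0 : 0 <= d by rewrite subr_ge0 ler_nat.
have d4 : 4 * d <= i%:R.
  by rewrite -(@ler_pXn2r _ 2) ?nnegrE ?mulr_ge0 //; nra.
set s := (i./2 - t)%N.
have si : (s + t)%N = i./2 by rewrite /s subnK // -(doubleK t) half_leq.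
have x01 : 0 <= 2 * d / i%:R <= 2^-1.
  by rewrite divr_ge0 ?mulr_ge0 //= ler_pdivrMr //; lra.
have := @bin_shift R i t s i0; rewrite si -/d => -[|H|]; first by clear; lia.
- have C0 : 2 ^+ i / (2 * Num.sqrt i%:R) <= 'C(i, i./2)%:R :> R.
    have q0 : 0 < Num.sqrt i%:R :> R by rewrite sqrtr_gt0.
    rewrite ler_pdivrMr ?mulr_gt0 //.
    rewrite -(@ler_pXn2r _ 2) ?nnegrE ?mulr_ge0 ?exprn_ge0 ?sqrtr_ge0 //.
    rewrite !exprMn sqr_sqrtr // -exprM mulnC exprM.
    have := leq_central_bin i0; rewrite -(ler_nat R) !natrM !natrX.
    rewrite (_ : 4%:R = 2 ^+ 2 :> R); last by ring.
    by move=> /le_trans; apply; apply: le_of_eq; ring.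
  have E : expR (- (2 * A)) <= (1 - 2 * d / i%:R) ^+ s.
    apply: (@le_trans _ _ (expR (- (2 * (2 * d / i%:R))) ^+ s)); last first.
      by rewrite lerXn2r ?nnegrE ?expR_ge0 ?expR_le_1B //; lra.
    rewrite -expRM_natl ler_expR.
    have sd : s%:R * 2 <= d.
      have : s.*2%:R <= (i - t.*2)%:R :> R by rewrite ler_nat; clear -si t2; lia.
      by rewrite natrB // -muln2 natrM.
    rewrite mulrN lerN2.
    have -> : s%:R * (2 * (2 * d / i%:R)) = (s%:R * 2) * d * 2 / i%:R :> R by ring.
    rewrite ler_pdivrMr // ; nra.
  have := le_trans (ler_pM (expR_ge0 _) _ E C0) H; rewrite divr_ge0 ?exprn_ge0 ?mulr_ge0 ?sqrtr_ge0 //.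
  move=> /(_ isT) H1; rewrite ler_pdivlMr ?exprn_gt0 //; apply: le_trans H1.
  apply: le_of_eq; field.
  by rewrite gt_eqF // sqrtr_gt0.
- by move=> x0; exfalso; lra.
Qed.

(** * Polynomials with nonnegative coefficients *)
Section NonnegPoly.
Variable R : realType.
Implicit Types (p q g : {poly R}).

Definition nneg_poly q := forall i, 0 <= q`_i.

Lemma nneg_coef q i : nneg_poly q -> 0 <= q`_i. Proof. exact. Qed.

Lemma nneg_polyM p q : nneg_poly p -> nneg_poly q -> nneg_poly (p * q).
Proof. by move=> p0 q0 i; rewrite coefM sumr_ge0 // => j _; rewrite mulr_ge0. Qed.

Lemma nneg_polyXn n : nneg_poly ('X^n).
Proof. by move=> i; rewrite coefXn ler0n. Qed.

Lemma nneg_poly_exp p n : nneg_poly p -> nneg_poly (p ^+ n).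
Proof.
move=> p0; elim: n => [|n IH]; first exact: (nneg_polyXn 0).
by rewrite exprS; apply: nneg_polyM.
Qed.

Lemma nneg_poly_deriv p : nneg_poly p -> nneg_poly p^`().
Proof. by move=> p0 i; rewrite coef_deriv mulrn_wge0. Qed.

Lemma nneg_poly_1DX n : nneg_poly ((1 + 'X) ^+ n).
Proof. by move=> i; rewrite coef_1DXn ler0n. Qed.

Lemma horner1E q n : (size q <= n)%N -> q.[1] = \sum_(i < n) q`_i.
Proof.
by move=> qn; rewrite (horner_coef_wide _ qn); apply: eq_bigr => i _; rewrite expr1n mulr1.
Qed.

Lemma deriv_horner1E q n : (size q <= n)%N -> q^`().[1] = \sum_(i < n) q`_i * i%:R.
Proof.
case: n => [|n] qn; first by move: qn; rewrite leqn0 size_poly_eq0 => /eqP ->;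
  rewrite big_ord0 derivC horner0.
rewrite (@horner1E _ n.+1); last exact: leq_trans (size_poly _ _) (leq_trans (leq_pred _) qn).
rewrite [LHS]big_ord_recr [RHS]big_ord_recl /= mulr0 add0r.
rewrite [X in _ + X]coef_deriv nth_default ?mul0rn ?addr0 //.
by apply: eq_bigr => i _; rewrite coef_deriv /bump /= add1n mulr_natr.
Qed.

Lemma sum_coef_le q n : nneg_poly q -> \sum_(i < n) q`_i <= q.[1].
Proof.
move=> q0; rewrite (@horner1E q (n + size q)) ?leq_addl //.
by rewrite big_split_ord /= lerDl sumr_ge0 // => i _; exact: nneg_coef.
Qed.

Lemma coef_le_horner1 q i : nneg_poly q -> q`_i <= q.[1].
Proof.
move=> q0; apply: le_trans (sum_coef_le i.+1 q0).
by rewrite big_ord_recr lerDr sumr_ge0 // => j _; exact: nneg_coef.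
Qed.

Lemma horner1_ge0 q : nneg_poly q -> 0 <= q.[1].
Proof. by move=> q0; apply: le_trans (coef_le_horner1 0 q0); exact: nneg_coef. Qed.

(** Convolution with a measure of mass g.[1] multiplies the supremum norm by at
    most g.[1]. *)
Lemma coefM_sup q g B j : (forall i, `|q`_i| <= B) -> nneg_poly g ->
  `|(q * g)`_j| <= B * g.[1].
Proof.
move=> qB g0; have B0 : 0 <= B := le_trans (normr_ge0 _) (qB 0%N).
rewrite coefMr; apply: le_trans (ler_norm_sum _ _ _) _.
apply: le_trans (_ : \sum_(i < j.+1) B * g`_i <= _).
  apply: ler_sum => i _; rewrite normrM (ger0_norm (nneg_coef _ g0)).
  by rewrite ler_wpM2r ?nneg_coef.
by rewrite -big_distrr ler_wpM2l // sum_coef_le.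
Qed.

(** This bounds the mean of 1 / (1 + Y) for Y binomial, using
    'C(N, i) / (i + 1) = 'C(N + 1, i + 1) / (N + 1). *)
Lemma sum_binomial_inv (a b : R) N : 0 <= a -> 0 <= b ->
  a * N.+1%:R * (\sum_(i < N.+1) a ^+ i * b ^+ (N - i) * 'C(N, i)%:R / i.+1%:R)
  <= (a + b) ^+ N.+1.
Proof.
move=> a0 b0; rewrite addrC exprDn [leRHS]big_ord_recl /= -[leLHS]add0r.
apply: lerD; first by rewrite mulrn_wge0 // mulr_ge0 ?exprn_ge0.
rewrite big_distrr /=; apply: ler_sum => i _.
rewrite /bump /= add1n subSS -[leRHS]mulr_natr.
have E : N.+1%:R * 'C(N, i)%:R = i.+1%:R * 'C(N.+1, i.+1)%:R :> R.
  by rewrite -!natrM mul_bin_diag.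
apply: le_of_eq.
transitivity (a ^+ i * a * b ^+ (N - i) * (N.+1%:R * 'C(N, i)%:R) / i.+1%:R); first by ring.
by rewrite E exprSr; field; rewrite addrC natr1 pnatr_eq0.
Qed.

(** Each of the N blocks of r steps either uses the two-atom part or the
    remainder g; i is the number of blocks of the first kind. *)
Lemma pow_split (P g : {poly R}) theta y r N s :
  P ^+ r = theta *: ('X^y * (1 + 'X)) + g ->
  P ^+ (r * N + s) = \sum_(i < N.+1)
    (theta ^+ i * 'C(N, i)%:R) *: ('X^(y * i) * g ^+ (N - i) * P ^+ s * (1 + 'X) ^+ i).
Proof.
move=> Pr; rewrite exprD exprM Pr addrC exprDn big_distrl /=; apply: eq_bigr => i _.
rewrite -!mul_polyC -mulr_natr !exprMn -exprM polyCM !rmorphXn rmorph_nat /=; ring.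
Qed.

Lemma half_horner1 (P g : {poly R}) theta y r : nneg_poly P -> P.[1] <= 1 ->
  P ^+ r = theta *: ('X^y * (1 + 'X)) + g -> g.[1] <= 1 - 2 * theta.
Proof.
move=> P0 P1 Pr; have := exprn_ile1 r (horner1_ge0 P0) P1.
rewrite -horner_exp Pr hornerD hornerZ hornerM hornerXn hornerD -polyC1 hornerC hornerX.
rewrite expr1n; lra.
Qed.

(** Conditionally on i blocks of the two-atom kind, the walk contains a binomial
    variable with parameter i, whose probabilities vary by at most 2 / (i + 1)
    between neighbours ([bin_diff_le]); then average over i. *)
Lemma smooth_pow (P g : {poly R}) theta y r N s j : 0 < theta ->
  nneg_poly P -> nneg_poly g -> P.[1] <= 1 ->
  P ^+ r = theta *: ('X^y * (1 + 'X)) + g ->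
  `|((1 - 'X) * P ^+ (r * N + s))`_j| <= (theta * N.+1%:R)^-1.
Proof.
move=> t0 P0 g0 P1 Pr; have g1 := half_horner1 P0 P1 Pr.
have g10 := horner1_ge0 g0.
have P10 := horner1_ge0 P0.
rewrite (pow_split _ _ Pr) big_distrr /= coef_sum.
apply: le_trans (ler_norm_sum _ _ _) _.
have -> : (theta * N.+1%:R)^-1 = 2 * (2 * theta * N.+1%:R)^-1 * 1 :> R.
  by rewrite mulr1 -mulrA [in RHS]invfM mulrA mulfV ?mul1r.
apply: le_trans (_ : 2 * (\sum_(i < N.+1) (2 * theta) ^+ i * (1 - 2 * theta) ^+ (N - i)
    * 'C(N, i)%:R / i.+1%:R) <= _); last first.
  rewrite mulr1 ler_wpM2l // -[leRHS]mul1r ler_pdivlMr ?mulr_gt0 // mulrC.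
  apply: le_trans (@sum_binomial_inv (2 * theta) (1 - 2 * theta) N _ _) _.
  - by rewrite mulr_ge0 // ltW.
  - exact: le_trans g1.
  - by rewrite addrC subrK expr1n.
rewrite big_distrr /=; apply: ler_sum => i _.
rewrite -scalerAr coefZ normrM ger0_norm; last by rewrite mulr_ge0 ?exprn_ge0 ?(ltW t0).
rewrite (mulrC _ ((1 + 'X) ^+ i)) (mulrA (1 - 'X : {poly R})).
set G := 'X^_ * _ * _.
have G0 : nneg_poly G.
    apply: nneg_polyM; last exact: nneg_poly_exp.
    by apply: nneg_polyM; [exact: nneg_polyXn|exact: nneg_poly_exp].
have G1 : G.[1] <= (1 - 2 * theta) ^+ (N - i).
  rewrite /G !hornerE expr1n mul1r -[leRHS]mulr1 ler_pM ?exprn_ge0 //.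
    by rewrite lerXn2r ?nnegrE // (le_trans g10).
  exact: exprn_ile1.
have := @coefM_sup _ G _ j (@bin_diff_le R i) G0.
move=> /le_trans H.
apply: le_trans (_ : theta ^+ i * 'C(N, i)%:R *
   (2 ^+ i.+1 / i.+1%:R * (1 - 2 * theta) ^+ (N - i)) <= _).
  rewrite ler_wpM2l ?mulr_ge0 ?exprn_ge0 ?(ltW t0) //; apply: H.
  by rewrite ler_wpM2l // divr_ge0 ?exprn_ge0.
apply: le_of_eq; rewrite exprMn exprS; ring.
Qed.

(** If consecutive coefficients differ by at most e, a coefficient M forces about
    M / e neighbours to be at least M / 2 on average, and their sum is at most 1. *)
Lemma sup_of_smooth q e j : nneg_poly q -> q.[1] <= 1 -> 0 < e ->
  (forall i, `|((1 - 'X) * q)`_i| <= e) -> q`_j ^+ 2 <= 3 * e.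
Proof.
move=> q0 q1 e0 He; set M := q`_j.
have M0 : 0 <= M by exact: nneg_coef.
have M1 : M <= 1 by apply: le_trans q1; exact: coef_le_horner1.
have step i : q`_i <= q`_i.+1 + e.
  have := He i.+1; rewrite coef_1BX_mul ler_norml => /andP[+ _]; lra.
have lo i : M - i%:R * e <= q`_(j + i).
  elim: i => [|i IH]; first by rewrite mul0r subr0 addn0.
  by have := step (j + i)%N; rewrite addnS -natr1; lra.
(* The coefficient at distance i is at least M - i * e, positive for i < t. *)
set t := Num.trunc (M / e).
have Me0 : 0 <= M / e by rewrite divr_ge0 // ltW.
have /andP[t1 t2] := truncn_itv Me0; rewrite -/t in t1 t2.
have S1 : \sum_(i < t) (M - i%:R * e) <= 1.
  apply: le_trans q1; apply: le_trans (sum_coef_le (j + t) q0).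
  rewrite big_split_ord /= -[leLHS]add0r lerD ?sumr_ge0 //.
  by apply: ler_sum => i _; exact: lo.
have S2 : 2 * (\sum_(i < t) (M - i%:R * e)) = t%:R * (2 * M - (t%:R - 1) * e).
  elim: t {t1 t2 S1} => [|t IH]; first by rewrite big_ord0 mulr0 mul0r.
  by rewrite big_ord_recr /= mulrDr IH -natr1; ring.
have te : t%:R * e <= M by rewrite -ler_pdivlMr.
have te2 : M <= (t%:R + 1) * e by rewrite natr1 -ler_pdivrMr // ltW.
have t0 : 0 <= t%:R :> R by [].
have tM : t%:R * M <= 2 by nra.
nra.
Qed.

(** The coefficients of S q are averages of those of q, shifted by a random amount
    with law S; replacing this shift by D costs e times the distance. *)
Lemma shift_pow S q e J D : nneg_poly S -> 0 <= e ->
  (forall i, `|((1 - 'X) * q)`_i| <= e) -> (D <= J)%N ->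
  `|(S * q)`_J - S.[1] * q`_(J - D)| <= e * (S^`().[1] + D%:R * S.[1]).
Proof.
move=> S0 e0 He DJ.
pose w y := if (y <= J)%N then q`_(J - y) else 0.
have w1 y : `|w y - w y.+1| <= e.
  rewrite /w; case: (ltngtP y J) => [yJ|Jy|->].
  - have := He (J - y)%N; rewrite coef_1BX_mul.
    by rewrite -(@prednK (J - y)%N) ?subn_gt0 // subnS.
  - by rewrite subrr normr0.
  - by have := He 0%N; rewrite coef_1BX_mul subnn subr0.
have wle a b : (a <= b)%N -> `|w a - w b| <= e * (b - a)%:R.
  elim: b => [|b IH]; first by rewrite leqn0 => /eqP ->; rewrite subrr normr0 mulr0.
  rewrite leq_eqVlt => /orP[/eqP ->|]; first by rewrite subrr normr0 subnn mulr0.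
  rewrite ltnS => ab; have -> : w a - w b.+1 = (w a - w b) + (w b - w b.+1) by ring.
  apply: le_trans (ler_normD _ _) _; apply: le_trans (lerD (IH ab) (w1 b)) _.
  by rewrite subSn // -natr1 mulrDr mulr1.
have wD y : `|w y - w D| <= e * (y%:R + D%:R).
  rewrite -natrD; case: (leqP y D) => [yD|/ltnW Dy]; last first.
    rewrite distrC; apply: le_trans (wle _ _ Dy) _.
    by rewrite ler_wpM2l // ler_nat; lia.
  apply: le_trans (wle _ _ yD) _.
  by rewrite ler_wpM2l // ler_nat; lia.
set n := (J.+1 + size S)%N.
have E1 : (S * q)`_J = \sum_(y < n) S`_y * w y.
  rewrite coefM [RHS]big_split_ord /= [X in _ + X]big1 ?addr0 => [|i _]; last first.
    by rewrite /w leqNgt ltnS leq_addr mulr0.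
  by apply: eq_bigr => y _; rewrite /w -ltnS ltn_ord.
have szS : (size S <= n)%N by rewrite leq_addl.
have E2 := deriv_horner1E szS.
have -> : q`_(J - D) = w D by rewrite /w DJ.
rewrite E1 E2 (horner1E szS) big_distrl /= -sumrB.
apply: le_trans (ler_norm_sum _ _ _) _.
rewrite [D%:R * _]mulrC big_distrl -big_split big_distrr /=.
apply: ler_sum => y _; rewrite -mulrBr normrM (ger0_norm (nneg_coef _ S0)).
by rewrite -mulrDr mulrCA ler_wpM2l ?nneg_coef.
Qed.

(** * Second moments *)
(** The sum of q`_i (i - a) ^ 2 ([second_momentE]); in terms of derivatives at 1,
    products and powers are computed by the Leibniz rule. *)
Definition second_moment (a : R) q := q^`()^`().[1] + (1 - 2 * a) * q^`().[1] + a ^+ 2 * q.[1].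

Lemma second_momentD a p q : second_moment a (p + q) = second_moment a p + second_moment a q.
Proof. by rewrite /second_moment !derivD !hornerD; ring. Qed.

Lemma second_momentZ a c q : second_moment a (c *: q) = c * second_moment a q.
Proof. by rewrite /second_moment !derivZ !hornerZ; ring. Qed.

Lemma second_moment_sum a n (F : 'I_n -> {poly R}) : second_moment a (\sum_(i < n) F i) = \sum_(i < n) second_moment a (F i).
Proof.
have m20 : second_moment a 0 = 0 by rewrite /second_moment !linear0 !horner0; ring.
by apply: (big_morph (second_moment a)); [exact: second_momentD|].
Qed.

Lemma second_momentE a q n : (size q <= n)%N -> second_moment a q = \sum_(i < n) q`_i * (i%:R - a) ^+ 2.
Proof.
move=> qn; transitivity (\sum_(i < size q) q`_i * (i%:R - a) ^+ 2); last first.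
  rewrite (big_ord_widen n (fun i => q`_i * (i%:R - a) ^+ 2)) // big_mkcond.
  by apply: eq_bigr => i _; case: ltnP => // qi; rewrite nth_default // mul0r.
rewrite -{1}(coefK q) poly_def second_moment_sum; apply: eq_bigr => i _; rewrite second_momentZ.
congr (_ * _); rewrite /second_moment derivXn derivMn derivXn !hornerMn !hornerXn !expr1n.
case: (nat_of_ord i) => [|k]; first by ring.
by rewrite /= -natr1; ring.
Qed.

(** Averaging over a binomial variable can only decrease a second moment, by the
    convexity of the square; i / 2 is the mean of the binomial variable. *)
Lemma second_moment_binomial a q i : nneg_poly q ->
  2 ^+ i * second_moment (a - i%:R / 2) q <= second_moment a (q * (1 + 'X) ^+ i).
Proof.
move=> q0; elim: i a => [|i IH] a; first by rewrite mul0r subr0 !mulr1 mul1r.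
have step p : second_moment a (p * (1 + 'X)) = 2 * second_moment (a - 2^-1) p + p.[1] / 2.
  have E (r : {poly R}) : (r * (1 + 'X))^`() = r^`() * (1 + 'X) + r.
    by rewrite derivM derivD derivX -polyC1 derivC add0r mulr1.
  have H (r : {poly R}) : (r * (1 + 'X)).[1] = 2 * r.[1].
    by rewrite hornerM hornerD hornerX -polyC1 hornerC; ring.
  by rewrite /second_moment !E derivD E !hornerD !H; field.
rewrite [(1 + 'X) ^+ _]exprSr mulrA step exprS -mulrA.
apply: le_trans (_ : 2 * second_moment (a - 2^-1) (q * (1 + 'X) ^+ i) <= _); last first.
  rewrite lerDl divr_ge0 // horner1_ge0 //.
  by apply: nneg_polyM => //; exact: nneg_poly_1DX.
rewrite ler_wpM2l //; apply: le_trans (IH _).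
by rewrite -[i.+1%:R]natr1 (_ : a - (i%:R + 1) / 2 = a - 2^-1 - i%:R / 2) //; field.
Qed.

(** The squared bias plus n times the second moment of one step, which is at least
    its variance; the mass q.[1] may be smaller than 1. *)
Lemma second_moment_pow_le a q n : nneg_poly q -> q.[1] <= 1 -> (1 < n)%N ->
  second_moment a (q ^+ n) <= (n%:R * q^`().[1] - a * q.[1]) ^+ 2
                   + n%:R * (q^`()^`().[1] + q^`().[1]).
Proof.
case: n => [|[|n]] // q0 q1 _.
have q10 := horner1_ge0 q0.
have d0 : 0 <= q^`().[1].
  exact/horner1_ge0/nneg_poly_deriv.
have dd0 : 0 <= q^`()^`().[1].
  exact/horner1_ge0/nneg_poly_deriv/nneg_poly_deriv.
set f0 := q.[1] in q10 q1 *; set f1 := q^`().[1] in d0 *.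
set f2 := q^`()^`().[1] in dd0 *.
have E1 : (q ^+ n.+2)^`().[1] = n.+2%:R * (f1 * f0 ^+ n.+1).
  by rewrite deriv_exp hornerMn hornerM horner_exp -[LHS]mulr_natl.
have E2 : (q ^+ n.+2)^`()^`().[1] =
    n.+2%:R * (f2 * f0 ^+ n.+1 + f1 * (n.+1%:R * (f1 * f0 ^+ n))).
  rewrite deriv_exp derivMn hornerMn -[LHS]mulr_natl; congr (_ * _).
  rewrite derivM deriv_exp hornerD !hornerM hornerMn hornerM !horner_exp.
  by rewrite /= mulr_natl.
rewrite /second_moment E1 E2 horner_exp -/f0; set N : R := n.+2%:R.
have -> : n.+1%:R = N - 1 :> R by rewrite /N -[n.+2%:R]natr1 addrK.
have N0 : 0 <= N by rewrite ler0n.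
have u0 : 0 <= f0 ^+ n by exact: exprn_ge0.
have u1 : f0 ^+ n <= 1 by exact: exprn_ile1.
rewrite !(exprS f0); move: (f0 ^+ n) u0 u1 => u u0 u1.
have -> : N * (f2 * (f0 * u) + f1 * ((N - 1) * (f1 * u))) +
   (1 - 2 * a) * (N * (f1 * (f0 * u))) + a ^+ 2 * (f0 * (f0 * u)) =
   u * (N * f1 - a * f0) ^+ 2 + (N * (f2 + f1) * (u * f0) - N * f1 ^+ 2 * u) by ring.
apply: lerD; first by rewrite -[leRHS]mul1r ler_wpM2r ?sqr_ge0.
have H1 : N * (f2 + f1) * (u * f0) <= N * (f2 + f1).
  rewrite -[leRHS]mulr1; apply: ler_wpM2l; last exact: mulr_ile1.
  exact: mulr_ge0 N0 (addr_ge0 dd0 d0).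
have H2 : 0 <= N * f1 ^+ 2 * u by rewrite !mulr_ge0 ?exprn_ge0.
lra.
Qed.
End NonnegPoly.

(** * A lower bound for point probabilities *)
Section LowerBound.
Variable R : realType.
Implicit Types (P g G : {poly R}).

(** Here i counts the two-atom blocks among n %/ r, and w is the value of the other
    part of the walk.  If i has order n and the conditional mean w + i / 2 of the
    walk is at distance O(sqrt n) of the target J, then J is reached with
    probability of order 1 / sqrt n ([binomial_lower_bound]).  Otherwise one of the
    two subtracted terms exceeds 1 and the left side is negative; these terms have
    small means, so that no event has to be discussed when averaging. *)
Lemma lower_binomial_mean (theta B : R) (r : nat) :
  0 < theta -> 0 <= B -> (0 < r)%N ->
  exists2 c : R, 0 < c & exists n0 : nat, forall n J i w : nat, (n0 <= n)%N ->
    (i <= n %/ r)%N ->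
    c / Num.sqrt n%:R * (1 - 4 * (w%:R - (J%:R - i%:R / 2)) ^+ 2 / ((16 * B + 1) * n%:R)
       - theta / 2 * (n %/ r).+1%:R / i.+1%:R)
    <= (if (w <= J)%N then 'C(i, J - w)%:R else 0) / 2 ^+ i.
Proof.
move=> t0 B0 r0; set A := 16 * B + 1.
have A0 : 0 < A by rewrite /A; lra.
have r0' : 0 < r%:R :> R by rewrite ltr0n.
(* For n large, v <= 1 below implies i >= kap * n. *)
pose kap : R := theta / (4 * r%:R).
have k0 : 0 < kap by rewrite /kap divr_gt0 // mulr_gt0.
have A'0 : 0 <= A / kap by rewrite divr_ge0 ?ltW.
have [c c0 [i0 Hi0]] := binomial_lower_bound A'0; exists c => //.
pose b : R := 4 * r%:R / theta + i0%:R / kap + A / kap / kap.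
exists (Num.trunc b).+1 => n J i w.
rewrite -(ler_nat R) => /(lt_le_trans (truncnS_gt _)) nb iN.
have b1 : 0 <= 4 * r%:R / theta :> R by rewrite divr_ge0 ?mulr_ge0 // ltW.
have b2 : 0 <= i0%:R / kap :> R by rewrite divr_ge0 // ltW.
have b3 : 0 <= A / kap / kap by rewrite divr_ge0 // ltW.
have n1 : 4 * r%:R <= theta * n%:R by rewrite [leRHS]mulrC -ler_pdivrMr //; move: nb; rewrite /b; lra.
have n2 : i0%:R <= kap * n%:R by rewrite [leRHS]mulrC -ler_pdivrMr //; move: nb; rewrite /b; lra.
have n3 : A / kap < kap * n%:R by rewrite [ltRHS]mulrC -ltr_pdivrMr //; move: nb; rewrite /b; lra.
have n0 : 0 < n%:R :> R.
  by rewrite -(pmulr_rgt0 _ t0) (lt_le_trans _ n1) // mulr_gt0.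
have q0 : 0 < Num.sqrt n%:R :> R by rewrite sqrtr_gt0.
have rhs0 : 0 <= (if (w <= J)%N then 'C(i, J - w)%:R else 0) / 2 ^+ i :> R.
  by rewrite divr_ge0 ?exprn_ge0 //; case: ifP.
set x := _ ^+ 2; set u := 4 * x / _; set v := _ / i.+1%:R.
have An0 : 0 < A * n%:R by rewrite mulr_gt0.
have u0 : 0 <= u by rewrite /u divr_ge0 ?(ltW An0) // mulr_ge0 ?sqr_ge0.
have i1 : 0 < i.+1%:R :> R by rewrite ltr0n.
have v0 : 0 <= v by rewrite /v divr_ge0 // mulr_ge0 // divr_ge0 // ltW.
have [uv|uv] := ltP (1 - u - v) 0.
  by apply: le_trans rhs0; rewrite nmulr_lle0 // ltW // divr_gt0.
have u1 : u <= 1 by lra.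
have v1 : v <= 1 by lra.
have in2 : i%:R <= n%:R :> R by rewrite ler_nat (leq_trans iN) // leq_div.
have nr : n%:R <= r%:R * (n %/ r).+1%:R :> R.
  by rewrite -natrM ler_nat mulnC ltnW // -ltn_divLR.
have ik : kap * n%:R <= i%:R.
  move: v1; rewrite /v ler_pdivrMr // mul1r -[i.+1%:R]natr1 => v1.
  rewrite /kap mulrAC ler_pdivrMr ?mulr_gt0 //.
  have : theta / 2 * (r%:R * (n %/ r).+1%:R) <= r%:R * (i%:R + 1).
    by rewrite mulrCA ler_wpM2l // ltW.
  have : theta / 2 * n%:R <= theta / 2 * (r%:R * (n %/ r).+1%:R).
    by rewrite ler_wpM2l // divr_ge0 // ltW.
  nra.
have ip : 0 < i%:R :> R by apply: lt_le_trans ik; rewrite mulr_gt0.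
have Hx : 4 * x <= A / kap * i%:R.
  move: u1; rewrite /u ler_pdivrMr ?mulr_gt0 // mul1r => /le_trans; apply.
  by rewrite -mulrA ler_wpM2l ?(ltW A0) // mulrC ler_pdivlMr // mulrC.
have ii0 : (i0 <= i)%N by rewrite -(ler_nat R) (le_trans n2).
case: leqP => [wJ|Jw]; last first.
  exfalso; have Jw' : J%:R <= w%:R :> R by rewrite ler_nat ltnW.
  have : i%:R * i%:R <= 4 * x by rewrite /x; have : 0 <= i%:R :> R by []; nra.
  have : A / kap < i%:R by exact: lt_le_trans ik.
  nra.
have [|ti] := Hi0 i (J - w)%N ii0.
  apply: le_trans Hx; rewrite /x -muln2 natrM natrB //; apply: le_of_eq.
  by field.
apply: le_trans.
apply: le_trans (_ : c / Num.sqrt n%:R <= _).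
  by rewrite ler_piMr ?divr_ge0 ?sqrtr_ge0 ?(ltW c0) //; lra.
by rewrite ler_wpM2l ?(ltW c0) // lef_pV2 ?posrE ?sqrtr_gt0 // ler_sqrt.
Qed.

(** Average [lower_binomial_mean] over i and w: the total mass is at least 7 / 8, and
    the two error terms have means at most 1 / 4, by the bound on the second moment
    and by [sum_binomial_inv]. *)
Lemma lower_pow (theta B : R) (r : nat) :
  0 < theta -> 0 <= B -> (0 < r)%N ->
  exists2 c : R, 0 < c & exists n0 : nat, forall P g y n J, (n0 <= n)%N ->
    nneg_poly P -> nneg_poly g -> P.[1] <= 1 ->
    P ^+ r = theta *: ('X^y * (1 + 'X)) + g ->
    7 / 8 <= P.[1] ^+ n -> second_moment J%:R (P ^+ n) <= B * n%:R ->
    c / Num.sqrt n%:R <= (P ^+ n)`_J.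
Proof.
move=> t0 B0 r0; have [c c0 [n0 Hc]] := lower_binomial_mean t0 B0 r0.
exists (c * (3 / 8)); first by rewrite mulr_gt0 // divr_gt0.
exists (maxn n0 1) => P g y n J nn P0 g0 P1 Pr Pn Vn.
have {nn} [nn n1] : (n0 <= n)%N /\ (0 < n)%N by move: nn; rewrite geq_max => /andP[].
have g1 := half_horner1 P0 P1 Pr.
have g10 := horner1_ge0 g0; have P10 := horner1_ge0 P0.
set N := (n %/ r)%N in Hc.
have En : n = (r * N + n %% r)%N by rewrite mulnC; exact: divn_eq.
pose s := (n %% r)%N.
have n0' : 0 < n%:R :> R by rewrite ltr0n.
pose G (i : 'I_N.+1) := 'X^(y * i) * g ^+ (N - i) * P ^+ s.
have G0 i : nneg_poly (G i).
  apply: nneg_polyM; last exact: nneg_poly_exp.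
  by apply: nneg_polyM; [exact: nneg_polyXn|exact: nneg_poly_exp].
have G1 i : (G i).[1] <= (1 - 2 * theta) ^+ (N - i).
  rewrite /G !hornerM !horner_exp hornerX expr1n mul1r -[leRHS]mulr1 ler_pM ?exprn_ge0 //.
    by rewrite lerXn2r ?nnegrE // (le_trans g10).
  exact: exprn_ile1.
have PE : P ^+ n = \sum_(i < N.+1) (theta ^+ i * 'C(N, i)%:R) *: (G i * (1 + 'X) ^+ i).
  by rewrite {1}En (pow_split _ _ Pr).
set A := 16 * B + 1 in Hc; have A0 : 0 < A by rewrite /A; lra.
set k := c / Num.sqrt n%:R.
have k0 : 0 <= k by rewrite divr_ge0 ?sqrtr_ge0 // ltW.
have H1 (q : {poly R}) i : (q * (1 + 'X) ^+ i).[1] = 2 ^+ i * q.[1].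
  rewrite hornerM horner_exp hornerD hornerX -polyC1 hornerC mulrC.
  by rewrite (_ : 1 + 1 = 2 :> R) //; ring.
have term (i : 'I_N.+1) : k * ((1 - theta / 2 * N.+1%:R / i.+1%:R) * (2 ^+ i * (G i).[1])
     - 4 / (A * n%:R) * second_moment J%:R (G i * (1 + 'X) ^+ i)) <= (G i * (1 + 'X) ^+ i)`_J.
  set q := G i; have qs : (size q <= J.+1 + size q)%N by rewrite leq_addl.
  have -> : (q * (1 + 'X) ^+ i)`_J = \sum_(w < J.+1 + size q)
      q`_w * (if (w <= J)%N then 'C(i, J - w)%:R else 0).
    rewrite coefM [RHS]big_split_ord /= [X in _ = _ + X]big1 ?addr0 => [|w _]; last first.
      by rewrite leqNgt ltnS leq_addr mulr0.
    by apply: eq_bigr => w _; rewrite coef_1DXn -ltnS ltn_ord.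
  apply: le_trans (_ : k * ((1 - theta / 2 * N.+1%:R / i.+1%:R) * (2 ^+ i * q.[1])
     - 4 / (A * n%:R) * (2 ^+ i * second_moment (J%:R - i%:R / 2) q)) <= _).
    rewrite ler_wpM2l // lerD2l lerN2 ler_wpM2l ?(second_moment_binomial _ _ (G0 i)) //.
    by rewrite divr_ge0 // mulr_ge0 // ltW.
  rewrite (horner1E qs) (second_momentE _ qs) !big_distrr /= -sumrB big_distrr /=.
  apply: ler_sum => w _.
  have := Hc n J i w nn; rewrite -ltnS ltn_ord => /(_ isT).
  rewrite ler_pdivlMr ?exprn_gt0 // -/k => /(ler_wpM2l (nneg_coef w (G0 i))).
  apply: le_trans; apply: le_of_eq.
  by rewrite -/q; field; rewrite !gt_eqF // addrC natr1 ltr0n.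
rewrite PE coef_sum.
apply: le_trans (_ : \sum_(i < N.+1) (theta ^+ i * 'C(N, i)%:R) *
  (k * ((1 - theta / 2 * N.+1%:R / i.+1%:R) * (2 ^+ i * (G i).[1])
     - 4 / (A * n%:R) * second_moment J%:R (G i * (1 + 'X) ^+ i))) <= _); last first.
  apply: ler_sum => i _; rewrite coefZ ler_wpM2l // mulr_ge0 ?exprn_ge0 //; exact: ltW.
have E1 : P.[1] ^+ n = \sum_(i < N.+1) (theta ^+ i * 'C(N, i)%:R) * (2 ^+ i * (G i).[1]).
  rewrite -horner_exp PE horner_sum; apply: eq_bigr => i _; by rewrite hornerZ H1.
have E2 : second_moment J%:R (P ^+ n) = \sum_(i < N.+1) (theta ^+ i * 'C(N, i)%:R) *
    second_moment J%:R (G i * (1 + 'X) ^+ i).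
  by rewrite PE second_moment_sum; apply: eq_bigr => i _; rewrite second_momentZ.
set S3 := \sum_(i < N.+1) (theta ^+ i * 'C(N, i)%:R) * (2 ^+ i * (G i).[1]) / i.+1%:R.
have E3 : S3 * (theta / 2 * N.+1%:R) <= 1 / 4.
  have H : S3 <= \sum_(i < N.+1) (2 * theta) ^+ i * (1 - 2 * theta) ^+ (N - i)
    * 'C(N, i)%:R / i.+1%:R.
    apply: ler_sum => i _; rewrite ler_wpM2r ?invr_ge0 // exprMn.
    rewrite (_ : 2 ^+ i * theta ^+ i * _ * _ =
        theta ^+ i * 'C(N, i)%:R * (2 ^+ i * (1 - 2 * theta) ^+ (N - i))); last by ring.
    rewrite ler_wpM2l ?mulr_ge0 ?exprn_ge0 ?(ltW t0) //.
    by rewrite ler_wpM2l ?exprn_ge0.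
  have := @sum_binomial_inv R (2 * theta) (1 - 2 * theta) N.
  rewrite [2 * theta + _]addrC subrK expr1n => /(_ _ (le_trans g10 g1)) => HH.
  have {}HH := HH (mulr_ge0 _ (ltW t0)); rewrite ler0n in HH; have {}HH := HH isT.
  have : S3 * (2 * theta * N.+1%:R) <= 1.
    by apply: le_trans HH; rewrite mulrC ler_wpM2l // !mulr_ge0 // ltW.
  lra.
have -> : \sum_(i < N.+1) (theta ^+ i * 'C(N, i)%:R) *
  (k * ((1 - theta / 2 * N.+1%:R / i.+1%:R) * (2 ^+ i * (G i).[1])
     - 4 / (A * n%:R) * second_moment J%:R (G i * (1 + 'X) ^+ i))) =
  k * (P.[1] ^+ n - S3 * (theta / 2 * N.+1%:R) - 4 / (A * n%:R) * second_moment J%:R (P ^+ n)).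
  rewrite E1 E2 /S3 big_distrl [4 / _ * _]big_distrr /= -!sumrB big_distrr /=.
  by apply: eq_bigr => i _; ring.
have E4 : 4 / (A * n%:R) * second_moment J%:R (P ^+ n) <= 1 / 4.
  rewrite mulrAC ler_pdivrMr ?mulr_gt0 //.
  apply: le_trans (_ : 4 * (B * n%:R) <= _); first by rewrite ler_wpM2l.
  by rewrite /A; have := ltW n0'; nra.
rewrite mulrAC -/k ler_wpM2l //; lra.
Qed.
End LowerBound.

(** * Local limit estimates for a law of span 1 *)
Section LocalLimit.
Variables (R : realType) (f : nat -> R) (h : nat) (V : R).
Hypothesis h_gt0 : (0 < h)%N.
Hypothesis f_ge0 : forall d, 0 <= f d.
Hypothesis mass_le1 : forall K, \sum_(d < K) f d <= 1.
Hypothesis mass_cvg : forall e : R, 0 < e ->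
  exists K0 : nat, forall K, (K0 <= K)%N -> 1 - e <= \sum_(d < K) f d.
Hypothesis mean_le1 : forall K, h%:R * \sum_(d < K) f d * d%:R <= 1.
Hypothesis mean_cvg : forall e : R, 0 < e ->
  exists K0 : nat, forall K, (K0 <= K)%N -> 1 - e <= h%:R * \sum_(d < K) f d * d%:R.
Hypothesis sqr_le : forall K, \sum_(d < K) f d * d%:R ^+ 2 <= V.
Hypothesis f0_gt0 : 0 < f 0.
Hypothesis f_aperiodic : forall m, (forall d, 0 < f d -> (m %| d)%N) -> m = 1%N.

(** The truncation keeps everything polynomial; K is taken so large that the lost
    mass and mean are negligible. *)
Definition gen_poly (K : nat) : {poly R} := \poly_(d < K) f d.

(** The probability that N steps with law f add up to j: coefficients up to j are
    those of every longer truncation ([walk_probE]). *)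
Definition walk_prob (N j : nat) : R := (gen_poly j.+1 ^+ N)`_j.

Lemma gen_poly_nneg K : nneg_poly (gen_poly K).
Proof. by move=> i; rewrite coef_poly; case: ifP. Qed.

Lemma gen_poly_le K K' i : (K <= K')%N -> (gen_poly K)`_i <= (gen_poly K')`_i.
Proof.
move=> KK'; rewrite !coef_poly; case: ifP => [iK|_]; last by case: ifP.
by rewrite (leq_trans iK KK').
Qed.

Lemma le_coef_exp (p q : {poly R}) N i : nneg_poly p ->
  (forall j, p`_j <= q`_j) -> (p ^+ N)`_i <= (q ^+ N)`_i.
Proof.
move=> p0 pq; elim: N i => [|N IH] i //; rewrite !exprS !coefM.
by apply: ler_sum => j _; rewrite ler_pM // nneg_poly_exp.
Qed.

Lemma walk_probE K N j : (j < K)%N -> (gen_poly K ^+ N)`_j = walk_prob N j.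
Proof.
have E M j' : (j' <= j)%N -> (j < K)%N -> (gen_poly K ^+ M)`_j' = (gen_poly j.+1 ^+ M)`_j'.
  move=> + jK; elim: M j' => [|M IH] i ij //; rewrite !exprS !coefM.
  apply: eq_bigr => u _; rewrite IH; last by rewrite (leq_trans _ ij) // leq_subr.
  have uj : (u < j.+1)%N by rewrite ltnS (leq_trans _ ij) // -ltnS ltn_ord.
  by rewrite !coef_poly uj (leq_trans uj jK).
by move=> jK; apply: E.
Qed.

Lemma gen_poly1 K : (gen_poly K).[1] = \sum_(d < K) f d.
Proof.
rewrite (horner1E (size_poly _ _)); apply: eq_bigr => i _.
by rewrite coef_poly ltn_ord.
Qed.

Lemma gen_poly1_le1 K : (gen_poly K).[1] <= 1. Proof. by rewrite gen_poly1. Qed.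

Lemma gen_poly_deriv1 K : (gen_poly K)^`().[1] = \sum_(d < K) f d * d%:R.
Proof.
rewrite (deriv_horner1E (size_poly _ _)); apply: eq_bigr => i _.
by rewrite coef_poly ltn_ord.
Qed.

Lemma gen_poly_deriv2_le K : (gen_poly K)^`()^`().[1] + (gen_poly K)^`().[1] <= V.
Proof.
have -> : (gen_poly K)^`()^`().[1] + (gen_poly K)^`().[1] = second_moment 0 (gen_poly K).
  by rewrite /second_moment; ring.
rewrite (second_momentE _ (size_poly _ _)); apply: le_trans (sqr_le K).
by apply: ler_sum => i _; rewrite coef_poly ltn_ord subr0.
Qed.

Let reach (s : seq nat) := all (fun d => 0 < f d) s.

Lemma reach_gt0 s : reach s ->
  exists K0 : nat, forall K, (K0 <= K)%N -> 0 < (gen_poly K ^+ size s)`_(sumn s).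
Proof.
elim: s => [_|d s IH /= /andP[fd /IH [K0 HK]]].
  by exists 0%N => K _; rewrite expr0 coef1.
exists (maxn K0 d.+1) => K; rewrite geq_max => /andP[K0K dK].
rewrite exprS coefM.
have dl : (d < (d + sumn s).+1)%N by rewrite ltnS leq_addr.
rewrite (bigD1 (Ordinal dl)) //= addKn ltr_wpDr ?mulr_gt0 ?HK ?coef_poly ?dK //.
rewrite sumr_ge0 // => i _; rewrite mulr_ge0 //; first exact: gen_poly_nneg.
exact/nneg_poly_exp/gen_poly_nneg.
Qed.

(** The differences between the sums of two lists of possible steps of the same
    length are closed under subtraction, and contain all possible steps since 0 is
    one of them.  Their least positive element divides all steps, so it is 1. *)
Lemma reach_gap : exists s1 s2 : seq nat, [/\ size s1 = size s2, reach s1, reach s2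
  & sumn s2 = (sumn s1).+1].
Proof.
pose gap z := exists s1 s2 : seq nat, [/\ size s1 = size s2, reach s1, reach s2
  & sumn s2 = (sumn s1 + z)%N].
have gapB z1 z2 : (z2 <= z1)%N -> gap z1 -> gap z2 -> gap (z1 - z2)%N.
  move=> z21 [s1 [s2 [ss rs1 rs2 E]]] [t1 [t2 [tt rt1 rt2 E']]].
  exists (s1 ++ t2), (s2 ++ t1); split.
  - by rewrite !size_cat ss tt.
  - by rewrite /reach all_cat; apply/andP.
  - by rewrite /reach all_cat; apply/andP.
  - by rewrite !sumn_cat E E'; lia.
have gapf d : 0 < f d -> gap d.
  by move=> fd; exists [:: 0%N], [:: d]; split=> //=; rewrite ?f0_gt0 ?fd ?addn0.
have [d0 fd0 d0_gt0] : exists2 d, 0 < f d & (0 < d)%N.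
  apply: contrapT => Hn.
  suff : 2%N = 1%N by [].
  apply: f_aperiodic => -[|d] fd //; exfalso; apply: Hn; exists d.+1 => //.
have ex : exists z, (0 < z)%N && `[< gap z >].
  by exists d0; rewrite d0_gt0; apply/asboolP/gapf.
case: (ex_minnP ex) => z /andP[z0 /asboolP gz] zmin.
suff z1 : z = 1%N.
  by move: gz; rewrite z1 => -[s1 [s2 [? ? ? E]]]; exists s1, s2; split=> //; rewrite E addn1.
apply: f_aperiodic => d /gapf gd.
have gm k : (k * z <= d)%N -> gap (d - k * z)%N.
  elim: k => [|k IH] kd; first by rewrite subn0.
  have -> : (d - k.+1 * z = (d - k * z) - z)%N by lia.
  by apply: gapB => //; [lia|apply: IH; lia].
have := gm (d %/ z)%N (leq_trunc_div _ _).
rewrite (_ : (d - d %/ z * z = d %% z)%N); last by have := divn_eq d z; lia.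
move=> g; rewrite /dvdn; case: posnP => // mz.
by have := zmin (d %% z)%N; rewrite mz asboolT // => /(_ isT); rewrite leqNgt ltn_mod z0.
Qed.

(** With r and y given by [reach_gap], theta is the smaller of the probabilities that
    r steps add up to y and to y + 1. *)
Lemma gen_poly_bernoulli_part : exists (r y K0 : nat) (theta : R),
  [/\ (0 < r)%N, 0 < theta & forall K, (K0 <= K)%N -> exists2 g : {poly R},
      nneg_poly g & gen_poly K ^+ r = theta *: ('X^y * (1 + 'X)) + g].
Proof.
have [s1 [s2 [ss rs1 rs2 E]]] := reach_gap.
have [K1 H1] := reach_gt0 rs1; have [K2 H2] := reach_gt0 rs2.
set r := size s1; set y := sumn s1; pose K0 := maxn K1 K2.
pose th := Num.min (gen_poly K0 ^+ r)`_y (gen_poly K0 ^+ r)`_y.+1.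
have c1 : 0 < (gen_poly K0 ^+ r)`_y by apply: H1; rewrite leq_maxl.
have c2 : 0 < (gen_poly K0 ^+ r)`_y.+1 by rewrite /r ss -E; apply: H2; rewrite leq_maxr.
exists r, y, K0, th; split.
- by rewrite /r; case: (s1) ss E => // /esym/size0nil ->.
- by rewrite lt_min c1.
move=> K K0K; exists (gen_poly K ^+ r - th *: ('X^y * (1 + 'X))); last by rewrite addrC subrK.
have mon i := le_coef_exp r i (gen_poly_nneg K0) (fun j => gen_poly_le j K0K).
move=> i; rewrite coefB coefZ mulrDr mulr1 -exprSr coefD !coefXn subr_ge0.
have p0 : 0 <= (gen_poly K ^+ r)`_i by exact/nneg_poly_exp/gen_poly_nneg.
have [->|iy] := eqVneq i y.
  rewrite (_ : (y == y.+1) = false) ?addr0 ?mulr1; last by apply/eqP; lia.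
  by apply: le_trans (mon y); rewrite ge_min lexx.
have [->|iy1] := eqVneq i y.+1; last by rewrite addr0 mulr0.
by rewrite add0r mulr1; apply: le_trans (mon y.+1); rewrite ge_min lexx orbT.
Qed.

Lemma gen_poly_smooth : exists2 C : R, 0 < C & exists K0 : nat, forall K N i,
  (K0 <= K)%N -> (0 < N)%N -> `|((1 - 'X) * gen_poly K ^+ N)`_i| <= C / N%:R.
Proof.
have [r [y [K0 [th [r0 th0 H]]]]] := gen_poly_bernoulli_part.
have r0' : 0 < r%:R :> R by rewrite ltr0n.
exists (r%:R / th); first by rewrite divr_gt0.
exists K0 => K N i /H [g g0 E] N0.
rewrite {1}(divn_eq N r) mulnC.
apply: le_trans (smooth_pow _ _ _ th0 (gen_poly_nneg K) g0 (gen_poly1_le1 K) E) _.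
have N0' : 0 < N%:R :> R by rewrite ltr0n.
have nr : N%:R <= r%:R * (N %/ r).+1%:R :> R.
  by rewrite -natrM ler_nat mulnC ltnW // -ltn_divLR.
rewrite -[leLHS]mul1r ler_pdivrMr ?mulr_gt0 // [r%:R / th]mulrC.
have -> : th^-1 * r%:R / N%:R * (th * (N %/ r).+1%:R) =
  r%:R * (N %/ r).+1%:R / N%:R by field; rewrite !gt_eqF.
by rewrite ler_pdivlMr // mul1r.
Qed.

Lemma walk_prob_le1 N j : walk_prob N j <= 1.
Proof.
apply: le_trans (coef_le_horner1 _ (nneg_poly_exp _ (gen_poly_nneg _))) _.
by rewrite horner_exp exprn_ile1 ?gen_poly1_le1 // horner1_ge0 //; exact: gen_poly_nneg.
Qed.

(** A smooth sequence of sum at most 1 is small ([sup_of_smooth]). *)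
Lemma walk_prob_upper : exists2 C : R, 0 < C & forall N j, (0 < N)%N ->
  walk_prob N j <= C / Num.sqrt N%:R.
Proof.
have [C C0 [K0 H]] := gen_poly_smooth.
exists (Num.sqrt (3 * C)) => [|N j N0]; first by rewrite sqrtr_gt0 mulr_gt0.
have N0' : 0 < N%:R :> R by rewrite ltr0n.
pose K := maxn K0 j.+1; have jK : (j < K)%N by rewrite leq_maxr.
rewrite -(walk_probE _ jK); set x := (gen_poly K ^+ N)`_j.
have x0 : 0 <= x by exact/nneg_poly_exp/gen_poly_nneg.
have q0 : 0 < Num.sqrt N%:R :> R by rewrite sqrtr_gt0.
have x2 : x ^+ 2 <= 3 * (C / N%:R).
  apply: sup_of_smooth; rewrite ?divr_gt0 //.
  - exact/nneg_poly_exp/gen_poly_nneg.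
  - by rewrite horner_exp exprn_ile1 ?gen_poly1_le1 // horner1_ge0 //; exact: gen_poly_nneg.
  - by move=> i; apply: H; rewrite ?leq_maxl.
rewrite ler_pdivlMr // -(@ler_pXn2r _ 2) ?nnegrE ?mulr_ge0 ?sqrtr_ge0 //.
rewrite exprMn !sqr_sqrtr ?mulr_ge0 // ?(ltW C0) //.
by move: x2; rewrite mulrA ler_pdivlMr.
Qed.

(** The first M steps are a random shift whose mean is at most M ([shift_pow]). *)
Lemma walk_prob_shift : exists2 C : R, 0 < C & forall n M J D, (M < n)%N -> (D <= J)%N ->
  `|walk_prob n J - walk_prob (n - M) (J - D)| <= C * (M%:R + D%:R) / (n - M)%:R.
Proof.
have [C C0 [K0 H]] := gen_poly_smooth; exists (C + 1); first by rewrite addr_gt0.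
move=> n M J D Mn DJ; have n0 : 0 < n%:R :> R by rewrite ltr0n; lia.
have [K1 HK1] := mass_cvg (divr_gt0 ltr01 n0).
pose K := maxn K0 (maxn K1 J.+1).
have [K0K K1K JK] : [/\ (K0 <= K)%N, (K1 <= K)%N & (J < K)%N] by rewrite /K; clear; split; lia.
set F := gen_poly K; have F0 : nneg_poly F by exact: gen_poly_nneg.
have F1 : F.[1] <= 1 := gen_poly1_le1 K.
have F10 : 0 <= F.[1] by exact: horner1_ge0.
have nM0 : 0 < (n - M)%:R :> R by rewrite ltr0n subn_gt0.
have e0 : 0 <= C / (n - M)%:R by rewrite divr_ge0 // ltW.
rewrite -(walk_probE _ JK) -(@walk_probE K); last exact: leq_ltn_trans (leq_subr _ _) JK.
have := @shift_pow _ (F ^+ M) (F ^+ (n - M)) _ J D (nneg_poly_exp _ F0) e0 _ DJ.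
rewrite -exprD subnKC ?(ltnW Mn) // => /(_ (fun i => H K _ i K0K _)).
rewrite subn_gt0 => /(_ Mn); set Q := (F ^+ (n - M))`_(J - D).
set S1 := (F ^+ M).[1]; set S' := (F ^+ M)^`().[1] => H1.
have S11 : S1 <= 1 by rewrite /S1 horner_exp exprn_ile1.
have S'M : S' <= M%:R.
  rewrite /S' deriv_exp hornerMn hornerM horner_exp -[leLHS]mulr_natl ler_piMr //.
  have d1 : F^`().[1] <= 1.
    rewrite gen_poly_deriv1; apply: le_trans (mean_le1 K).
    rewrite ler_peMl ?ler1n // sumr_ge0 // => i _; exact: mulr_ge0.
  by rewrite mulr_ile1 ?exprn_ge0 ?exprn_ile1 // horner1_ge0 //; exact: nneg_poly_deriv.
have Q0 : 0 <= Q by exact: nneg_poly_exp.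
have Q1 : Q <= 1.
  by rewrite /Q walk_probE ?walk_prob_le1 // (leq_ltn_trans (leq_subr _ _)).
have S1M : 1 - S1 <= M%:R / n%:R.
  rewrite /S1 horner_exp; have F01 : 0 <= F.[1] <= 1 by rewrite F10.
  apply: le_trans (expr_1B_le M F01) _; rewrite ler_wpM2l //.
  have := HK1 K K1K; rewrite -gen_poly1 -/F div1r; lra.
have M0 : 0 <= M%:R :> R by []; have D0 : 0 <= D%:R :> R by [].
have MM : M%:R / n%:R <= M%:R / (n - M)%:R :> R.
  by rewrite ler_wpM2l // lef_pV2 ?posrE // ler_nat leq_subr.
have H2 : C / (n - M)%:R * (S' + D%:R * S1) <= C / (n - M)%:R * (M%:R + D%:R).
  by rewrite ler_wpM2l // lerD // ler_piMr.
have H3 : `|S1 * Q - Q| <= M%:R / (n - M)%:R.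
  rewrite -[X in _ - X]mul1r -mulrBl normrM distrC (ger0_norm Q0) ger0_norm ?subr_ge0 //.
  apply: le_trans MM; apply: le_trans S1M; rewrite ler_piMr ?subr_ge0 //.
have -> : (F ^+ n)`_J - Q = ((F ^+ n)`_J - S1 * Q) + (S1 * Q - Q) by rewrite addrA subrK.
apply: le_trans (ler_normD _ _) _.
apply: le_trans (lerD (le_trans H1 H2) H3) _.
rewrite (_ : (C + 1) * (M%:R + D%:R) / (n - M)%:R =
  C / (n - M)%:R * (M%:R + D%:R) + M%:R / (n - M)%:R + D%:R / (n - M)%:R); last by ring.
by rewrite lerDl divr_ge0.
Qed.

(** At J = (n - 1) / h the walk is at bounded distance of its mean n / h, and its
    variance is O(n), so [lower_pow] applies. *)
Lemma walk_prob_lower : exists2 c : R, 0 < c & exists n0 : nat, forall n J,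
  (n0 <= n)%N -> (h * J).+1 = n -> c / Num.sqrt n%:R <= walk_prob n J.
Proof.
have [r [y [K0 [th [r0 th0 H]]]]] := gen_poly_bernoulli_part.
have V0 : 0 <= V by apply: le_trans (sqr_le 0); rewrite big_ord0.
have B0 : 0 <= V + 4 by lra.
have [c c0 [n0 Hn]] := lower_pow th0 B0 r0; exists c => //.
exists (maxn n0 2) => n J; rewrite geq_max => /andP[n0n n2] hJ.
have n0' : 0 < n%:R :> R by rewrite ltr0n; lia.
(* With this precision, n steps lose at most 1 / 8 of their mass. *)
have e0 : 0 < (8 * n%:R)^-1 :> R by rewrite invr_gt0 mulr_gt0.
have [K1 HK1] := mass_cvg e0; have [K2 HK2] := mean_cvg e0.
pose K := maxn (maxn K0 K1) (maxn K2 J.+1).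
have [K0K K1K K2K JK] : [/\ (K0 <= K)%N, (K1 <= K)%N, (K2 <= K)%N & (J < K)%N].
  by rewrite /K; clear; split; lia.
have [g g0 E] := H K K0K.
have F0 := gen_poly_nneg K; have F1 := gen_poly1_le1 K; have F10 := horner1_ge0 F0.
have m1 : 1 - (8 * n%:R)^-1 <= (gen_poly K).[1] by rewrite gen_poly1; exact: HK1.
have d1 : 1 - (8 * n%:R)^-1 <= h%:R * (gen_poly K)^`().[1] by rewrite gen_poly_deriv1; exact: HK2.
have d2 : h%:R * (gen_poly K)^`().[1] <= 1 by rewrite gen_poly_deriv1.
rewrite -(walk_probE _ JK); apply: (Hn (gen_poly K) g y n J n0n F0 g0 F1 E).
- have F01 : 0 <= (gen_poly K).[1] <= 1 by rewrite F10.
  have : n%:R * (1 - (gen_poly K).[1]) <= 1 / 8.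
    apply: le_trans (_ : n%:R * (8 * n%:R)^-1 <= _); first by rewrite ler_wpM2l //; lra.
    by apply: le_of_eq; field; rewrite gt_eqF.
  by have := expr_1B_le n F01; lra.
- apply: le_trans (second_moment_pow_le _ F0 F1 n2) _.
  rewrite addrC mulrDl; apply: lerD.
    by rewrite mulrC ler_wpM2r // gen_poly_deriv2_le.
  set x := _ - _.
  have hx : h%:R * x = n%:R * (h%:R * (gen_poly K)^`().[1]) - (n%:R - 1) * (gen_poly K).[1].
    have En : n%:R = h%:R * J%:R + 1 :> R by rewrite -hJ -natr1 natrM.
    by rewrite /x En; move: (gen_poly K)^`().[1] (gen_poly K).[1] => a b; ring.
  have n8 : n%:R * (8 * n%:R)^-1 = 8^-1 :> R by field; rewrite gt_eqF.
  have n1 : 1 <= n%:R :> R by rewrite ler1n ltnW.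
  have h1 : 1 <= h%:R :> R by rewrite ler1n.
  have A1 : h%:R * x <= 2.
    rewrite hx.
    have : n%:R * (h%:R * (gen_poly K)^`().[1]) <= n%:R by rewrite ler_piMr // ltW.
    have : (n%:R - 1) * (1 - (8 * n%:R)^-1) <= (n%:R - 1) * (gen_poly K).[1].
      by rewrite ler_wpM2l // subr_ge0.
    have : 0 <= (8 * n%:R)^-1 :> R by exact: ltW.
    by rewrite mulrBr mulr1 mulrBl n8; lra.
  have A2 : - 2 <= h%:R * x.
    rewrite hx.
    have : n%:R * (1 - (8 * n%:R)^-1) <= n%:R * (h%:R * (gen_poly K)^`().[1]).
      by rewrite ler_wpM2l // ltW.
    have : (n%:R - 1) * (gen_poly K).[1] <= n%:R - 1 by rewrite ler_piMr // subr_ge0.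
    by rewrite mulrBr mulr1 n8; lra.
  have x4 : x ^+ 2 <= 4.
    have : (h%:R * x) ^+ 2 <= 4 by nra.
    by rewrite exprMn; apply: le_trans; rewrite ler_peMl ?sqr_ge0 // exprn_ege1.
  apply: le_trans x4 _; lra.
Qed.

End LocalLimit.

(** * Trees read off from the degrees at all addresses *)
Section Branches.
Variables (c : seq nat -> nat) (A : pred (seq nat)).

Fixpoint grown_forest (i : nat) (ss : seq plane_tree) : Prop :=
  if ss is s :: ss' then grown (fun u => c (i :: u)) s /\ grown_forest i.+1 ss'
  else True.

Fixpoint prune_forest (i : nat) (ss : seq plane_tree) : seq plane_tree :=
  if ss is s :: ss' then prune (fun u => A (i :: u)) s :: prune_forest i.+1 ss'
  else [::].

Lemma grown_Node ts :
  grown c (Node ts) = (size ts = c [::] /\ grown_forest 0 ts).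
Proof. by []. Qed.

Lemma prune_Node ts :
  prune A (Node ts) = if A [::] then leaf else Node (prune_forest 0 ts).
Proof. by []. Qed.

End Branches.

Lemma prec_prune A S : prec (prune A S) S.
Proof.
move: S A; apply (@proj1 _ (forall ss i A, all2 prec (prune_forest A i ss) ss)).
apply: tree_forest_ind => // [ss IH A|s ss IHs IHss i A].
- rewrite prune_Node; case: (A [::]) => //; have := IH 0%N A.
  by case: (prune_forest A 0 ss).
- by rewrite /= IHs IHss.
Qed.

(** Whether the address u is a leaf of T; pruning S at these addresses gives T
    whenever T \prec S. *)
Fixpoint leaf_at (T : plane_tree) (u : seq nat) : bool :=
  if u is i :: u' then leaf_at (nth leaf (branches T) i) u' else nilp (branches T).

Lemma prune_prec T S : prec T S -> prune (leaf_at T) S = T.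
Proof.
suff H : (forall T S A, A =1 leaf_at T -> prec T S -> prune A S = T) by apply: H.
move=> {}T; move: T; apply (@proj1 _ (forall ts i ss A,
   (forall j u, A ((i + j)%N :: u) = leaf_at (nth leaf ts j) u) ->
   all2 prec ts ss -> prune_forest A i ss = ts)).
apply: tree_forest_ind => [[|t ts] IH [ss] A AE|i [] //|t ts IHt IHts i [|s ss] // A AE].
- by rewrite prune_Node AE.
- move=> pss; rewrite prune_Node AE; congr Node.
  by apply: IH pss => j u; rewrite AE.
- move=> /andP[ps pss] /=; congr (_ :: _).
  + by apply: IHt ps => u; have := AE 0%N u; rewrite addn0.
  + by apply: IHts pss => j u; have := AE j.+1 u; rewrite addnS.
Qed.

Lemma nonfringeP T S : nonfringe T S <-> prec T S.
Proof.
by split=> [[A <-]|/prune_prec TS]; [exact: prec_prune|exists (leaf_at T)].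
Qed.

Lemma NnfE T S : Nnf T S = occ T [:: S].
Proof.
rewrite /Nnf /occ /= cats0; apply: eq_count => s.
by apply/asboolP/idP => /nonfringeP.
Qed.

Fixpoint forest_degrees (f : plane_tree -> seq (seq nat * nat)) (i : nat)
    (ss : seq plane_tree) : seq (seq nat * nat) :=
  if ss is s :: ss' then
    [seq (i :: x.1, x.2) | x <- f s] ++ forest_degrees f i.+1 ss'
  else [::].

(** The addresses of the nodes of t with their numbers of children; the flag tells
    whether leaves are listed.  With leaves, the list characterizes the event that
    the random tree is t; without leaves, the event that it contains t at its
    root. *)
Fixpoint degrees (b : bool) (t : plane_tree) : seq (seq nat * nat) :=
  let: Node ts := t in
  if ~~ b && nilp ts then [::]
  else ([::], size ts) :: forest_degrees (degrees b) 0 ts.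

Definition agrees (c : seq nat -> nat) (l : seq (seq nat * nat)) :=
  all (fun x => c x.1 == x.2) l.

Lemma grown_degrees c t : grown c t <-> agrees c (degrees true t).
Proof.
move: t c; apply (@proj1 _ (forall ss i c,
  grown_forest c i ss <-> agrees c (forest_degrees (degrees true) i ss))).
apply: tree_forest_ind => // [ss IH c|s ss IHs IHss i c].
- rewrite grown_Node /= eq_sym; split=> [[-> /IH ->]|/andP[/eqP -> /IH]] //.
  by rewrite eqxx.
- rewrite /= /agrees all_cat all_map; split.
    by move=> [/IHs H1 /IHss H2]; apply/andP.
  by move=> /andP[H1 H2]; split; [exact/IHs|exact/IHss].
Qed.

Lemma prec_degrees c T t : grown c t -> prec T t = agrees c (degrees false T).
Proof.
move: T c t; apply (@proj1 _ (forall ts i c ss, size ts = size ss ->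
  grown_forest c i ss ->
  all2 prec ts ss = agrees c (forest_degrees (degrees false) i ts))).
apply: tree_forest_ind => // [[|t ts] IH c [ss]|i c [] //|t ts IHt IHts i c [|s ss] //].
- by case: ss.
- rewrite grown_Node => -[sz gs].
  rewrite -[RHS]/((c [::] == size (t :: ts)) &&
    agrees c (forest_degrees (degrees false) 0 (t :: ts))) -sz.
  rewrite -[prec _ _]/(all2 prec (t :: ts) ss); case: eqP => [E|E].
    by apply: IH.
  by rewrite all2E eq_sym; case: eqP.
- move=> [sz] [gs gss]; rewrite /= /agrees all_cat all_map.
  by rewrite (IHt _ _ gs) (IHts _ _ _ sz gss).
Qed.

Lemma grown_inj c t t' : grown c t -> grown c t' -> t = t'.
Proof.
move: t c t'; apply (@proj1 _ (forall ts i c ss, size ts = size ss ->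
  grown_forest c i ts -> grown_forest c i ss -> ts = ss)).
apply: tree_forest_ind => // [ts IH c [ss]|i c [] //|t ts IHt IHts i c [|s ss] //].
- by rewrite !grown_Node => -[E1 g1] [E2 g2]; congr Node; apply: IH g1 g2; rewrite E1.
- by move=> [sz] [g1 gs1] [g2 gs2]; rewrite (IHt _ _ g1 g2) (IHts _ _ _ sz gs1 gs2).
Qed.

Lemma uniq_degrees b t : uniq (map fst (degrees b t)).
Proof.
move: t; apply (@proj1 _ (forall ss i,
  uniq (map fst (forest_degrees (degrees b) i ss)) /\
  forall u, u \in map fst (forest_degrees (degrees b) i ss) -> (i < (head 0%N u).+1)%N
     /\ u != [::])).
apply: tree_forest_ind => // [ss IH|s ss IHs IHss i].
- rewrite /=; case: ifP => //= _; have [-> H] := IH 0%N; rewrite andbT.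
  by apply/negP => /H [].
- have [U1 H1] := IHss i.+1; rewrite /= map_cat cat_uniq U1 andbT -map_comp.
  have E : map (fst \o (fun x : seq nat * nat => (i :: x.1, x.2))) (degrees b s) =
           map (cons i) (map fst (degrees b s)) by rewrite -map_comp.
  rewrite E; split.
    rewrite map_inj_uniq ?IHs /= => [|? ? [] //].
    apply/hasPn => u uP; apply/negP => /mapP[v _ Eu]; move: (H1 _ uP) => [].
    by rewrite Eu /= ltnn.
  move=> u; rewrite mem_cat => /orP[/mapP[v _ ->]|/H1 [? ?]]; first by split.
  by split=> //; apply: ltnW.
Qed.

Lemma prod_degrees (R : realFieldType) (p : nat -> R) b t :
  \prod_(x <- degrees b t) p x.2 = if b then tree_weight p t else pattern_weight p t.
Proof.
move: t; apply (@proj1 _ (forall ss i,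
  \prod_(x <- forest_degrees (degrees b) i ss) p x.2 =
  if b then forest_weight p ss else foldr (fun s x => pattern_weight p s * x) 1 ss)).
apply: tree_forest_ind => [ss IH|i|s ss IHs IHss i].
- rewrite /=; case: b IH => IH /=; first by rewrite big_cons IH.
  by case: ss IH => [|s ss] IH; rewrite ?big_nil //= big_cons IH.
- by rewrite big_nil; case: b.
- by rewrite /= big_cat big_map /= IHs IHss; case: b {IHs IHss}.
Qed.

(** * Criticality and extinction *)
(** For the generating function G of a critical law, G(q) - q is the sum of the
    terms p_d (q ^ d - 1 - d (q - 1)) >= 0, and the term of index d0 > 1 is positive
    unless q = 1.  So G(q) <= q forces q = 1. *)
Lemma critical_fixpoint (R : realFieldType) (p : nat -> R) (q : R) (d0 : nat) :
  (forall d, 0 <= p d) ->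
  (forall e, 0 < e -> exists K0 : nat, forall K, (K0 <= K)%N -> 1 - e <= \sum_(d < K) p d) ->
  (forall K, \sum_(d < K) p d * d%:R <= 1) ->
  (1 < d0)%N -> 0 < p d0 -> 0 <= q <= 1 ->
  (forall D, \sum_(d < D) p d * q ^+ d <= q) -> q = 1.
Proof.
move=> p0 mass mean d01 pd0 /andP[q0 q1] fixq; apply/eqP; rewrite eq_le q1 leNgt.
apply/negP => {}q1.
have B d : 0 <= q ^+ d - 1 - d%:R * (q - 1).
  elim: d => [|d IH]; first by rewrite expr0 mul0r !subrr.
  have : q ^+ d <= 1 by rewrite exprn_ile1 // ltW.
  by rewrite exprS -natr1; nra.
have B2 d : (1 - q) ^+ 2 <= q ^+ d.+2 - 1 - d.+2%:R * (q - 1).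
  elim: d => [|d IH]; first by apply: le_of_eq; ring.
  have : q ^+ d.+2 <= 1 by rewrite exprn_ile1 // ltW.
  by rewrite (exprS _ d.+2) -[d.+3%:R]natr1; nra.
set s := p d0 * (1 - q) ^+ 2.
have s0 : 0 < s by rewrite mulr_gt0 // exprn_gt0 // subr_gt0.
have s2 : 0 < s / 2 by rewrite divr_gt0.
have [K0 HK] := mass _ s2; pose K := maxn K0 d0.+1.
have dK : (d0 < K)%N by rewrite leq_maxr.
have lo : s <= \sum_(d < K) p d * (q ^+ d - 1 - d%:R * (q - 1)).
  rewrite (bigD1 (Ordinal dK)) //= -[leLHS]addr0; apply: lerD.
    by rewrite ler_wpM2l //; case: d0 d01 {pd0 s s0 s2 HK K dK} => [|[|d0]].
  by apply: sumr_ge0 => d _; rewrite mulr_ge0.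
have E : \sum_(d < K) p d * (q ^+ d - 1 - d%:R * (q - 1)) =
    \sum_(d < K) p d * q ^+ d - \sum_(d < K) p d
    + (1 - q) * (\sum_(d < K) p d * d%:R).
  rewrite big_distrr /= -sumrB -big_split /=; apply: eq_bigr => d _; ring.
have := HK K (leq_maxl _ _); have := mean K; have := fixq K; rewrite E in lo.
by move: (\sum_(_ < _) _ * _%:R) lo => m lo; nra.
Qed.

Definition trees_lt (n : nat) : seq plane_tree :=
  [seq head leaf phi | j <- iota 0 n, phi <- forests j 1].

Lemma mem_forests1 j phi : (phi \in forests j 1) = (phi == [:: head leaf phi]) && (tree_size (head leaf phi) == j).
Proof.
rewrite mem_forests; case: phi => [|t [|s phi]] //=.
  by rewrite eqxx /forest_size /= addn0.
by apply/esym/negP => /andP[/eqP].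
Qed.

Lemma mem_trees_lt n t : (t \in trees_lt n) = (tree_size t < n)%N.
Proof.
apply/allpairsPdep/idP => [[j [phi []]]|tn].
  by rewrite mem_iota add0n mem_forests1 => /andP[_ jn] /andP[_ /eqP E] ->; rewrite E.
by exists (tree_size t), [:: t]; rewrite mem_iota add0n tn mem_forests1 !eqxx.
Qed.

Lemma trees_lt_uniq n : uniq (trees_lt n).
Proof.
apply: allpairs_uniq_dep => [|j _|]; [exact: iota_uniq|exact: forests_uniq|].
move=> _ _ /allpairsPdep[i [phi [_ Hphi ->]]] /allpairsPdep[j [psi [_ Hpsi ->]]] /=.
move: Hphi Hpsi; rewrite !mem_forests1 => /andP[/eqP Ephi /eqP <-] /andP[/eqP Epsi /eqP <-].
by rewrite Ephi Epsi /= => ->.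
Qed.

Fixpoint words (k : nat) (L : seq plane_tree) : seq (seq plane_tree) :=
  if k is k'.+1 then [seq t :: phi | t <- L, phi <- words k' L] else [:: [::]].

Lemma size_words k L phi : phi \in words k L -> size phi = k.
Proof.
elim: k phi => [|k IH] phi /=; first by rewrite inE => /eqP ->.
by move=> /allpairsP[[t psi] /= [_ /IH <- ->]].
Qed.

Lemma words_uniq k L : uniq L -> uniq (words k L).
Proof.
move=> uL; elim: k => //= k IH; apply: allpairs_uniq => // -[t phi] [s psi] _ _ /=.
by case=> -> ->.
Qed.

Lemma sum_words (R : realFieldType) (p : nat -> R) k L :
  \sum_(phi <- words k L) forest_weight p phi = (\sum_(t <- L) tree_weight p t) ^+ k.
Proof.
elim: k => [|k IH]; first by rewrite big_seq1 expr0.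
rewrite big_allpairs_dep exprS -IH big_distrl /=; apply: eq_bigr => t _.
by rewrite big_distrr.
Qed.

Definition nodes_over (D : nat) (L : seq plane_tree) : seq plane_tree :=
  [seq Node phi | k <- iota 0 D, phi <- words k L].

Lemma nodes_over_uniq D L : uniq L -> uniq (nodes_over D L).
Proof.
move=> uL; apply: allpairs_uniq_dep => [|k _|]; [exact: iota_uniq|exact: words_uniq|].
move=> _ _ /allpairsPdep[i [phi [_ Hphi ->]]] /allpairsPdep[j [psi [_ Hpsi ->]]] /=.
by move=> [E]; move: (size_words Hphi) (size_words Hpsi); rewrite E => -> ->.
Qed.

Lemma sum_nodes_over (R : realFieldType) (p : nat -> R) D L :
  \sum_(t <- nodes_over D L) tree_weight p t = \sum_(k < D) p k * (\sum_(t <- L) tree_weight p t) ^+ k.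
Proof.
rewrite big_allpairs_dep /= -(big_mkord xpredT (fun k => p k * _ ^+ k)).
rewrite /index_iota subn0; apply: eq_bigr => k _.
rewrite -sum_words big_distrr /= !big_seq; apply: eq_bigr => phi /size_words <-.
by [].
Qed.

(** * The law of the tree *)
Lemma uniq_fst_inj (l : seq (seq nat * nat)) u a b :
  uniq (map fst l) -> (u, a) \in l -> (u, b) \in l -> a = b.
Proof.
elim: l => //= -[v e] l IH /andP[vl ul]; rewrite !inE.
move=> /orP[/eqP [-> ->]|al] /orP[/eqP E|bl].
- by case: E.
- by exfalso; move/negP: vl; apply; apply/mapP; exists (v, b).
- by exfalso; move/negP: vl; apply; apply/mapP; exists (u, a) => //=; case: E => ->.
- exact: (IH ul al bl).
Qed.

Section TreeLaw.
Context {R : realType} {d0 : measure_display} {Omega0 : measurableType d0}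
  {P0 : probability Omega0 R} (xi : {RV P0 >-> nat})
  {d : measure_display} {Omega : measurableType d} {P : probability Omega R}
  (X : seq nat -> {RV P >-> nat}).

Definition law (k : nat) : R := fine (P0 (xi @^-1` [set k])).

Lemma measurable_preimage_rv {d1} {Om : measurableType d1} {Q : probability Om R}
  (Y : {RV Q >-> nat}) (A : set nat) : measurable (Y @^-1` A).
Proof. by rewrite -[X in measurable X]setTI; apply: measurable_funPT. Qed.

Lemma lawE k : P0 (xi @^-1` [set k]) = (law k)%:E.
Proof. by rewrite /law fineK // fin_num_measure //; exact: measurable_preimage_rv. Qed.

Lemma law_ge0 k : 0 <= law k.
Proof. by rewrite /law fine_ge0. Qed.

(** Moments as limits of partial sums, in the elementary form used with truncated
    polynomials. *)
Lemma law_moment (g : nat -> R) (v : R) : (forall k, 0 <= g k) ->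
  (\int[P0]_w (g (xi w))%:E = v%:E)%E ->
  (forall K, \sum_(k < K) law k * g k <= v) /\
  (forall e, 0 < e -> exists K0 : nat, forall K, (K0 <= K)%N ->
     v - e <= \sum_(k < K) law k * g k).
Proof.
move=> g0 Eg.
have S : (\sum_(0 <= k <oo) (law k * g k)%:E = v%:E)%E.
  rewrite -Eg.
  transitivity (\sum_(0 <= k <oo) \int[P0]_w (g k * \1_(xi @^-1` [set k]) w)%:E)%E.
    apply: eq_eseriesr => k _.
    rewrite (@integralZl_indic _ _ _ P0 _ measurableT (fun=> xi @^-1` [set k]) (g k)).
    - rewrite integral_indic // ?setIT; last exact: measurable_preimage_rv.
      by rewrite EFinM muleC -lawE.
    - by move=> gk; have := g0 k; rewrite leNgt gk.
    - exact: measurable_preimage_rv.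
  rewrite -integral_nneseries //.
  - apply: eq_integral => w _.
    rewrite (@nneseriesD1 _ _ (xi w)) //; last first.
      by move=> k _; rewrite lee_fin mulr_ge0.
    rewrite eseries0 ?adde0.
      by rewrite indicE mem_set ?mulr1.
    move=> k _ /= kx; rewrite indicE memNset ?mulr0 //= => E.
    by move: kx; rewrite E eqxx.
  - move=> k; apply/measurable_EFinP; apply: measurable_funM => //.
    by apply: measurable_indic; exact: measurable_preimage_rv.
  - by move=> k w _; rewrite lee_fin mulr_ge0.
have pos k : true -> (0 <= (law k * g k)%:E)%E by rewrite lee_fin mulr_ge0 ?law_ge0.
have EK K : (\sum_(0 <= k < K) (law k * g k)%:E = (\sum_(k < K) law k * g k)%:E)%E.
  by rewrite sumEFin big_mkord.
split=> [K|e e0].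
  by have := @nneseries_lim_ge R _ xpredT 0 K (fun k _ => pos k); rewrite S EK lee_fin.
have cv : ((fun n => \sum_(0 <= k < n) (law k * g k)%:E)%E @ \oo --> v%:E).
  by rewrite -S; apply: is_cvg_nneseries => k _; exact: pos.
have {}cv : (fun n => \sum_(k < n) law k * g k) @ \oo --> v.
  have -> : (fun n => \sum_(k < n) law k * g k) =
    fine \o (fun n => \sum_(0 <= k < n) (law k * g k)%:E)%E.
    by apply/funext => n /=; rewrite EK.
  exact: fine_cvg cv.
have /cvgrPdist_le/(_ _ e0) [K0 _ HK] := cv.
exists K0 => K /HK /=; rewrite ler_norml => /andP[_ +]; lra.
Qed.

Lemma agrees_measurable l : measurable [set w | agrees (fun u => X u w) l].
Proof.
elim: l => [|x l IH].
  by rewrite (_ : [set w | _] = setT) //; apply/seteqP; split.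
rewrite (_ : [set w | _] = X x.1 @^-1` [set x.2] `&` [set w | agrees (fun u => X u w) l]).
  by apply: measurableI => //; exact: measurable_preimage_rv.
apply/seteqP; split=> w /=; rewrite /agrees /=.
  by move=> /andP[/eqP ? ?].
by move=> [-> ->]; rewrite eqxx.
Qed.

Definition tree_event (A : set plane_tree) : set Omega :=
  [set w | exists2 t, grown (fun u => X u w) t & A t].

Lemma tree_event1 t : tree_event [set t] = [set w | agrees (fun u => X u w) (degrees true t)].
Proof.
apply/seteqP; split=> w /=; first by move=> [s gs <-]; exact/grown_degrees.
by move=> /grown_degrees gt; exists t.
Qed.

Lemma set_seq_cons (t : plane_tree) s : [set` t :: s] = [set t] `|` [set` s].
Proof.
apply/seteqP; split=> u /=; first by rewrite inE => /orP[/eqP ->|]; [left|right].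
by rewrite inE => -[->|->]; rewrite ?eqxx ?orbT.
Qed.

Lemma tree_eventU A B : tree_event (A `|` B) = tree_event A `|` tree_event B.
Proof.
apply/seteqP; split=> w /=.
  by move=> [t gt [At|Bt]]; [left|right]; exists t.
by move=> [[t gt At]|[t gt Bt]]; exists t => //; [left|right].
Qed.

Lemma tree_event_disjoint A B : A `&` B = set0 -> tree_event A `&` tree_event B = set0.
Proof.
move=> AB; apply/seteqP; split=> w //= -[[t gt At] [s gs Bs]].
suff : (A `&` B) t by rewrite AB.
by split=> //; rewrite (grown_inj gt gs).
Qed.

Lemma tree_event_seq_measurable (s : seq plane_tree) : measurable (tree_event [set` s]).
Proof.
elim: s => [|t s IH].
  rewrite (_ : tree_event _ = set0) //; apply/seteqP; split=> w //=.
  by move=> [t _]; rewrite /= in_nil.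
rewrite set_seq_cons tree_eventU; apply: measurableU => //.
by rewrite tree_event1; exact: agrees_measurable.
Qed.

Lemma tree_event_measurable A : measurable (tree_event A).
Proof.
rewrite (_ : tree_event A =
   \bigcup_n tree_event [set` [seq t <- trees_lt n | `[< A t >]]]).
  by apply: bigcupT_measurable => n; exact: tree_event_seq_measurable.
apply/seteqP; split=> w /=.
  move=> [t gt At]; exists (tree_size t).+1 => //; exists t => //=.
  by rewrite mem_filter mem_trees_lt ltnS leqnn andbT; apply/asboolP.
by move=> [n _ [t gt]]; rewrite /= mem_filter => /andP[/asboolP At _]; exists t.
Qed.

Hypothesis iid_X : iid_copies xi X.

(** Independence enters here, through finitely many addresses at a time. *)
Lemma prob_agrees l : uniq (map fst l) ->
  P [set w | agrees (fun u => X u w) l] = (\prod_(x <- l) law x.2)%:E.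
Proof.
move=> ul; pose A u := [set k | (u, k) \in l].
have AE x : x \in l -> A x.1 = [set x.2].
  case: x => u a /= al; apply/seteqP; split=> k /=; last by move=> ->.
  by move=> kl; exact: uniq_fst_inj ul kl al.
have -> : [set w | agrees (fun u => X u w) l] =
    [set w | forall u, u \in map fst l -> A u (X u w)].
  apply/seteqP; split=> w /=.
    move=> /allP H u /mapP[x xl ->]; rewrite (AE _ xl); exact/eqP/H.
  move=> H; apply/allP => x xl; apply/eqP.
  by have := H x.1 (map_f fst xl); rewrite (AE _ xl).
rewrite (iid_X.1 _ A ul) // big_map -prodEFin !big_seq; apply: eq_bigr => x xl.
rewrite (AE _ xl) -lawE; exact: (iid_X.2 x.1 [set x.2]).
Qed.

Lemma prob_tree_seq s : uniq s -> P (tree_event [set` s]) = (\sum_(t <- s) tree_weight law t)%:E.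
Proof.
elim: s => [|t s IH] /=.
  rewrite big_nil (_ : tree_event _ = set0) ?measure0 //; apply/seteqP; split=> w //=.
  by move=> [t _]; rewrite /= in_nil.
move=> /andP[ts us]; rewrite set_seq_cons tree_eventU.
have -> : P (tree_event [set t] `|` tree_event [set` s]) =
    (P (tree_event [set t]) + P (tree_event [set` s]))%E.
  apply: measureU.
  - by rewrite tree_event1; exact: agrees_measurable.
  - exact: tree_event_seq_measurable.
  - apply: tree_event_disjoint; apply/seteqP; split=> u //= -[-> us'].
    by move: ts; rewrite us'.
rewrite IH // big_cons EFinD; congr (_ + _)%E.
by rewrite tree_event1 prob_agrees ?uniq_degrees // prod_degrees.
Qed.

Lemma prGW_size A n : prGW X (A `&` [set t | tree_size t = n]) =
  forest_sum law n 1 (fun phi => `[< A (head leaf phi) >]%:R).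
Proof.
pose s := [seq head leaf phi | phi <- [seq phi <- forests n 1 | `[< A (head leaf phi) >]]].
have us : uniq s.
  rewrite map_inj_in_uniq ?filter_uniq ?forests_uniq // => phi psi.
  rewrite !mem_filter !mem_forests1 => /and3P[_ /eqP E _] /and3P[_ /eqP E' _].
  by rewrite E E' /= => ->.
have -> : A `&` [set t | tree_size t = n] = [set` s].
  apply/seteqP; split=> t /=.
    move=> [At tn]; apply/mapP; exists [:: t] => //.
    by rewrite mem_filter mem_forests1 /= tn !eqxx !andbT; apply/asboolP.
  move=> /mapP[phi]; rewrite mem_filter mem_forests1 => /and3P[/asboolP At _ /eqP tn] ->.
  by [].
rewrite -[LHS]/(fine (P (tree_event [set` s]))) (prob_tree_seq us) /= /s big_map big_filter.
rewrite /forest_sum big_mkcond !big_seq; apply: eq_bigr => phi; rewrite mem_forests1.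
move=> /andP[/eqP E _]; rewrite E /= mulr1.
by case: asboolP; rewrite ?mulr1 ?mulr0.
Qed.

Lemma prGWnE A n : prGWn X n A =
  forest_sum law n 1 (fun phi => `[< A (head leaf phi) >]%:R) / forest_sum law n 1 (fun=> 1).
Proof.
rewrite /prGWn prGW_size; congr (_ / _).
rewrite -[X in prGW _ X]setTI prGW_size; apply: eq_forest_sum => phi _.
by rewrite asboolT.
Qed.

Section Extinction.
Hypothesis mass_cvg : forall e : R, 0 < e ->
  exists K0 : nat, forall K, (K0 <= K)%N -> 1 - e <= \sum_(k < K) law k.
Hypothesis mean_le1 : forall K, \sum_(k < K) law k * k%:R <= 1.
Variable k0 : nat.
Hypotheses (k0_gt1 : (1 < k0)%N) (law_k0 : 0 < law k0).

(** Let q be the probability that the tree is finite.  The trees with fewer than D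
    branches of size less than n have total weight at most q, and letting n tend to
    infinity gives \sum_(k < D) p_k q ^ k <= q ([critical_fixpoint]). *)
Lemma prob_finite_tree : P (tree_event setT) = 1%E.
Proof.
pose q := fine (P (tree_event setT)).
have Eq : P (tree_event setT) = q%:E.
  by rewrite /q fineK // fin_num_measure //; exact: tree_event_measurable.
have q1 : q <= 1.
  by rewrite -lee_fin -Eq; apply: probability_le1; exact: tree_event_measurable.
have q0 : 0 <= q by rewrite /q fine_ge0.
pose qn n := \sum_(t <- trees_lt n) tree_weight law t.
have qn_q : qn @ \oo --> q.
  have H : (P \o (fun n => tree_event [set` trees_lt n])) @ \oo -->
      P (\bigcup_n tree_event [set` trees_lt n]).
    apply: nondecreasing_cvg_mu.
    - by move=> n; exact: tree_event_seq_measurable.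
    - by apply: bigcupT_measurable => n; exact: tree_event_seq_measurable.
    - move=> m n mn; apply/subsetPset => w [t gt] /=; rewrite mem_trees_lt => tm.
      by exists t => //=; rewrite mem_trees_lt (leq_trans tm).
  have E : \bigcup_n tree_event [set` trees_lt n] = tree_event setT.
    apply/seteqP; split=> w; first by move=> [n _ [t gt _]]; exists t.
    by move=> [t gt _]; exists (tree_size t).+1 => //; exists t => //=; rewrite mem_trees_lt.
  rewrite E Eq in H; have -> : qn = fine \o (P \o (fun n => tree_event [set` trees_lt n])).
    by apply/funext => n /=; rewrite prob_tree_seq ?trees_lt_uniq.
  exact: fine_cvg H.
rewrite Eq; congr (_%:E).
apply: (critical_fixpoint law_ge0 mass_cvg mean_le1 k0_gt1 law_k0); first by rewrite q0.
move=> D.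
have -> : \sum_(k < D) law k * q ^+ k = (\poly_(k < D) law k).[q].
  by rewrite horner_poly.
have cv : (horner (\poly_(k < D) law k) \o qn) @ \oo --> (\poly_(k < D) law k).[q].
  by apply: continuous_cvg => //; exact: continuous_horner.
apply: (@closed_cvg _ _ _ _ _ (fun x => x <= q) (@closed_le R q) _ _ cv).
near=> n; rewrite /= horner_poly -(sum_nodes_over law).
rewrite -lee_fin -Eq -prob_tree_seq ?nodes_over_uniq ?trees_lt_uniq //.
apply: le_measure; rewrite ?inE.
- exact: tree_event_seq_measurable.
- exact: tree_event_measurable.
- by move=> w [t gt _]; exists t.
Unshelve. all: by end_near.
Qed.

(** On the almost sure event that the tree is finite, T \prec S only depends on the
    numbers of children at the internal nodes of T. *)
Lemma pi_nfE T : pi_nf X T = pattern_weight law T.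
Proof.
rewrite /pi_nf -[LHS]/(fine (P (tree_event [set S | nonfringe T S]))).
have H : P [set w | agrees (fun u => X u w) (degrees false T)] = (pattern_weight law T)%:E.
  by rewrite prob_agrees ?uniq_degrees // prod_degrees.
pose A := [set w | agrees (fun u => X u w) (degrees false T)].
have mA : measurable A by exact: agrees_measurable.
have mT := tree_event_measurable setT.
have -> : tree_event [set S | nonfringe T S] = A `&` tree_event setT.
  apply/seteqP; split=> w /=.
    move=> [t gt /nonfringeP TS]; split; last by exists t.
    by rewrite /A /= -(prec_degrees T gt).
  move=> [Aw [t gt _]]; exists t => //; apply/nonfringeP.
  by rewrite (prec_degrees T gt).
have N0 : P (~` tree_event setT) = 0%E.
  by rewrite probability_setC // prob_finite_tree subee.
suff -> : P (A `&` tree_event setT) = P A by rewrite H.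
have -> : P A = P (A `&` tree_event setT) + P (A `\` tree_event setT)%E.
  by rewrite addeC -measureDI.
have -> : P (A `\` tree_event setT) = 0%E.
  apply/eqP; rewrite eq_le measure_ge0 andbT -N0.
  apply: le_measure; rewrite ?inE; [exact: measurableD|exact: measurableC|].
  exact: subIsetr.
by rewrite adde0.
Qed.
End Extinction.
End TreeLaw.

(** * Moments and lattice of the offspring law *)
Section Offspring.
Context {R : realType} {d0 : measure_display} {Omega0 : measurableType d0}
  {P0 : probability Omega0 R} (xi : {RV P0 >-> nat}) (h : nat).
Hypotheses (mean_xi : ('E_P0[fun w => (xi w)%:R%R : R] = 1)%E)
  (var_xi_gt0 : (0 < 'V_P0[fun w => (xi w)%:R%R : R])%E)
  (var_xi_fin : ('V_P0[fun w => (xi w)%:R%R : R] < +oo)%E)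
  (span_xi : is_span xi h).
Local Notation law := (law xi).

Lemma law_mass : (forall K, \sum_(k < K) law k <= 1) /\
  (forall e, 0 < e -> exists K0 : nat, forall K, (K0 <= K)%N -> 1 - e <= \sum_(k < K) law k).
Proof.
have E : (\int[P0]_w (1 : R)%:E = 1%:E)%E.
  by rewrite integral_cst // mul1e; exact: probability_setT.
have [H1 H2] := @law_moment R d0 Omega0 P0 xi (fun=> 1) 1 (fun=> ler01) E.
have S K : \sum_(k < K) law k * 1 = \sum_(k < K) law k by apply: eq_bigr => k _; rewrite mulr1.
split=> [K|e /H2 [K0 HK]]; first by rewrite -S.
by exists K0 => K /HK; rewrite S.
Qed.

Lemma law_mean : (forall K, \sum_(k < K) law k * k%:R <= 1) /\
  (forall e, 0 < e -> exists K0 : nat, forall K, (K0 <= K)%N ->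
     1 - e <= \sum_(k < K) law k * k%:R).
Proof. by apply: law_moment => // ; rewrite -mean_xi unlock. Qed.

Lemma law_var : exists2 V : R, 0 < V & (forall K, \sum_(k < K) law k * (k%:R - 1) ^+ 2 <= V) /\
  (forall e, 0 < e -> exists K0 : nat, forall K, (K0 <= K)%N ->
     V - e <= \sum_(k < K) law k * (k%:R - 1) ^+ 2).
Proof.
exists (fine ('V_P0[fun w => (xi w)%:R%R : R])%E); first by rewrite fine_gt0 // var_xi_gt0.
apply: (@law_moment _ _ _ _ xi (fun k => (k%:R - 1) ^+ 2)) => [k|]; first exact: sqr_ge0.
rewrite fineK; last by rewrite gt0_fin_numE.
by rewrite /variance unlock mean_xi unlock.
Qed.

Lemma law_sqr : exists V : R, forall K, \sum_(k < K) law k * k%:R ^+ 2 <= V.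
Proof.
have [V V0 [HV _]] := law_var; have [H1 _] := law_mass.
exists (2 * V + 2) => K; apply: le_trans (_ : 2 * (\sum_(k < K) law k * (k%:R - 1) ^+ 2)
  + 2 * (\sum_(k < K) law k) <= _); last first.
  by have := HV K; have := H1 K; lra.
rewrite !big_distrr -big_split /=; apply: ler_sum => k _.
have := law_ge0 xi k; have := sqr_ge0 ((k%:R : R) - 2); move: (law k) (k%:R : R) => a b; nra.
Qed.

Lemma law_neq1 : exists2 k, 0 < law k & k != 1%N.
Proof.
apply: contrapT => Hn; have [V V0 [_ HV]] := law_var.
have Z k : k != 1%N -> law k = 0.
  move=> k1; apply/eqP; rewrite eq_le law_ge0 andbT leNgt; apply/negP => lk.
  by apply: Hn; exists k.
have V2 : 0 < V / 2 by rewrite divr_gt0.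
have [K0 /(_ K0 (leqnn _))] := HV _ V2.
rewrite big1 => [|k _]; first lra.
by have [->|/Z ->] := eqVneq (nat_of_ord k) 1%N; rewrite ?subrr ?expr0n ?mulr0 ?mul0r.
Qed.

(** The step minus one has mean zero. *)
Lemma law_sub1_cvg e : 0 < e -> exists K0 : nat, forall K, (K0 <= K)%N ->
   `|\sum_(k < K) law k * (k%:R - 1)| <= e.
Proof.
move=> e0; have [M1 M2] := law_mass; have [N1 N2] := law_mean.
have [K1 H1] := M2 _ e0; have [K2 H2] := N2 _ e0.
exists (maxn K1 K2) => K; rewrite geq_max => /andP[/H1 A1 /H2 A2].
have -> : \sum_(k < K) law k * (k%:R - 1) = \sum_(k < K) law k * k%:R - \sum_(k < K) law k.
  by rewrite -sumrB; apply: eq_bigr => k _; rewrite mulrBr mulr1.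
have := M1 K; have := N1 K; rewrite ler_norml; lra.
Qed.

Lemma law_gt1 : exists2 k, (1 < k)%N & 0 < law k.
Proof.
apply: contrapT => Hn.
have Z k : law k.+2 = 0.
  apply/eqP; rewrite eq_le law_ge0 andbT leNgt; apply/negP => lk.
  by apply: Hn; exists k.+2.
have [k lk k1] := law_neq1.
have l0 : 0 < law 0 by case: k lk k1 => [|[|k]] //; rewrite Z ltxx.
have e0 : 0 < law 0 / 2 by rewrite divr_gt0.
have [K0 /(_ K0.+1 (leqnSn _))] := law_sub1_cvg e0.
rewrite big_ord_recl /= big1 ?addr0 ?sub0r ?mulrN1 ?normrN => [|i _].
  by rewrite ger0_norm ?law_ge0 //; lra.
rewrite /bump /= add1n; case: (nat_of_ord i) => [|j]; first by rewrite subrr mulr0.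
by rewrite Z mul0r.
Qed.

(** If p_0 = 0, the mean is at least 1 + (k - 1) p_k for every k > 1, hence more than
    1 by [law_gt1]. *)
Lemma law0_gt0 : 0 < law 0.
Proof.
rewrite lt_def law_ge0 andbT; apply/eqP => l0.
have [k k1 lk] := law_gt1.
have e0 : 0 < law k / 2 by rewrite divr_gt0.
have [K0 /(_ (maxn K0 k.+1) (leq_maxl _ _))] := law_sub1_cvg e0.
set K := maxn _ _; have kK : (k < K)%N by rewrite leq_maxr.
have T0 (j : nat) : 0 <= law j * (j%:R - 1).
  case: j => [|j]; first by rewrite l0 mul0r.
  by rewrite mulr_ge0 ?law_ge0 // -natr1 addrK.
rewrite ger0_norm ?sumr_ge0 // (bigD1 (Ordinal kK)) //=.
have := @sumr_ge0 R _ (index_enum _) (fun i => i != Ordinal kK)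
  (fun i : 'I_K => law i * (i%:R - 1)) (fun i _ => T0 i).
have : law k <= law k * (k%:R - 1).
  rewrite ler_peMr ?law_ge0 // lerBrDr; have : 2%:R <= k%:R :> R by rewrite ler_nat.
  lra.
lra.
Qed.

(** The masses of 0 and k together are at most 1. *)
Lemma law_le k : (0 < k)%N -> law k <= 1 - law 0.
Proof.
case: k => // k _; have [H _] := law_mass; have := H k.+2.
rewrite big_ord_recl big_ord_recr /=.
have := @sumr_ge0 R _ (index_enum _) xpredT
   (fun i : 'I_k => law (bump 0 (widen_ord (leqnSn k) i))) (fun i _ => law_ge0 xi _).
rewrite /bump /= add1n; lra.
Qed.

Lemma law_dvd k : 0 < law k -> (h %| k)%N.
Proof.
case: k => [|k] lk; first exact: dvdn0.
by apply: (proj1 (span_xi h) (dvdnn h)) => //; rewrite lawE lte_fin.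
Qed.

Lemma span_gt0 : (0 < h)%N.
Proof.
rewrite lt0n; apply/eqP => h0; have [k k1 lk] := law_gt1.
by have := law_dvd lk; rewrite h0 dvd0n; case: k k1 lk.
Qed.

(** The law of xi / h, whose span is 1. *)
Definition lattice_law (k : nat) : R := law (h * k).

Lemma lattice_aperiodic m : (forall k, 0 < lattice_law k -> (m %| k)%N) -> m = 1%N.
Proof.
move=> Hm; have h0 := span_gt0.
have : (h * m %| h)%N.
  apply/span_xi => i i1; rewrite lawE lte_fin => li.
  have /dvdnP[j Ej] := law_dvd li; rewrite Ej mulnC dvdn_mul //.
  by apply: Hm; rewrite /lattice_law mulnC -Ej.
rewrite -{2}[h]muln1 dvdn_pmul2l // dvdn1 => /eqP //.
Qed.

Lemma sum_multiples (G : nat -> R) K : (forall i, ~~ (h %| i)%N -> G i = 0) ->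
  \sum_(i < h * K) G i = \sum_(k < K) G (h * k)%N.
Proof.
move=> G0; have h0 := span_gt0.
rewrite -(big_mkord xpredT G); elim: K => [|K IH]; first by rewrite muln0 big_geq // big_ord0.
rewrite (@big_cat_nat _ _ _ (h * K)) //=; last by rewrite leq_mul2l leqnSn orbT.
rewrite IH big_ord_recr /=; congr (_ + _).
rewrite big_ltn; last by rewrite ltn_mul2l h0 ltnSn.
rewrite big_nat big1 ?addr0 // => i /andP[Ki iK]; apply: G0; apply/negP => /dvdnP[j Ej].
by move: Ki iK; rewrite Ej [(j * h)%N]mulnC !ltn_mul2l h0 /=; lia.
Qed.

Lemma lattice_sum (g : nat -> R) K :
  \sum_(k < K) lattice_law k * g (h * k)%N = \sum_(i < h * K) law i * g i.
Proof.
rewrite (@sum_multiples (fun i => law i * g i)) // => i hi.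
rewrite (_ : law i = 0) ?mul0r //; apply/eqP; rewrite eq_le law_ge0 andbT leNgt.
by apply: contra hi; exact: law_dvd.
Qed.

Lemma lattice_mass : (forall K, \sum_(k < K) lattice_law k <= 1) /\
  (forall e, 0 < e -> exists K0 : nat, forall K, (K0 <= K)%N ->
     1 - e <= \sum_(k < K) lattice_law k).
Proof.
have S K : \sum_(k < K) lattice_law k = \sum_(i < h * K) law i.
  have := lattice_sum (fun=> 1) K; under eq_bigr do rewrite mulr1.
  by move=> ->; apply: eq_bigr => i _; rewrite mulr1.
have [H1 H2] := law_mass; split=> [K|e /H2 [K0 HK]]; first by rewrite S.
exists K0 => K KK; rewrite S; apply: HK; rewrite (leq_trans KK) // leq_pmull //; exact: span_gt0.
Qed.

Lemma lattice_mean : (forall K, h%:R * \sum_(k < K) lattice_law k * k%:R <= 1) /\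
  (forall e, 0 < e -> exists K0 : nat, forall K, (K0 <= K)%N ->
     1 - e <= h%:R * \sum_(k < K) lattice_law k * k%:R).
Proof.
have S K : h%:R * \sum_(k < K) lattice_law k * k%:R = \sum_(i < h * K) law i * i%:R.
  rewrite -(lattice_sum (fun i => i%:R)) big_distrr /=; apply: eq_bigr => k _.
  by rewrite natrM mulrCA.
have [H1 H2] := law_mean; split=> [K|e /H2 [K0 HK]]; first by rewrite S.
exists K0 => K KK; rewrite S; apply: HK; rewrite (leq_trans KK) // leq_pmull //; exact: span_gt0.
Qed.

Lemma lattice_sqr : exists V : R, forall K, \sum_(k < K) lattice_law k * k%:R ^+ 2 <= V.
Proof.
have [V HV] := law_sqr; exists V => K; apply: le_trans (HV (h * K)%N).
rewrite -(lattice_sum (fun i => i%:R ^+ 2)); apply: ler_sum => k _.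
rewrite ler_wpM2l ?law_ge0 // lerXn2r ?nnegrE // ler_nat leq_pmull //; exact: span_gt0.
Qed.

Lemma lattice_ge0 k : 0 <= lattice_law k. Proof. exact: law_ge0. Qed.

Lemma lattice0_gt0 : 0 < lattice_law 0.
Proof. by rewrite /lattice_law muln0 law0_gt0. Qed.

Local Notation a := (walk_prob lattice_law).

Lemma lattice_upper : exists2 C : R, 0 < C & forall N j, (0 < N)%N ->
  a N j <= C / Num.sqrt N%:R.
Proof.
have [mass1 mass2] := lattice_mass.
exact: walk_prob_upper span_gt0 lattice_ge0 mass1 lattice0_gt0 lattice_aperiodic.
Qed.

Lemma lattice_shift : exists2 C : R, 0 < C & forall n M J D, (M < n)%N -> (D <= J)%N ->
  `|a n J - a (n - M) (J - D)| <= C * (M%:R + D%:R) / (n - M)%:R.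
Proof.
have [mass1 mass2] := lattice_mass; have [n1 n2] := lattice_mean.
exact: walk_prob_shift span_gt0 lattice_ge0 mass1 mass2 n1 lattice0_gt0 lattice_aperiodic.
Qed.

Lemma lattice_lower : exists2 c : R, 0 < c & exists n0 : nat, forall n J,
  (n0 <= n)%N -> (h * J).+1 = n -> c / Num.sqrt n%:R <= a n J.
Proof.
have [mass1 mass2] := lattice_mass; have [n1 n2] := lattice_mean; have [V HV] := lattice_sqr.
exact: walk_prob_lower span_gt0 lattice_ge0 mass1 mass2 n1 n2 HV lattice0_gt0 lattice_aperiodic.
Qed.

Lemma walk_coef_lattice n N s M : (s <= M <= n)%N ->
  walk_coef law (h * n.+1) N s M = if (h %| M - s)%N then a N ((M - s) %/ h) else 0.
Proof.
move=> /andP[sM Mn]; have h0 := span_gt0; rewrite walk_coefE ltnNge sM /=.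
have -> : \poly_(d < h * n.+1) law d = gen_poly lattice_law n.+1 \Po 'X^h.
  apply/polyP => i; rewrite coef_comp_poly_Xn // !coef_poly.
  have [/dvdnP[j ->]|hi] := boolP (h %| i)%N.
    by rewrite mulnK // [(h * _)%N]mulnC ltn_mul2r h0 /lattice_law mulnC.
  case: ifP => // _; apply/eqP; rewrite eq_le law_ge0 andbT leNgt.
  by apply: contra hi; exact: law_dvd.
rewrite -rmorphXn /= coef_comp_poly_Xn //; case: ifP => // _; apply: walk_probE.
by rewrite ltnS (leq_trans (leq_div _ _)) // (leq_trans (leq_subr _ _)).
Qed.

End Offspring.

(** * Size of a pattern and its probability *)
Lemma sum_degrees t : \sum_(x <- degrees false t) x.2 = (tree_size t).-1.
Proof.
move: t; apply (@proj1 _ (forall ss i,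
  (\sum_(x <- forest_degrees (degrees false) i ss) x.2 + size ss = forest_size ss)%N)).
apply: tree_forest_ind => [[|s ss] IH|i|s ss IHs IHss i].
- by rewrite big_nil.
- by rewrite [degrees _ _]/= big_cons tree_size_Node -(IH 0%N) addnC.
- by rewrite big_nil.
- rewrite /= big_cat big_map /= IHs forest_size_cons -(IHss i.+1).
  by case: s {IHs} => ts; rewrite tree_size_Node; lia.
Qed.

Lemma degrees_gt0 t x : x \in degrees false t -> (0 < x.2)%N.
Proof.
move: t x; apply (@proj1 _ (forall ss i x,
  x \in forest_degrees (degrees false) i ss -> (0 < x.2)%N)).
apply: tree_forest_ind => // [[|s ss] IH x|s ss IHs IHss i x] //.
- by rewrite [degrees _ _]/= inE => /orP[/eqP ->|/IH].
- by rewrite /= mem_cat => /orP[/mapP[y /IHs ? ->]|/IHss].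
Qed.

Section PatternSize.
Variables (R : realType) (p : nat -> R).
Hypothesis p_ge0 : forall k, 0 <= p k.

Lemma pattern_weight_gt0_dvd h T : (forall k, 0 < p k -> (h %| k)%N) -> 0 < pattern_weight p T ->
  (h %| (tree_size T).-1)%N.
Proof.
move=> ph; rewrite -(prod_degrees p false) -sum_degrees.
elim: (degrees false T) => [|x l IH]; first by rewrite !big_nil dvdn0.
rewrite !big_cons => H; have Px : 0 < p x.2.
  rewrite lt_def p_ge0 andbT; apply/eqP => E; by rewrite E mul0r ltxx in H.
by apply: dvdn_add; [exact: ph|apply: IH; rewrite pmulr_rgt0 in H].
Qed.

(** With q_d = sqrt p_d and S the sum of the degrees d of some internal nodes, adding
    a node of degree d replaces S Q by (d + S) q_d Q = (d q_d) Q + (S Q) q_d, where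
    Q <= 1 is the product of the q_d of the previous ones.  As d q_d <= C and
    q_d <= g < 1, the bound C / (1 - g) is preserved.  The degrees of the internal
    nodes add up to the size minus 1. *)
Lemma size_sqrt_pattern_weight (c V : R) : 0 <= c < 1 -> (forall k, (0 < k)%N -> p k <= c) ->
  (forall k, p k * k%:R ^+ 2 <= V) ->
  exists2 B : R, 0 < B & forall T, (tree_size T).-1%:R * Num.sqrt (pattern_weight p T) <= B.
Proof.
move=> /andP[c0 c1] pc pV; set g := Num.sqrt c.
have g1 : g < 1 by rewrite /g -[ltRHS]sqrtr1 ltr_sqrt.
have g0 : 0 <= g by exact: sqrtr_ge0.
pose C := Num.sqrt V + 1.
have C0 : 0 < C by rewrite ltr_wpDl // sqrtr_ge0.
exists (C / (1 - g)) => [|T]; first by rewrite divr_gt0 // subr_gt0.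
rewrite -(prod_degrees p false) -sum_degrees.
have := @degrees_gt0 T; move: (degrees false T) => l l0.
suff [] : (\sum_(x <- l) x.2)%:R * Num.sqrt (\prod_(x <- l) p x.2) <= C / (1 - g) /\
   Num.sqrt (\prod_(x <- l) p x.2) <= 1 by [].
elim: l l0 => [_|x l IH l0].
  by rewrite !big_nil sqrtr1 mul0r divr_ge0 ?subr_ge0 // ltW.
have {IH} [|H1 H2] := IH; first by move=> y yl; apply: l0; rewrite inE yl orbT.
have x0 : (0 < x.2)%N by apply: l0; rewrite inE eqxx.
rewrite !big_cons sqrtrM // natrD.
set q := Num.sqrt (p x.2); set Q := Num.sqrt _ in H1 H2 *; set S := (\sum_(_ <- _) _)%:R in H1 *.
have q0 : 0 <= q by exact: sqrtr_ge0.
have Q0 : 0 <= Q by exact: sqrtr_ge0.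
have qg : q <= g by rewrite /q /g ler_wsqrtr // pc.
have xq : x.2%:R * q <= C.
  apply: le_trans (_ : Num.sqrt V <= _); last by rewrite lerDl.
  have : Num.sqrt ((x.2%:R * q) ^+ 2) <= Num.sqrt V.
    by rewrite ler_wsqrtr // exprMn sqr_sqrtr // mulrC.
  by rewrite sqrtr_sqr ger0_norm // mulr_ge0.
have qQ1 : q * Q <= 1 by rewrite mulr_ile1 // (le_trans qg) // ltW.
split=> //.
have -> : (x.2%:R + S) * (q * Q) = (x.2%:R * q) * Q + (S * Q) * q by ring.
have -> : C / (1 - g) = C * 1 + C / (1 - g) * g by field; rewrite subr_eq0 gt_eqF.
have S0 : 0 <= S by exact: ler0n.
by apply: lerD; rewrite ler_pM ?mulr_ge0.
Qed.
End PatternSize.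

(** * Tail bounds *)
Section TailBounds.
Context {R : realType} {d0 : measure_display} {Omega0 : measurableType d0}
  {P0 : probability Omega0 R} (xi : {RV P0 >-> nat}) (h : nat)
  {d : measure_display} {Omega : measurableType d} {P : probability Omega R}
  (X : seq nat -> {RV P >-> nat}).
Hypotheses (mean_xi : ('E_P0[fun w => (xi w)%:R%R : R] = 1)%E)
  (var_xi_gt0 : (0 < 'V_P0[fun w => (xi w)%:R%R : R])%E)
  (var_xi_fin : ('V_P0[fun w => (xi w)%:R%R : R] < +oo)%E)
  (span_xi : is_span xi h) (iid_X : iid_copies xi X).
Local Notation law := (law xi).
Local Notation a := (walk_prob (lattice_law xi h)).
Local Notation Z n := (forest_sum law n 1 (fun=> 1)).
Local Notation EN T n := (forest_sum law n 1 (fun phi => (occ T phi)%:R)).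

Lemma pi_nf_pattern_weight T : pi_nf X T = pattern_weight law T.
Proof.
have [mass1 mass2] := law_mass xi; have [n1 n2] := law_mean mean_xi.
have [k k1 lk] := law_gt1 mean_xi var_xi_gt0 var_xi_fin.
exact: (pi_nfE iid_X mass2 n1 k1 lk).
Qed.

Lemma leq_lattice n : (n <= h * n.+1)%N.
Proof.
have h0 := span_gt0 mean_xi var_xi_gt0 var_xi_fin span_xi.
by rewrite (leq_trans (leqnSn n)) // leq_pmull.
Qed.

(** Otter-Dwass for one tree, on the lattice of the multiples of h. *)
Lemma partition_fun n : (n = 1 %[mod h])%N -> (0 < n)%N ->
  n%:R * Z n = a n (n.-1 %/ h) /\ (h %| n.-1)%N.
Proof.
move=> nh n0; have hn : (h %| n.-1)%N by rewrite -subn1 -eqn_mod_dvd // nh.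
rewrite (forest_sum_one _ _ (leq_lattice n)) mul1r.
by rewrite (walk_coef_lattice mean_xi var_xi_gt0 var_xi_fin span_xi) ?n0 ?leqnn // subn1 hn.
Qed.

Lemma walk_coef_upper : exists2 C : R, 0 < C & forall n N s, (0 < N <= n)%N ->
  walk_coef law (h * n.+1) N s N <= C / Num.sqrt N%:R.
Proof.
have [C C0 H] := lattice_upper mean_xi var_xi_gt0 var_xi_fin span_xi.
exists C => // n N s /andP[N0 Nn].
have r0 : 0 <= C / Num.sqrt N%:R by rewrite divr_ge0 ?sqrtr_ge0 // ltW.
have [Ns|sN] := ltnP N s; first by rewrite walk_coef_small.
rewrite (walk_coef_lattice mean_xi var_xi_gt0 var_xi_fin span_xi) ?sN //.
by case: ifP => // _; exact: H.
Qed.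

(** Only the upper bound on point probabilities enters, so that the grafts are
    covered as well. *)
Lemma mean_occ_le : exists2 C : R, 0 < C & forall n T, ((inner_nodes T).*2 <= n)%N -> (0 < n)%N ->
  EN T n <= C * pattern_weight law T / Num.sqrt n%:R.
Proof.
have [C C0 H] := walk_coef_upper; exists (2 * C) => [|n T mn n0]; first by rewrite mulr_gt0.
set m := inner_nodes T in mn.
rewrite (forest_sum_occ _ _ _ (leq_lattice n)) mul1r -/m.
have nm0 : (0 < n - m <= n)%N by apply/andP; clear -mn n0; split; lia.
rewrite (mulrC (2 * C)) -mulrA ler_wpM2l ?pattern_weight_ge0 //; first exact: law_ge0.
apply: le_trans (H _ _ _ nm0) _.
have q0 : 0 < Num.sqrt (n - m)%:R :> R by rewrite sqrtr_gt0 ltr0n; case/andP: nm0.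
have r0 : 0 < Num.sqrt n%:R :> R by rewrite sqrtr_gt0 ltr0n.
rewrite ler_pdivrMr // mulrAC ler_pdivlMr // -mulrA mulrCA ler_wpM2l ?(ltW C0) //.
rewrite -(@ler_pXn2r _ 2) ?nnegrE ?mulr_ge0 ?sqrtr_ge0 //.
by rewrite exprMn !sqr_sqrtr // -natrX -natrM ler_nat; lia.
Qed.

Lemma prGWn_markov (F : plane_tree -> R) n e : 0 < e -> 0 < Z n -> (forall t, 0 <= F t) ->
  prGWn X n [set t | e < F t] <= forest_sum law n 1 (fun phi => F (head leaf phi)) / (e * Z n).
Proof.
move=> e0 Z0 F0; rewrite (prGWnE iid_X) ler_pdivrMr // invfM mulrA divfK ?gt_eqF //.
rewrite ler_pdivlMr // mulrC -forest_sumZ; apply: (le_forest_sum (law_ge0 xi)) => phi _.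
by case: asboolP => [/ltW|_]; rewrite ?mulr1 ?mulr0.
Qed.

Lemma forest_sum_Nnf (G : R -> R) T n : forest_sum law n 1 (fun phi => G (Nnf T (head leaf phi))%:R) =
  forest_sum law n 1 (fun phi => G (occ T phi)%:R).
Proof. by apply: eq_forest_sum => -[|t [|]] // _; rewrite NnfE. Qed.

(** The point probabilities in the first two moments differ from P(S_n = n - 1) by
    O(k / n): one copy of T removes m steps and k - 1 of their sum, two copies twice
    as much, and h divides k - 1 when T has positive weight. *)
Lemma moment_coef_bounds : exists2 C : R, 0 < C & forall n T, (n = 1 %[mod h])%N ->
  (0 < n)%N -> (4 * tree_size T <= n)%N -> 0 < pattern_weight law T ->
  n%:R * Z n - C * (tree_size T)%:R / n%:R <= walk_coef law (h * n.+1) (n - inner_nodes T) (leaves T) (n - inner_nodes T) /\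
  walk_coef law (h * n.+1) (n - (inner_nodes T).*2) ((leaves T).-1.*2 + 1) (n - (inner_nodes T).*2)
    <= Num.min 1 (n%:R * Z n + C * (tree_size T)%:R / n%:R).
Proof.
have [C C0 HC] := lattice_shift mean_xi var_xi_gt0 var_xi_fin span_xi.
exists (8 * C) => [|n T nh n0 kn pT]; first by rewrite mulr_gt0.
have [-> hn] := partition_fun nh n0; set k : R := (tree_size T)%:R.
have hT := pattern_weight_gt0_dvd (law_ge0 xi) (law_dvd span_xi) pT.
have h0 := span_gt0 mean_xi var_xi_gt0 var_xi_fin span_xi.
set J := (n.-1 %/ h)%N; set an := a n J; set D := ((tree_size T).-1 %/ h)%N.
have EJ : n.-1 = (J * h)%N by rewrite divnK.
have ED : (tree_size T).-1 = (D * h)%N by rewrite divnK.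
have ED2 : (D.*2 * h = (tree_size T).-1.*2)%N by rewrite -doubleMl -ED.
have kE := tree_sizeE T; have l0 := leaves_gt0 T.
set m := inner_nodes T in kE *; set l := leaves T in kE l0 *.
have DT : (D <= tree_size T)%N by rewrite (leq_trans (leq_div _ _)) // leq_pred.
have n0' : 0 < n%:R :> R by rewrite ltr0n.
have key M D' : (M + D' <= 4 * tree_size T)%N -> (M.*2 <= n)%N -> (D' <= J)%N ->
    `|an - a (n - M) (J - D')| <= 8 * C * k / n%:R.
  move=> MD Mn DJ; have nM : (0 < n - M)%N by clear -Mn n0; lia.
  apply: le_trans (HC n M J D' _ DJ) _; first by rewrite -subn_gt0.
  have nM0 : 0 < (n - M)%:R :> R by rewrite ltr0n.
  rewrite ler_pdivrMr // mulrAC ler_pdivlMr //.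
  have H1 : (M%:R + D'%:R) <= 4 * k by rewrite /k -natrD -natrM ler_nat.
  have H2 : n%:R <= 2 * (n - M)%:R :> R by rewrite -natrM ler_nat; clear -Mn; lia.
  have H := ler_pM (addr_ge0 (ler0n R M) (ler0n R D')) (ltW n0') H1 H2.
  rewrite -[leLHS]mulrA; apply: le_trans (ler_wpM2l (ltW C0) H) _.
  by apply: le_of_eq; ring.
have J1 : (n - m - l = (J - D) * h)%N.
  by rewrite mulnBl -EJ -ED; clear -kE l0; lia.
have J2 : (n - m.*2 - (l.-1.*2 + 1) = (J - D.*2) * h)%N.
  by rewrite mulnBl -EJ ED2; clear -kE l0; lia.
have DJ : (D.*2 <= J)%N.
  by rewrite -(leq_pmul2r h0) -EJ ED2; clear -kn; lia.
have DJ1 : (D <= J)%N by clear -DJ; lia.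
have mn : (m.*2.*2 <= n)%N by clear -kn kE; lia.
have mn1 : (m.*2 <= n)%N by clear -mn; lia.
have md1 : (m + D <= 4 * tree_size T)%N by clear -DT kE; lia.
have md2 : (m.*2 + D.*2 <= 4 * tree_size T)%N by clear -DT kE; lia.
have l1 : (l <= n - m)%N by clear -kn kE; lia.
have l2 : (l.-1.*2 + 1 <= n - m.*2)%N by clear -kn kE l0; lia.
rewrite !(walk_coef_lattice mean_xi var_xi_gt0 var_xi_fin span_xi) ?l1 ?l2 ?leq_subr //.
rewrite J1 J2 !dvdn_mull // !mulnK //; split.
  by have := key m D md1 mn1 DJ1; rewrite ler_norml => /andP[_]; lra.
rewrite le_min walk_prob_le1 //=; last 2 first.
- exact: lattice_ge0.
- by have [] := lattice_mass mean_xi var_xi_gt0 var_xi_fin span_xi.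
by have := key m.*2 D.*2 md2 mn DJ; rewrite ler_norml => /andP[+ _]; lra.
Qed.

(** With a_n = P(S_n = n - 1) >= c / sqrt n, the second moment of N / y - 1 is at most
    (O(k / n) + 1 / n) / a_n plus O(1 / y) from the grafts, and
    k / sqrt n <= 1 / sqrt n + B / sqrt y by [size_sqrt_pattern_weight]. *)
Lemma tail_bounds : exists2 C : R, 0 < C & exists n0 : nat, forall n T, (n0 <= n)%N ->
  (n = 1 %[mod h])%N -> (4 * tree_size T <= n)%N -> forall e, 0 < e ->
  let y : R := n%:R * pattern_weight law T in
  prGWn X n [set t | e < `|(Nnf T t)%:R - 0|] <= C / e * y /\
  (0 < pattern_weight law T -> prGWn X n [set t | e < `|(Nnf T t)%:R / y - 1|] <=
     C / e ^+ 2 * ((Num.sqrt n%:R)^-1 + (Num.sqrt y)^-1 + y^-1)).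
Proof.
have [c c0 [n1 Hc]] := lattice_lower mean_xi var_xi_gt0 var_xi_fin span_xi.
have [C2 C20 H2] := mean_occ_le.
have [C3 C30 H3] := moment_coef_bounds.
have l0 := law0_gt0 mean_xi var_xi_gt0 var_xi_fin.
have p0 := law_ge0 xi.
have [V HV] := law_sqr mean_xi var_xi_gt0 var_xi_fin.
have c1 : 0 <= 1 - law 0 < 1.
  rewrite ltrBlDr ltrDl l0 andbT subr_ge0.
  by have [H _] := law_mass xi; have := H 1%N; rewrite big_ord1.
have pV k : law k * k%:R ^+ 2 <= V.
  apply: le_trans (HV k.+1); rewrite big_ord_recr /= lerDr sumr_ge0 // => i _.
  by rewrite mulr_ge0 ?sqr_ge0.
have [B B0 HB] := size_sqrt_pattern_weight p0 c1 (@law_le _ _ _ _ xi) pV.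
(* C3 and B come from the two point probabilities and from the size of T,
   C2 / law 0 from the grafts, and the last C2 from the first moment. *)
pose C := (3 * C3 + 1 + 3 * C3 * B + 2 * C2 / law 0 + C2) / c.
exists C => [|]; first by rewrite divr_gt0 // !addr_gt0 ?divr_gt0 ?mulr_gt0.
exists (maxn n1 1) => n T; rewrite geq_max => /andP[nn1 n0] nh kn e e0 y.
have n0' : 0 < n%:R :> R by rewrite ltr0n.
set r := Num.sqrt n%:R.
have r0 : 0 < r by rewrite sqrtr_gt0.
have rr : r * r = n%:R by rewrite -expr2 sqr_sqrtr // ltW.
have [En hn] := partition_fun nh n0.
have anc : c / r <= n%:R * Z n.
  by rewrite En; apply: Hc => //; rewrite mulnC divnK // prednK.
have Z0 : 0 < Z n.
  by rewrite -(pmulr_rgt0 _ n0') (lt_le_trans _ anc) // divr_gt0.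
have Zle : c <= r * n%:R * Z n.
  by move: anc; rewrite ler_pdivrMr // => /le_trans; apply; rewrite mulrC mulrA.
have y0 : 0 <= y by rewrite mulr_ge0 ?pattern_weight_ge0.
have mT S : (inner_nodes S <= tree_size S)%N by rewrite tree_sizeE leq_addr.
have u1 : 0 <= 3 * C3 by rewrite mulr_ge0 // ltW.
have u2 : 0 <= 3 * C3 * B by rewrite mulr_ge0 // ltW.
have u3 : 0 <= 2 * C2 / law 0 by rewrite divr_ge0 ?mulr_ge0 ?(ltW C20) // ltW.
split.
  under [X in prGWn _ _ X]eq_set do rewrite subr0 ger0_norm //.
  apply: le_trans (prGWn_markov e0 Z0 (fun t => ler0n R _)) _.
  have CC2 : C2 / c <= C.
    rewrite /C ler_wpM2r ?invr_ge0 ?(ltW c0) // lerDr.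
    by do 3!rewrite addr_ge0 //.
  rewrite (forest_sum_Nnf id) ler_pdivrMr ?mulr_gt0 //.
  have mn : ((inner_nodes T).*2 <= n)%N by have := mT T; clear -kn; lia.
  have HE := H2 n T mn n0; rewrite -/r in HE.
  apply: le_trans HE _.
  have -> : C / e * y * (e * Z n) = C * pattern_weight law T * (n%:R * Z n).
    by rewrite /y; field; rewrite gt_eqF.
  apply: le_trans (_ : C2 / c * pattern_weight law T * (c / r) <= _).
    by apply: le_of_eq; field; rewrite !gt_eqF.
  apply: ler_pM => //.
  - by rewrite mulr_ge0 ?pattern_weight_ge0 // divr_ge0 // ltW.
  - by rewrite divr_ge0 // ltW.
  - by rewrite ler_wpM2r ?pattern_weight_ge0.
move=> pT; have yp : 0 < y by rewrite mulr_gt0.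
set k : R := (tree_size T)%:R.
have [S1 S2] := H3 n T nh n0 kn pT.
set an := n%:R * Z n in S1 S2 anc.
set pc1 := walk_coef _ _ _ (leaves T) _ in S1; set pc2 := walk_coef _ _ _ _ _ in S2.
have E1 : EN T n = pattern_weight law T * pc1.
  by rewrite (forest_sum_occ _ _ _ (leq_lattice n)) mul1r add1n prednK ?leaves_gt0.
have E2 : forest_sum law n 1 (fun phi => (occ T phi)%:R ^+ 2) <=
    (n%:R + 1) * pattern_weight law T ^+ 2 * pc2 + 2 * (C2 / r * (pattern_weight law T / law 0)).
  have := forest_sum_occ_sqr p0 T 1 (leq_lattice n); rewrite mul1r -/pc2 => HU.
  have SQ : \sum_(Q <- grafts T T) EN Q n <= C2 / r * (pattern_weight law T / law 0).
    apply: le_trans (_ : \sum_(Q <- grafts T T) C2 / r * pattern_weight law Q <= _).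
      rewrite !big_seq; apply: ler_sum => Q /tree_size_grafts QT.
      rewrite mulrAC; apply: H2 => //; have := mT Q; clear -QT kn; lia.
    rewrite -big_distrr ler_wpM2l ?divr_ge0 ?(ltW C20) ?(ltW r0) //=.
    apply: le_trans (sum_grafts p0 T T c1 (@law_le _ _ _ _ xi)) _.
    have -> : 1 - (1 - law 0) = law 0 by ring.
    rewrite ler_wpM2l ?pattern_weight_ge0 // -[leRHS]mul1r ler_wpM2r ?invr_ge0 ?(ltW l0) //.
    by rewrite gerBl exprn_ge0 //; case/andP: c1.
  have -> : forest_sum law n 1 (fun phi => (occ T phi)%:R ^+ 2) =
     forest_sum law n 1 (fun phi => (occ T phi)%:R ^+ 2 -
        2 * (\sum_(Q <- grafts T T) (occ Q phi)%:R)) + 2 * \sum_(Q <- grafts T T) EN Q n.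
    rewrite -forest_sum_sum -forest_sumZ -forest_sumD; apply: eq_forest_sum => phi _; ring.
  apply: lerD; last by rewrite ler_wpM2l.
  apply: le_trans HU _; rewrite ler_wpM2r ?walk_coef_ge0 // ler_wpM2r ?sqr_ge0 //.
  by rewrite natr1 ler_nat ltnS leq_subr.
have e20 : 0 < e ^+ 2 by rewrite exprn_gt0.
have MK : prGWn X n [set t | e < `|(Nnf T t)%:R / y - 1|] <=
   forest_sum law n 1 (fun phi => ((occ T phi)%:R / y - 1) ^+ 2) / (e ^+ 2 * Z n).
  rewrite -(forest_sum_Nnf (fun x => (x / y - 1) ^+ 2)).
  apply: le_trans (prGWn_markov e20 Z0 (fun t => sqr_ge0 ((Nnf T t)%:R / y - 1))).
  apply: le_of_eq; congr (prGWn _ _ _).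
  have sqE (x : R) : (e < `|x|) = (e ^+ 2 < x ^+ 2).
    by rewrite -(real_normK (num_real x)) ltr_pXn2r ?nnegrE ?(ltW e0).
  by apply/seteqP; split=> t /=; rewrite sqE.
apply: le_trans MK _.
have -> : forest_sum law n 1 (fun phi => ((occ T phi)%:R / y - 1) ^+ 2) =
   forest_sum law n 1 (fun phi => (occ T phi)%:R ^+ 2) / y ^+ 2 - 2 / y * EN T n + Z n.
  rewrite [X in X - _]mulrC -mulNr -!forest_sumZ -!forest_sumD; apply: eq_forest_sum => phi _.
  by field; rewrite gt_eqF.
rewrite ler_pdivrMr ?mulr_gt0 //.
have -> : C / e ^+ 2 * (r^-1 + (Num.sqrt y)^-1 + y^-1) * (e ^+ 2 * Z n) =
   C * (r^-1 + (Num.sqrt y)^-1 + y^-1) * Z n by field; rewrite !gt_eqF ?sqrtr_gt0.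
have Z1 : Z n = an / n%:R by rewrite /an mulrC mulKf // gt_eqF.
set q := Num.sqrt (pattern_weight law T).
have q0 : 0 < q by rewrite sqrtr_gt0.
have sy : Num.sqrt y = r * q by rewrite /y sqrtrM // ltW.
have kq : k * r^-1 <= r^-1 + B / Num.sqrt y.
  have := HB T; rewrite -/q => HBT.
  have : k - 1 <= B / q.
    rewrite ler_pdivlMr //; apply: le_trans HBT; rewrite ler_wpM2r ?(ltW q0) //.
    by rewrite /k lerBlDr natr1 ler_nat leqSpred.
  move=> Hk; rewrite sy; have -> : r^-1 + B / (r * q) = (1 + B / q) * r^-1.
    by field; rewrite !gt_eqF.
  by rewrite ler_wpM2r ?invr_ge0 ?(ltW r0) //; lra.
have pc1_ge : an - C3 * k / n%:R <= pc1 by [].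
have pc21 : pc2 <= 1 by move: S2; rewrite le_min => /andP[].
have pc2_le : pc2 <= an + C3 * k / n%:R by move: S2; rewrite le_min => /andP[].
have M1 : forest_sum law n 1 (fun phi => (occ T phi)%:R ^+ 2) / y ^+ 2 - 2 / y * EN T n + Z n <=
   (3 * C3 * k + 1) / n%:R / n%:R + 2 * C2 / law 0 / r * pattern_weight law T / y ^+ 2.
  apply: le_trans (_ : ((n%:R + 1) * pattern_weight law T ^+ 2 * pc2 + 2 * (C2 / r * (pattern_weight law T / law 0)))
     / y ^+ 2 - 2 / y * (pattern_weight law T * pc1) + an / n%:R <= _).
    by rewrite E1 -Z1 lerD2r lerD2r ler_wpM2r ?invr_ge0 ?sqr_ge0.
  have -> : ((n%:R + 1) * pattern_weight law T ^+ 2 * pc2 + 2 * (C2 / r * (pattern_weight law T / law 0)))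
     / y ^+ 2 - 2 / y * (pattern_weight law T * pc1) + an / n%:R =
     (pc2 - 2 * pc1 + an + pc2 / n%:R) / n%:R + 2 * C2 / law 0 / r * pattern_weight law T / y ^+ 2.
    by rewrite /y; field; rewrite !gt_eqF.
  rewrite lerD2r ler_wpM2r ?invr_ge0 //.
  have P2 : pc2 / n%:R <= 1 / n%:R by rewrite ler_wpM2r ?invr_ge0.
  have -> : (3 * C3 * k + 1) / n%:R = 3 * (C3 * k / n%:R) + 1 / n%:R by ring.
  lra.
apply: le_trans M1 _.
apply: le_trans (_ : (3 * C3 * (r^-1 + B / Num.sqrt y) + r^-1 + 2 * C2 / law 0 / y) / c * Z n <= _).
  have cZ : r^-1 <= Z n * n%:R / c by rewrite ler_pdivlMr // mulrC (mulrC (Z n)) -/an.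
  have -> : (3 * C3 * k + 1) / n%:R / n%:R + 2 * C2 / law 0 / r * pattern_weight law T / y ^+ 2 =
     ((3 * C3 * k + 1) * r^-1 + 2 * C2 / law 0 / y) / n%:R * r^-1.
    by rewrite /y -rr; field; rewrite !gt_eqF.
  apply: le_trans (_ : (3 * C3 * (r^-1 + B / Num.sqrt y) + r^-1 + 2 * C2 / law 0 / y) / n%:R
     * (Z n * n%:R / c) <= _); last first.
    by apply: le_of_eq; field; rewrite !gt_eqF ?sqrtr_gt0.
  have k0 : 0 <= k by exact: ler0n.
  rewrite ler_pM ?invr_ge0 ?(ltW r0) //.
    apply: divr_ge0 => //; apply: addr_ge0; last by rewrite divr_ge0.
    by rewrite mulr_ge0 ?invr_ge0 ?(ltW r0) // addr_ge0 // mulr_ge0.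
  rewrite ler_wpM2r ?invr_ge0 // lerD2r mulrDl mul1r lerD2r -!mulrA ler_wpM2l //.
  by rewrite ler_wpM2l ?(ltW C30).
rewrite ler_wpM2r ?(ltW Z0) //.
have ir : 0 <= r^-1 by rewrite invr_ge0 ltW.
have isy : 0 <= (Num.sqrt y)^-1 by rewrite invr_ge0 sqrtr_ge0.
have iy : 0 <= y^-1 by rewrite invr_ge0 ltW.
rewrite /C [leRHS]mulrAC ler_wpM2r ?invr_ge0 ?(ltW c0) //.
rewrite mulrDr [3 * C3 * (B / _)]mulrA.
move: (3 * C3 * B) (2 * C2 / law 0) (3 * C3) u1 u2 u3 => v2 v3 v1 u1 u2 u3.
by have := ltW C20; nra.
Qed.
End TailBounds.

Lemma inv_sqrt_cvg0 (R : realType) (I : Type) (F : set_system I) (FF : Filter F) (f : I -> R) :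
  f x @[x --> F] --> +oo ->
  (f x)^-1 @[x --> F] --> (0 : R) /\ (Num.sqrt (f x))^-1 @[x --> F] --> (0 : R).
Proof.
move=> fy; have f0 : \forall x \near F, 0 < f x by move/cvgryPgt : fy; exact.
have inv0 : (f x)^-1 @[x --> F] --> (0 : R) by apply/gtr0_cvgV0.
split=> //; have : Num.sqrt (f x)^-1 @[x --> F] --> Num.sqrt (0 : R).
  by apply: continuous_cvg => //; exact: sqrt_continuous.
rewrite sqrtr0; apply: cvg_trans; apply: near_eq_cvg.
by near=> x; rewrite sqrtrV // ltW //; near: x.
Unshelve. all: by end_near.
Qed.

Theorem theorem4 (R : realType)
  (d0 : measure_display) (Omega0 : measurableType d0)
  (P0 : probability Omega0 R) (xi : {RV P0 >-> nat}) (h : nat)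
  (d : measure_display) (Omega : measurableType d) (P : probability Omega R)
  (X : seq nat -> {RV P >-> nat}) (T : nat -> plane_tree) (k : nat -> nat)
  (mean_xi : ('E_P0[fun w => (xi w)%:R%R : R] = 1)%E)
  (var_xi_gt0 : (0 < 'V_P0[fun w => (xi w)%:R%R : R])%E)
  (var_xi_fin : ('V_P0[fun w => (xi w)%:R%R : R] < +oo)%E)
  (span_xi : is_span xi h)
  (iid_X : iid_copies xi X)
  (size_T : forall n, tree_size (T n) = k n)
  (k_infty : k n @[n --> along h] --> \oo)
  (k_littleo : (k n)%:R / n%:R @[n --> along h] --> (0 : R)) :
  (n%:R * pi_nf X (T n) @[n --> along h] --> (0 : R) ->
     cvg_in_probability X (along h) (fun n t => (Nnf (T n) t)%:R) 0)
  /\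
  (n%:R * pi_nf X (T n) @[n --> along h] --> +oo ->
     cvg_in_probability X (along h)
       (fun n t => (Nnf (T n) t)%:R / (n%:R * pi_nf X (T n))) 1).
Proof.
have FF : Filter (along h) by apply: within_filter.
have piE n : pi_nf X (T n) = pattern_weight (law xi) (T n).
  exact: (pi_nf_pattern_weight mean_xi var_xi_gt0 var_xi_fin iid_X).
have [C C0 [n0 H]] := tail_bounds mean_xi var_xi_gt0 var_xi_fin span_xi iid_X.
have good : \forall n \near along h,
    [/\ (n0 <= n)%N, (n = 1 %[mod h])%N & (4 * tree_size (T n) <= n)%N].
  have A1 : \forall n \near along h, (maxn n0 1 <= n)%N.
    exact: (cvg_within _ (nbhs_infty_ge (maxn n0 1))).
  have A2 : \forall n \near along h, (n = 1 %[mod h])%N by exact: near_withinT.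
  (* Two disjoint copies of T should fill at most half of the tree. *)
  have e4 : 0 < 4^-1 :> R by [].
  have A3 : \forall n \near along h, `|0 - (k n)%:R / n%:R| < 4^-1 :> R.
    by move/cvgrPdist_lt : k_littleo; apply.
  near=> n.
  have /[!geq_max]/andP[n0n n1] : (maxn n0 1 <= n)%N by near: n.
  split=> //; first by near: n.
  have : `|0 - (k n)%:R / n%:R| < 4^-1 :> R by near: n.
  rewrite sub0r normrN ger0_norm ?divr_ge0 // ltr_pdivrMr ?ltr0n // => kn.
  rewrite size_T -(ler_nat R) natrM; move: kn; move: (n%:R : R) ((k n)%:R : R) => u v; lra.
have prob_ge0 n A : 0 <= prGWn X n A.
  rewrite (prGWnE iid_X) divr_ge0 // sumr_ge0 // => phi _; rewrite mulr_ge0 ?forest_weight_ge0 //;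
  exact: law_ge0.
split=> Hpi e e0.
- have lim : C / e * (n%:R * pi_nf X (T n)) @[n --> along h] --> (0 : R).
    by rewrite -[X in _ --> X](mulr0 (C / e)); apply: cvgM => //; exact: cvg_cst.
  apply: (squeeze_cvgr _ (cvg_cst 0) lim).
  near=> n; rewrite prob_ge0 /= piE.
  have [n0n nh kn] : [/\ (n0 <= n)%N, (n = 1 %[mod h])%N & (4 * tree_size (T n) <= n)%N].
    by near: n.
  by have [] := H n (T n) n0n nh kn e e0.
- have [y1 y2] := inv_sqrt_cvg0 FF Hpi.
  have ny : (n%:R : R) @[n --> along h] --> +oo by apply: cvg_within_filter; exact: cvgr_idn.
  have [_ n2] := inv_sqrt_cvg0 FF ny.
  have lim : C / e ^+ 2 * ((Num.sqrt n%:R)^-1 + (Num.sqrt (n%:R * pi_nf X (T n)))^-1 +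
     (n%:R * pi_nf X (T n))^-1) @[n --> along h] --> (0 : R).
    rewrite -[X in _ --> X](mulr0 (C / e ^+ 2)); apply: cvgM; first exact: cvg_cst.
    rewrite -[X in _ --> X](addr0 0); apply: cvgD => //.
    by rewrite -[X in _ --> X](addr0 0); apply: cvgD.
  apply: (squeeze_cvgr _ (cvg_cst 0) lim).
  have pos : \forall n \near along h, 0 < n%:R * pi_nf X (T n).
    by move/cvgryPgt : Hpi; exact.
  near=> n; rewrite prob_ge0 /=.
  have [n0n nh kn] : [/\ (n0 <= n)%N, (n = 1 %[mod h])%N & (4 * tree_size (T n) <= n)%N].
    by near: n.
  have [_] := H n (T n) n0n nh kn e e0; rewrite -piE; apply.
  have : 0 < n%:R * pi_nf X (T n) by near: n.
  rewrite pmulr_rgt0 // ltr0n lt0n; apply: contraTneq kn => ->.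
  by case: (T 0%N).
Unshelve. all: by end_near.
Qed.
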